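(* Let $\Gamma_0$ be a cocompact Fuchsian group, let $\Gamma\vartriangleleft\Gamma_0$ and let $\delta\ge\delta(\Gamma)$. Then the following mapping $\psi$ is an affine bijection between the Radon eigenmeasures of $L_{\phi^{X,\delta}}$ for eigenvalue $1$ and the $(\Gamma,\delta)$-conformal measures: for a Radon eigenmeasure $\mu_X$ and a Borel set $E\subseteq\partial\mathbb{D}$, $$\psi(\mu_X)(E)=\mu_X\bigl(\pi_\Sigma^{-1}(E)\times\{\Gamma\}\bigr).$$
   Context: $\mathbb{D}=\{|z|<1\}$ carries the hyperbolic metric $d_{\mathbb D}$; $\partial\mathbb{D}=\{|z|=1\}$. A Fuchsian group is a discrete group of Möbius transformations preserving $\mathbb D$; $\Gamma_0$ is cocompact if $\mathbb{D}/\Gamma_0$ is compact. $\delta(\Gamma)$ is the critical exponent of $\Gamma$: the series $\sum_{\gamma\in\Gamma}e^{-\delta d_{\mathbb D}(0,\gamma 0)}$ converges for all $\delta>\delta(\Gamma)$ and diverges for all $\delta<\delta(\Gamma)$. A finite positive measure $\mu$ on $\partial\mathbb D$ is $(\Gamma,\delta)$-conformal if $\frac{d(\mu\circ\gamma)}{d\mu}=|\gamma'|^\delta$ for all $\gamma\in\Gamma$, where $(\mu\circ\gamma)(A)=\mu(\gamma A)$. Bowen–Series coding: with respect to a fundamental domain $F_0\subseteq\mathbb D$ of $\mathbb D/\Gamma_0$, Bowen and Series constructed a finite partition $\{I_a\}_{a\in S_0}$ of $\partial\mathbb D$ into closed arcs with disjoint interiors, a finite set $\{e_a\}_{a\in S_0}\subseteq\Gamma_0$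 and a map $f_{\Gamma_0}:\partial\mathbb D\to\partial\mathbb D$ with the properties: (Gen) $\{e_a\}$ is symmetric and generates $\Gamma_0$; (Res) $f_{\Gamma_0}=e_a^{-1}$ on $\mathrm{int}(I_a)$; (Mar) if $\mathrm{int}(f_{\Gamma_0}(I_a))\cap\mathrm{int}(I_b)\ne\varnothing$ then $I_b\subseteq f_{\Gamma_0}(I_a)$; (Tr) for all $a,b\in S_0$ there is $n$ with $f_{\Gamma_0}^n(I_a)\supseteq I_b$; (Orb) for all except finitely many $\xi_1,\xi_2\in\partial\mathbb D$: $f_{\Gamma_0}^n(\xi_1)=f_{\Gamma_0}^m(\xi_2)$ for some $n,m\in\mathbb N$ iff $\xi_1=\gamma_0(\xi_2)$ for some $\gamma_0\in\Gamma_0$; (Bnd) there is $N_0$ such that each $\gamma_0\in\Gamma_0$, $\gamma_0\ne id$, equals $e_{a_n}^{-1}\cdots e_{a_0}^{-1}$ for at most $N_0$ words $(a_0,\dots,a_n)$ (over all $n\ge0$) with $\mathrm{int}(\bigcap_{i=0}^n f_{\Gamma_0}^{-i}(I_{a_i}))\neq\varnothing$; (Dist) there is $B>1$ such that $|(f_{\Gamma_0}^{n-1})'(\xi_1)|\le B|(f_{\Gamma_0}^{n-1})'(\xi_2)|$ whenever $a_1,\dots,a_n\in S_0$ and $f_{\Gamma_0}^k\xi_i=e_{a_k}^{-1}\cdots e_{a_1}^{-1}\xi_i$ for $k=1,\dots,n$, $i=1,2$. $\Sigma=\{(\sigma_i)_{i\ge0}:\sigma_i\in S_0,\ \mathrm{int}(I_{\sigma_{i+1}})\subseteq\mathrm{int}(f_{\Gamma_0}(I_{\sigma_i}))\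 \forall i\ge0\}$, and $\pi_\Sigma:\Sigma\to\partial\mathbb D$ sends $\sigma$ to the unique point of $\bigcap_{n\ge0}\overline{f_{\Gamma_0}^{-n}I_{\sigma_n}}$. Let $G=\Gamma_0/\Gamma$. $X$ is the set of sequences $((\sigma_0,\gamma_0\Gamma),(\sigma_1,\gamma_1\Gamma),\dots)$ with $(\sigma_i)\in\Sigma$, $\gamma_i\Gamma\in G$ and $\gamma_{i+1}\Gamma=e_{\sigma_i}^{-1}\gamma_i\Gamma$ for all $i\ge0$; $T$ is the left shift. $X$ is identified with $\Sigma\times G$ by recording $\sigma$ and $\gamma_0\Gamma$. Put $\phi^{X,\delta}(\sigma,\gamma\Gamma)=-\delta\log|(e_{\sigma_0}^{-1})'(\pi_\Sigma(\sigma))|$ and $(L_{\phi^{X,\delta}}f)(x)=\sum_{y:Ty=x}e^{\phi^{X,\delta}(y)}f(y)$ (the Ruelle operator). A Radon eigenmeasure of $L_{\phi^{X,\delta}}$ for eigenvalue $1$ is a positive Radon measure $\mu_X$ on $X$ with $\mu_X(L_{\phi^{X,\delta}}f)=\mu_X(f)$ for all continuous compactly supported $f$.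
   Formalization: Γ is taken nontrivial (δ(Γ) is a real number; for trivial Γ the map ψ is not injective), and π_Σ(σ) is the point common to the closures of the interiors of all cylinders I_{σ_0}∩…∩f^{-n}I_{σ_n}, since the intersection of the closures of the sets f^{-n}I_{σ_n} need not be a single point. *)

(* Defs.v *)
From HB Require Import structures.
From mathcomp Require Import all_boot all_order all_algebra.
From mathcomp Require Import all_classical all_reals all_analysis.
From mathcomp Require Import complex.
Set Implicit Arguments.
Unset Strict Implicit.
Unset Printing Implicit Defensive.
Import Order.TTheory GRing.Theory Num.Theory.
Import numFieldNormedType.Exports.
Local Open Scope classical_set_scope.
Local Open Scope ring_scope.

(* The name [Cplx R] is a [numClosedFieldType] (not the bare carrier [R[i]]) so
   that the topology and the norm of normed fields are found on it. *)
Definition Cplx (R : realType) : numClosedFieldType := R[i].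

(* [`|z|] lives in [Cplx R]; this is the same number as an element of [R]. *)
Definition cabs (R : realType) (z : Cplx R) : R := complex.Re `|z|.

(* [None] is the point at infinity. *)
Definition sphere (R : realType) : Type := option (Cplx R).
Definition smap (R : realType) : Type := sphere R -> sphere R.

Definition moebius (R : realType) (A : 'M[Cplx R]_2) : smap R := fun p =>
  if p is Some z then
    let d := A 1 0 * z + A 1 1 in
    if d == 0 then None else Some ((A 0 0 * z + A 0 1) / d)
  else if A 1 0 == 0 then None else Some (A 0 0 / A 1 0).

Definition is_moebius (R : realType) (g : smap R) : Prop :=
  exists2 A : 'M[Cplx R]_2, \det A != 0 & g = moebius A.

(* The inverse of [g]; only used for bijective [g]. *)
Definition sinv (R : realType) (g : smap R) : smap R :=
  fun p => xget None [set q | g q = p].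

(* [g] as a map on finite points (0 if [g z] is infinite), and the modulus of
   its complex derivative. *)
Definition finpart (R : realType) (g : smap R) (z : Cplx R) : Cplx R :=
  odflt 0 (g (Some z)).
Definition mderiv (R : realType) (g : smap R) (z : Cplx R) : R :=
  cabs (derive1 (finpart g) z).

Definition disc (R : realType) : set (Cplx R) := [set z | `|z| < 1].

Definition preserves_disc (R : realType) (g : smap R) : Prop :=
  g @` (Some @` @disc R) = Some @` @disc R.

Definition is_subgroup (R : realType) (H : set (smap R)) : Prop :=
  [/\ H id, forall g h, H g -> H h -> H (g \o h)
    & forall g, H g -> H (sinv g)].

(* Discreteness in PSL_2(C): the preimage in SL_2(C) is a discrete set. *)
Definition is_discrete (R : realType) (H : set (smap R)) : Prop :=
  forall A : 'M[Cplx R]_2, \det A = 1 -> H (moebius A) ->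
    \forall B \near A, \det B = 1 -> H (moebius B) -> B = A.

Definition fuchsian (R : realType) (H : set (smap R)) : Prop :=
  [/\ is_subgroup H, forall g, H g -> is_moebius g /\ preserves_disc g
    & is_discrete H].

(* Compactness of the quotient space D/H: its open sets are the H-invariant
   open subsets of D, so this is the open cover property of D/H pulled back
   to D. *)
Definition cocompact (R : realType) (H : set (smap R)) : Prop :=
  forall U : set (set (Cplx R)),
    (forall V, U V -> [/\ open V, V `<=` @disc R
       & forall g z, H g -> V z -> V (finpart g z)]) ->
    @disc R `<=` \bigcup_(V in U) V ->
    exists U' : set (set (Cplx R)),
      [/\ finite_set U', U' `<=` U & @disc R `<=` \bigcup_(V in U') V].

Definition normal_subgroup (R : realType) (N H : set (smap R)) : Prop :=
  [/\ is_subgroup N, N `<=` H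
    & forall g h, H g -> N h -> N (g \o h \o sinv g)].

(* The hyperbolic distance of curvature -1. *)
Definition hdist (R : realType) (z w : Cplx R) : R :=
  let t := cabs ((z - w) / (1 - w^* * z)) in ln ((1 + t) / (1 - t)).

Definition poincare_series (R : realType) (H : set (smap R)) (s : R) : \bar R :=
  (\esum_(g in H) (expR (- s * hdist 0 (finpart g 0)))%:E)%E.

(* [d] is a real number, so an infinite [H] is implied: for a finite group the
   series never diverges and there is no such [d]. *)
Definition critical_exponent (R : realType) (H : set (smap R)) (d : R) : Prop :=
  (forall s, d < s -> (poincare_series H s < +oo)%E) /\
  (forall s, s < d -> poincare_series H s = +oo%E).

Definition circle_set (R : realType) : set (Cplx R) := [set z | `|z| = 1].
Definition circle (R : realType) : Type := set_type (@circle_set R).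
HB.instance Definition _ (R : realType) := Topological.on (circle R).

Lemma circle1_subproof (R : realType) : (1 : Cplx R) \in @circle_set R.
Proof. by rewrite inE /circle_set /= normr1. Qed.
Definition circle1 (R : realType) : circle R := SigSub (circle1_subproof R).
HB.instance Definition _ (R : realType) := isPointed.Build (circle R) (circle1 R).

Definition borel_circle (R : realType) :=
  g_sigma_algebraType (@open (circle R)).

Definition on_sphere (R : realType) (xi : circle R) : sphere R :=
  Some (set_val xi).

Definition circle_image (R : realType) (g : smap R) (A : set (circle R)) :
    set (circle R) :=
  [set eta | exists2 xi, A xi & g (on_sphere xi) = on_sphere eta].

(* d(mu o g)/dmu = |g'|^d for all g in H *)
Definition conformal (R : realType) (H : set (smap R)) (d : R)
    (mu : {measure set (borel_circle R) -> \bar R}) : Prop :=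
  (mu setT < +oo)%E /\
  forall g, H g -> forall A : set (borel_circle R), measurable A ->
    mu (circle_image g A) =
    (\int[mu]_(xi in A) ((mderiv g (set_val xi)) `^ d)%:E)%E.

Definition circle_quot (R : realType) (h : circle R -> circle R)
    (xi eta : circle R) : Cplx R :=
  (set_val (h eta) - set_val (h xi)) / (set_val eta - set_val xi).
Definition circle_derivable (R : realType) (h : circle R -> circle R)
    (xi : circle R) : Prop := cvg (circle_quot h xi eta @[eta --> xi^']).
Definition circle_deriv (R : realType) (h : circle R -> circle R)
    (xi : circle R) : R := cabs (lim (circle_quot h xi eta @[eta --> xi^'])).

Definition closed_arc (R : realType) (A : set (circle R)) : Prop :=
  exists a b : R, [/\ a < b, b < a + 2 * pi
    & A = [set xi | exists2 t : R, a <= t <= b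
                    & set_val xi = Complex (cos t) (sin t)]].

(* [winv e [:: a_1; ...; a_n]] is e_(a_n)^-1 ... e_(a_1)^-1 *)
Definition winv (R : realType) (S0 : Type) (e : S0 -> smap R) (w : seq S0) :
    smap R := foldl (fun g a => sinv (e a) \o g) id w.

(* [cyl I f [:: a_0; ...; a_n]] is the intersection of the f^-i(I_(a_i)) *)
Fixpoint cyl (T S0 : Type) (I : S0 -> set T) (f : T -> T) (w : seq S0) :
    set T :=
  if w is a :: w' then I a `&` f @^-1` (cyl I f w') else setT.

(* At the finitely many endpoints of the arcs the two one-sided branches of
   [f] differ in general while [f] takes a single value, so the image of a
   closed arc need not be closed. Hence the closures in [bs_markov] and
   [bs_trans]; they change nothing when [f I_a] and [f^n I_a] are closed.
   For the same reason [bs_dist] compares the derivatives at points where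
   they exist. *)
Record bowen_series (R : realType) (G0 : set (smap R)) (S0 : finType)
    (I : S0 -> set (circle R)) (e : S0 -> smap R)
    (f : circle R -> circle R) : Prop := BowenSeries {
  bs_arc : forall a, closed_arc (I a);
  bs_cover : \bigcup_a I a = setT;
  bs_disj : forall a b, a != b -> (I a)° `&` (I b)° = set0;
  bs_in : forall a, G0 (e a);
  bs_sym : forall a, exists b, e b = sinv (e a);
  bs_gen : forall H, is_subgroup H -> (forall a, H (e a)) -> G0 `<=` H;
  bs_res : forall a xi, (I a)° xi ->
    on_sphere (f xi) = sinv (e a) (on_sphere xi);
  bs_markov : forall a b, (f @` I a)° `&` (I b)° !=set0 ->
    I b `<=` closure (f @` I a);
  bs_trans : forall a b, exists n, I b `<=` closure (iter n f @` I a);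
  bs_orb : exists2 E : set (circle R), finite_set E &
    forall xi1 xi2, ~ E xi1 -> ~ E xi2 ->
      ((exists n m, iter n f xi1 = iter m f xi2) <->
       (exists2 g, G0 g & on_sphere xi1 = g (on_sphere xi2)));
  bs_bnd : exists N0 : nat, forall g, G0 g -> g <> id ->
    ([set w : seq S0 |
      [/\ w <> [::], (cyl I f w)° !=set0 & winv e w = g]] #<= `I_N0)%card;
  bs_dist : exists2 B : R, 1 < B &
    forall (w : seq S0) (xi1 xi2 : circle R), w <> [::] ->
      (forall k, (1 <= k <= size w)%N ->
         on_sphere (iter k f xi1) = winv e (take k w) (on_sphere xi1) /\
         on_sphere (iter k f xi2) = winv e (take k w) (on_sphere xi2)) ->
      let F := iter (size w).-1 f in
      circle_derivable F xi1 -> circle_derivable F xi2 ->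
      circle_deriv F xi1 <= B * circle_deriv F xi2
}.

Definition Sigma (R : realType) (S0 : finType) (I : S0 -> set (circle R))
    (f : circle R -> circle R) : set (nat -> S0) :=
  [set s | forall i, (I (s i.+1))° `<=` (f @` I (s i))°].

(* The point coded by [s]: the unique point in the nested closures of the
   interiors of the cylinders of [s]. The intersection of the closures of the
   single sets f^-n(I_(s n)) can contain more than one point: already for
   angle doubling coded by two half circles and s = 0 0 0 ..., it contains
   every 1/2^k. *)
Definition piSigma (R : realType) (S0 : finType) (I : S0 -> set (circle R))
    (f : circle R -> circle R) (s : nat -> S0) : circle R :=
  get [set xi | forall n, closure ((cyl I f (mkseq s n.+1))°) xi].

Definition lcoset (R : realType) (g : smap R) (H : set (smap R)) :
    set (smap R) := [set g \o h | h in H].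

Definition quotient_group (R : realType) (G0 G : set (smap R)) :
    set (set (smap R)) := [set lcoset g G | g in G0].

Definition seqs (R : realType) (S0 : finType) : Type :=
  prod_topology (fun _ : nat => discrete_topology (S0 * set (smap R))%type).
HB.instance Definition _ (R : realType) (S0 : finType) :=
  Topological.on (seqs R S0).

Definition letters (R : realType) (S0 : finType) (x : seqs R S0) : nat -> S0 :=
  fun i => (x i).1.

Definition Xset (R : realType) (G0 G : set (smap R)) (S0 : finType)
    (I : S0 -> set (circle R)) (e : S0 -> smap R)
    (f : circle R -> circle R) : set (seqs R S0) :=
  [set x | [/\ Sigma I f (letters x),
               forall i, quotient_group G0 G (x i).2
             & forall i, (x i.+1).2 = lcoset (sinv (e (x i).1)) (x i).2]].

(* The library's measurable spaces are pointed; this is [T] with base point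
   [x0], which plays no other role: the Borel sets do not depend on it. *)
Definition pointed_at (T : topologicalType) (x0 : T) : Type := T.
HB.instance Definition _ (T : topologicalType) (x0 : T) :=
  Topological.on (pointed_at x0).
HB.instance Definition _ (T : topologicalType) (x0 : T) :=
  isPointed.Build (pointed_at x0) x0.
Definition borel_at (T : topologicalType) (x0 : T) :=
  g_sigma_algebraType (@open (pointed_at x0)).

(* Borel measures finite on compact sets; regularity is automatic on [Xspace],
   which is locally compact with a countable basis. *)
Definition radon (R : realType) (T : topologicalType) (x0 : T)
    (mu : {measure set (borel_at x0) -> \bar R}) : Prop :=
  forall K : set T, compact K -> (mu K < +oo)%E.

Section Ruelle.
Variables (R : realType) (G0 G : set (smap R)) (S0 : finType).
Variables (I : S0 -> set (circle R)) (e : S0 -> smap R).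
Variables (f : circle R -> circle R) (d : R).

Definition Xspace : Type := set_type (Xset G0 G I e f).
HB.instance Definition _ := Topological.on Xspace.

Definition codepoint (x : Xspace) : circle R := piSigma I f (letters (set_val x)).

Definition phiX (x : Xspace) : R :=
  - d * ln (mderiv (sinv (e (letters (set_val x) 0%N)))
              (set_val (codepoint x))).

(* [y] is mapped to [x] by the left shift T *)
Definition shifts_to (y x : Xspace) : Prop :=
  forall i, set_val y i.+1 = set_val x i.

Definition ruelle (u : Xspace -> R) (x : Xspace) : R :=
  \sum_(y \in [set y | shifts_to y x]) (expR (phiX y) * u y).

Definition eigenmeasure (x0 : Xspace) (mu : {measure set (borel_at x0) -> \bar R}) :
    Prop :=
  radon mu /\
  forall u : Xspace -> R, continuous u -> compact (closure [set x | u x != 0]) ->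
    (\int[mu]_x (ruelle u x)%:E = \int[mu]_x (u x)%:E)%E.

Definition psi (x0 : Xspace) (mu : {measure set (borel_at x0) -> \bar R})
    (E : set (circle R)) : \bar R :=
  mu [set x : Xspace | E (codepoint x) /\ (set_val x 0%N).2 = G].

End Ruelle.

(* Main.v *)
(* Write G0, G for the two groups and M_H for the image on the circle, under the
   coding map, of the restriction of an eigenmeasure to the fibre over the coset H.
   The eigenmeasure equation says that the measure has Jacobian
   exp(- phi) on each one-letter cylinder, which on the circle reads
   M_(eH) o e = |e'|^delta M_H on an arc. Off a countable set the orbits of the
   Bowen-Series map are those of G0, so these local identities glue to
   M_(hH) o h = |h'|^delta M_H for all h in G0. Taking h in G gives conformality
   of M_G; letting h run through G0 recovers all M_H from M_G, hence injectivity;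
   and for a conformal nu the measures M_(hG) = |h'|^delta nu transported by h
   lift fibre by fibre to an eigenmeasure.
   The countable set is null because there are no atoms: by normality and
   nontriviality of G, a word in a code of a point can be enlarged by a loop in G at
   bounded cost for the derivative, so an atom would produce infinitely many
   points, converging to it, of mass bounded below. *)

Require Import Defs.
From HB Require Import structures.
From mathcomp Require Import all_boot all_order all_algebra.
From mathcomp Require Import all_classical all_reals all_analysis.
From mathcomp Require Import measurable_realfun lebesgue_integral.
From mathcomp Require Import complex ring lra.
Set Implicit Arguments.
Unset Strict Implicit.
Unset Printing Implicit Defensive.
Import Order.TTheory GRing.Theory Num.Theory.
Import numFieldNormedType.Exports.
Local Open Scope classical_set_scope.
Local Open Scope ring_scope.

(** At an arc endpoint [f] takes the value of at most one branch and a point may have several codes.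
    Cylinders are therefore cut out by the group elements [winv e w], which agree with iterates of
    [f] up to finite sets. Where codes must be unique, a countable [G0]-invariant set is removed; it
    also contains the fixed points of nontrivial elements, so that off it an equality of two images
    of a point is an equality of group elements. The critical exponent supplies two facts: [G] is
    infinite, hence nontrivial, and [delta] is nonnegative, so that t -> t^delta is monotone. Loops
    in [G] arise geometrically. Arbitrarily near every point of the circle, some element of [G]
    expands almost as much as its norm permits. A code shadows this element, so every admissible
    word extends to one within bounded distance of [G]. Only finitely many elements of [G0] have
    bounded norm, and a pigeonhole argument along nested extensions yields a word lying exactly in
    [G]. Moduli and distances are squared throughout, which keeps the estimates polynomial. *)

(** * Squared moduli of complex numbers *)

Section ComplexSquare.
Variable R : realType.
Implicit Types z w a b c d : Cplx R.

(** The squared modulus as an element of [R]: polynomial in the coordinates, so that [ring], [lra]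
    and [nra] apply to the estimates. *)
Definition sq z : R := complex.Re z ^+ 2 + complex.Im z ^+ 2.

Lemma cRe0 : complex.Re (0 : Cplx R) = 0. Proof. by []. Qed.
Lemma cIm0 : complex.Im (0 : Cplx R) = 0. Proof. by []. Qed.
Lemma cRe1 : complex.Re (1 : Cplx R) = 1. Proof. by []. Qed.
Lemma cIm1 : complex.Im (1 : Cplx R) = 0. Proof. by []. Qed.
Lemma cReD z w : complex.Re (z + w) = complex.Re z + complex.Re w.
Proof. by case: z; case: w. Qed.
Lemma cImD z w : complex.Im (z + w) = complex.Im z + complex.Im w.
Proof. by case: z; case: w. Qed.
Lemma cReN z : complex.Re (- z) = - complex.Re z.
Proof. by case: z. Qed.
Lemma cImN z : complex.Im (- z) = - complex.Im z.
Proof. by case: z. Qed.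
Lemma cReM z w :
  complex.Re (z * w) = complex.Re z * complex.Re w - complex.Im z * complex.Im w.
Proof. by case: z; case: w. Qed.
Lemma cImM z w :
  complex.Im (z * w) = complex.Re z * complex.Im w + complex.Im z * complex.Re w.
Proof. by case: z; case: w. Qed.
Lemma cReJ z : complex.Re (z^*) = complex.Re z.
Proof. by case: z. Qed.
Lemma cImJ z : complex.Im (z^*) = - complex.Im z.
Proof. by case: z. Qed.
Definition cE := (cRe0, cIm0, cRe1, cIm1, cReD, cImD, cReN, cImN, cReM, cImM,
  cReJ, cImJ).

Lemma cplxP z w : complex.Re z = complex.Re w -> complex.Im z = complex.Im w ->
  z = w.
Proof. by case: z => [x y]; case: w => [x' y'] /= -> ->. Qed.

Lemma sqM z w : sq (z * w) = sq z * sq w.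
Proof. rewrite /sq !cE; ring. Qed.
Lemma sq_ge0 z : 0 <= sq z.
Proof. by rewrite addr_ge0 ?sqr_ge0. Qed.
Lemma sq0 : sq 0 = 0. Proof. by rewrite /sq !cE expr0n /= addr0. Qed.
Lemma sq1 : sq 1 = 1. Proof. by rewrite /sq !cE expr0n expr1n /= addr0. Qed.
Lemma sqN z : sq (- z) = sq z. Proof. rewrite /sq !cE; ring. Qed.
Lemma sqJ z : sq z^* = sq z. Proof. rewrite /sq !cE; ring. Qed.
Lemma sqBC z w : sq (z - w) = sq (w - z). Proof. by rewrite -sqN opprB. Qed.
Lemma sq_eq0 z : (sq z == 0) = (z == 0).
Proof.
apply/eqP/eqP => [|->]; last exact: sq0.
move/eqP; rewrite /sq paddr_eq0 ?sqr_ge0// !sqrf_eq0 => /andP[/eqP h1 /eqP h2].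
by apply: cplxP; rewrite ?cE.
Qed.
Lemma sq_gt0 z : (0 < sq z) = (z != 0).
Proof. by rewrite lt_neqAle sq_ge0 andbT eq_sym sq_eq0. Qed.
Lemma sqV z : sq z^-1 = (sq z)^-1.
Proof.
have [->|z0] := eqVneq z 0; first by rewrite invr0 sq0 invr0.
apply: (mulfI (x := sq z)); first by rewrite sq_eq0.
by rewrite -sqM !mulfV ?sq1// sq_eq0.
Qed.
Lemma sqDJ z w : sq (z + w) = sq z + sq w + complex.Re (z * w^*) *+ 2.
Proof. rewrite /sq !cE; ring. Qed.
Lemma sqD_le z w : sq (z + w) <= sq z *+ 2 + sq w *+ 2.
Proof.
have := sq_ge0 (z - w); rewrite /sq !cE; nra.
Qed.
Lemma sq_dist_le z w u : sq (z - w) <= sq (z - u) *+ 2 + sq (u - w) *+ 2.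
Proof. by have := sqD_le (z - u) (u - w); rewrite subrKA. Qed.

Lemma mulJ z : z * z^* = (sq z)%:C%C.
Proof. by apply: cplxP; rewrite !cE /sq /=; ring. Qed.

Lemma norm_sq z : `|z| = (Num.sqrt (sq z))%:C%C.
Proof. by case: z. Qed.
Lemma cabs_sq z : cabs z = Num.sqrt (sq z).
Proof. by rewrite /cabs norm_sq. Qed.
Lemma norm_lt z (r : R) : 0 < r -> (`|z| < r%:C%C) = (sq z < r ^+ 2).
Proof.
move=> r0; rewrite norm_sq ltcR -[X in _ < X]ger0_norm ?ltW// -sqrtr_sqr.
by rewrite ltr_sqrt// exprn_gt0.
Qed.
Lemma norm_lt1 z : (`|z| < 1) = (sq z < 1).
Proof. by have := norm_lt z ltr01; rewrite expr1n. Qed.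
Lemma norm_eq1 z : (`|z| = 1) <-> (sq z = 1).
Proof.
rewrite norm_sq; split => [[] h|->]; last by rewrite sqrtr1.
by have := sqr_sqrtr (sq_ge0 z); rewrite h expr1n.
Qed.
End ComplexSquare.

(** * Derivatives of homographies *)

Section Homography.
Variable K : numFieldType.
Implicit Types a b c d z : K.

Lemma is_derive_affine a b z : is_derive z (1 : K) (a \*: (id : K -> K) + cst b) a.
Proof. by apply: is_derive_eq; rewrite addr0 -[RHS]mulr1. Qed.

Lemma derive_homography a b c d z : c * z + d != 0 ->
  'D_1 (fun w : K => (a * w + b) / (c * w + d)) z = (a * d - b * c) * (c * z + d)^-1 ^+ 2.
Proof.
move=> den.
have -> : (fun w : K => (a * w + b) / (c * w + d)) = (a \*: (id : K -> K) + cst b) *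
    (fun w => ((c \*: (id : K -> K) + cst d) w)^-1) by [].
set p := a \*: _ + _; set q := c \*: _ + _.
have [dp ep] := is_derive_affine a b z; have [dq eq] := is_derive_affine c d z.
have q0 : q z != 0 by exact: den.
rewrite deriveM//; last exact: derivableV.
rewrite deriveV// ep eq.
rewrite -[LHS]/(p z * (- q z ^- 2 * c) + (q z)^-1 * a).
rewrite -[c * z + d]/(q z).
have -> : p z * (- q z ^- 2 * c) + (q z)^-1 * a =
      (q z)^-1 ^+ 2 * (a * q z - c * p z) by field.
rewrite mulrC; congr (_ * _).
rewrite -[q z]/(c * z + d) -[p z]/(a * z + b); ring.
Qed.

Lemma det2 (A : 'M[K]_2) : \det A = A 0 0 * A 1 1 - A 0 1 * A 1 0.
Proof.
rewrite (expand_det_row _ ord0) !big_ord_recl big_ord0 addr0 /cofactor !det_mx11 !mxE /=.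
have -> : lift (0 : 'I_2) (0 : 'I_1) = 1 :> 'I_2 by apply/val_inj.
have -> : lift (1 : 'I_2) (0 : 'I_1) = 0 :> 'I_2 by apply/val_inj.
have -> : ord0 = 0 :> 'I_2 by [].
by rewrite /bump /= expr0 expr1 mul1r mulN1r mulrN.
Qed.
End Homography.

(** * Moebius transformations with matrix in SU(1,1) *)

Section Moebius.
Variable R : realType.
Implicit Types (z w a b c d n : Cplx R) (A B : 'M[Cplx R]_2) (g h : smap R).

(** The point [n : d] of the projective line. Matrices act linearly on such pairs, so compositions
    need little case analysis at infinity. *)
Definition hratio n d : sphere R := if d == 0 then None else Some (n / d).

Lemma moebius_Some A z : moebius A (Some z) = hratio (A 0 0 * z + A 0 1) (A 1 0 * z + A 1 1).
Proof. by []. Qed.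
Lemma moebius_None A : moebius A None = hratio (A 0 0) (A 1 0).
Proof. by []. Qed.

Lemma moebius_hratio A n d : (n, d) != (0, 0) ->
  moebius A (hratio n d) = hratio (A 0 0 * n + A 0 1 * d) (A 1 0 * n + A 1 1 * d).
Proof.
move=> nd; rewrite {1}/hratio; have [d0|d0] := eqVneq d 0.
  have n0 : n != 0 by move: nd; rewrite d0 xpair_eqE eqxx andbT.
  rewrite moebius_None /hratio d0 !mulr0 !addr0 mulf_eq0 (negbTE n0) orbF.
  by case: ifP => // h; rewrite -mulf_div divff// mulr1.
rewrite moebius_Some /hratio.
have -> : A 1 0 * (n / d) + A 1 1 = (A 1 0 * n + A 1 1 * d) / d by field.
have -> : A 0 0 * (n / d) + A 0 1 = (A 0 0 * n + A 0 1 * d) / d by field.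
rewrite mulf_eq0 invr_eq0 (negbTE d0) orbF; case: ifP => // h.
by congr Some; field; rewrite d0 h.
Qed.

(** For |a|^2 - |b|^2 = 1 these matrices form SU(1,1). *)
Definition su a b : 'M[Cplx R]_2 :=
  \matrix_(i < 2, j < 2) if i == 0 then if j == 0 then a else b
                         else if j == 0 then b^* else a^*.
Lemma suE a b : (su a b 0 0 = a) * (su a b 0 1 = b) * (su a b 1 0 = b^*) *
  (su a b 1 1 = a^*).
Proof. by rewrite !mxE. Qed.

Lemma det_su a b : \det (su a b) = (sq a - sq b)%:C%C.
Proof. by rewrite det2 !suE mulJ mulJ rmorphB. Qed.

Definition rep g a b := sq a - sq b = 1 /\ g = moebius (su a b).

Lemma moebius_su_hratio a b n d : (n, d) != (0, 0) ->
  moebius (su a b) (hratio n d) = hratio (a * n + b * d) (b^* * n + a^* * d).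
Proof. by move=> /moebius_hratio ->; rewrite !suE. Qed.

Lemma rep_comp g h a b c d : rep g a b -> rep h c d ->
  rep (g \o h) (a * c + b * d^*) (a * d + b * c^*).
Proof.
move=> [ab ->] [cd ->]; split.
  rewrite -[RHS]mulr1 -{1}ab -[in RHS]cd /sq !cE; ring.
have c0 : c != 0.
  by rewrite -sq_gt0; have := sq_ge0 d; lra.
apply: funext => -[z|]; rewrite -[LHS]/(moebius (su a b) (moebius (su c d) _)).
  rewrite moebius_Some moebius_su_hratio ?suE//.
    rewrite moebius_Some !suE !rmorphD !rmorphM/= !conjCK.
    by congr hratio; ring.
  rewrite xpair_eqE; apply/negP => /andP[/eqP h1 /eqP h2].
  have : \det (su c d) = 0.
    rewrite det2 !suE.
    have <- : c * (d^* * z + c^*) - d^* * (c * z + d) = c * c^* - d * d^* by ring.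
    by rewrite h1 h2 !mulr0 subr0.
  by rewrite det_su cd => /eqP; rewrite oner_eq0.
rewrite moebius_None moebius_su_hratio ?suE//; last by rewrite xpair_eqE (negbTE c0).
rewrite moebius_None !suE !rmorphD !rmorphM/= !conjCK.
by congr hratio; ring.
Qed.

Lemma rep_id : rep id 1 0.
Proof.
split; first by rewrite sq1 sq0 subr0.
apply: funext => -[z|]; rewrite ?moebius_Some ?moebius_None !suE /hratio rmorph0 ?rmorph1.
  by rewrite !mul1r mul0r add0r addr0 oner_eq0 divr1.
by rewrite eqxx.
Qed.

Lemma rep_inverse g a b : rep g a b ->
  exists h, [/\ rep h a^* (- b), g \o h = id & h \o g = id].
Proof.
move=> gab; exists (moebius (su a^* (- b))).
have hr : rep (moebius (su a^* (- b))) a^* (- b).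
  by split => //; rewrite sqJ sqN; case: gab.
have e1 : sq a - sq b = 1 by case: gab.
have aE : a * a^* - b * b^* = 1 by rewrite !mulJ -rmorphB e1.
split => //.
  have [_ ->] := rep_comp gab hr; have [_ ->] := rep_id.
  by rewrite rmorphN/= conjCK mulrN aE; congr (moebius (su _ _)); ring.
have [_ ->] := rep_comp hr gab; have [_ ->] := rep_id.
by rewrite mulNr [a^* * a]mulrC aE; congr (moebius (su _ _)); ring.
Qed.

(** [sinv] picks some preimage of each point; a two-sided inverse leaves it no choice. *)
Lemma sinv_uniq g h : g \o h = id -> h \o g = id -> sinv g = h.
Proof.
move=> gh hg; apply: funext => p; apply: xget_unique => /=.
  exact: (congr1 (@^~ p) gh).
by move=> q <-; rewrite (_ : h (g q) = q)//; exact: (congr1 (@^~ q) hg).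
Qed.

Lemma rep_sinv g a b : rep g a b ->
  [/\ rep (sinv g) a^* (- b), g \o sinv g = id & sinv g \o g = id].
Proof. by move=> /rep_inverse[h [hr gh hg]]; rewrite (sinv_uniq gh hg). Qed.

(** The pole of [g] lies outside the closed disc because |a| > |b|. *)
Lemma rep_den_neq0 g a b z : rep g a b -> sq z <= 1 -> b^* * z + a^* != 0.
Proof.
move=> [ab _] z1; apply/negP => /eqP h.
have : sq a = sq b * sq z.
  by rewrite -(sqJ a) -(sqJ b) -sqM -(sqN (_ * z)); congr sq; rewrite -[a^*](addKr (b^* * z)) h addr0.
have := sq_ge0 b; have := sq_ge0 z; nra.
Qed.

Lemma rep_Some g a b z : rep g a b -> sq z <= 1 ->
  g (Some z) = Some ((a * z + b) / (b^* * z + a^*)).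
Proof.
move=> gab z1; have := rep_den_neq0 gab z1; case: gab => _ -> /negbTE h.
by rewrite moebius_Some !suE /hratio h.
Qed.

Lemma finpart_rep g a b z : rep g a b -> finpart g z = (a * z + b) / (b^* * z + a^*).
Proof.
move=> [_ ->]; rewrite /finpart moebius_Some !suE /hratio.
by case: eqP => //= ->; rewrite invr0 mulr0.
Qed.

Lemma mderiv_rep g a b z : rep g a b -> sq z <= 1 ->
  mderiv g z = (sq (b^* * z + a^*))^-1.
Proof.
move=> gab z1; have den := rep_den_neq0 gab z1.
have e1 : sq a - sq b = 1 by case: gab.
have aE : a * a^* - b * b^* = 1 by rewrite !mulJ -rmorphB e1.
rewrite /mderiv derive1E.
have -> : finpart g = (fun w => (a * w + b) / (b^* * w + a^*)).
  by apply: funext => w; rewrite (finpart_rep _ gab).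
rewrite derive_homography// aE mul1r.
by rewrite cabs_sq exprVn sqV expr2 sqM -expr2 -exprVn sqrtr_sqr ger0_norm// invr_ge0 sq_ge0.
Qed.
End Moebius.

(** * Disc-preserving transformations lie in SU(1,1) *)

Section DiscPreserving.
Variable R : realType.
Implicit Types (z w a b c d n : Cplx R) (A : 'M[Cplx R]_2) (g h u : smap R).

(** Replaces a limit t -> 1 along a radius. If the value at 1 were -s < 0, then at 1 - x with x = s
    / (s + M) it would be at most -s + x M = -x s < 0, where [M] bounds the slope. *)
Lemma quad_ge0_at1 (p q r : R) :
  (forall t, 0 <= t < 1 -> 0 < p + q * t + r * t ^+ 2) -> 0 <= p + q + r.
Proof.
move=> H; rewrite leNgt; apply/negP => neg.
pose s := - (p + q + r); pose M := `|q| + 3 * `|r| + 1.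
have s0 : 0 < s by rewrite oppr_gt0.
have M0 : 0 < M by rewrite /M; have := normr_ge0 q; have := normr_ge0 r; lra.
pose x := s / (s + M).
have sM : 0 < s + M by exact: addr_gt0.
have x0 : 0 < x by exact: divr_gt0.
have x1 : x <= 1 by rewrite /x ler_pdivrMr// mul1r; lra.
have xM : x * (s + M) = s by rewrite divfK// gt_eqF// addr_gt0.
have /H : 0 <= 1 - x < 1 by lra.
have := ler_norm q; have := ler_norm (- q); rewrite normrN.
have := ler_norm r; have := ler_norm (- r); rewrite normrN.
move: xM; rewrite /M /s; nra.
Qed.

Lemma hratio_scale k n d : k != 0 -> hratio (k * n) (k * d) = hratio n d.
Proof.
move=> k0; rewrite /hratio mulf_eq0 (negbTE k0) /=; case: ifP => // d0.
by congr Some; rewrite -mulf_div divff// mul1r.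
Qed.

Lemma moebius_scale A k : k != 0 -> moebius (k *: A) = moebius A.
Proof.
move=> k0; apply: funext => -[z|]; rewrite ?moebius_Some ?moebius_None !mxE -?mulrA -?mulrDr.
  exact: hratio_scale.
exact: hratio_scale.
Qed.

Lemma moebius_normalize g : is_moebius g ->
  exists2 A : 'M[Cplx R]_2, \det A = 1 & g = moebius A.
Proof.
move=> [A dA ->]; pose s : Cplx R := sqrtC (\det A).
have s0 : s != 0 by rewrite sqrtC_eq0.
exists (s^-1 *: A); last by rewrite moebius_scale// invr_eq0.
by rewrite detZ exprVn sqrtCK mulVf.
Qed.

Lemma moebius_inj_Some A z w p : \det A != 0 ->
  moebius A (Some z) = Some p -> moebius A (Some w) = Some p -> z = w.
Proof.
rewrite !moebius_Some /hratio det2 => dA.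
case: eqP => // /eqP dz [<-]; case: eqP => // /eqP dw [] /eqP.
rewrite eqr_div// => /eqP h; apply/eqP; rewrite -subr_eq0.
apply/eqP/(mulfI dA); rewrite mulr0.
transitivity ((A 0 0 * z + A 0 1) * (A 1 0 * w + A 1 1) -
  (A 0 0 * w + A 0 1) * (A 1 0 * z + A 1 1)); first by ring.
by rewrite h subrr.
Qed.

Lemma disc_moebius_in A z : preserves_disc (moebius A) -> sq z < 1 ->
  sq (A 0 0 * z + A 0 1) < sq (A 1 0 * z + A 1 1).
Proof.
move=> P z1; have : (moebius A @` (Some @` @disc R)) (moebius A (Some z)).
  by exists (Some z) => //; exists z => //; rewrite /disc /= norm_lt1.
rewrite P moebius_Some /hratio => -[w]; rewrite /disc /= norm_lt1 => w1.
case: eqP => // /eqP d0 [e]; move: w1.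
by rewrite e sqM sqV ltr_pdivrMr ?mul1r// sq_gt0.
Qed.

(** An outer point sent into the disc would share its image with an inner point, against
    injectivity. *)
Lemma disc_moebius_out A z : \det A != 0 -> preserves_disc (moebius A) -> 1 <= sq z ->
  sq (A 1 0 * z + A 1 1) <= sq (A 0 0 * z + A 0 1).
Proof.
move=> dA P z1; rewrite leNgt; apply/negP => lt.
have d0 : A 1 0 * z + A 1 1 != 0 by rewrite -sq_gt0 (le_lt_trans _ lt)// sq_ge0.
set p := (A 0 0 * z + A 0 1) / (A 1 0 * z + A 1 1).
have ez : moebius A (Some z) = Some p by rewrite moebius_Some /hratio (negbTE d0).
have : (Some @` @disc R) (Some p).
  by exists p => //; rewrite /disc /= norm_lt1 sqM sqV ltr_pdivrMr ?mul1r// sq_gt0.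
rewrite -P => -[_ [w w1 <-]] ew.
move: w1; rewrite /disc /= norm_lt1 -(moebius_inj_Some dA ez ew); lra.
Qed.

(** One inequality is the exterior case. The other is the limit of the interior case along the
    radius through [z], on which both squared moduli are quadratic in t. *)
Lemma disc_moebius_circle A z : \det A != 0 -> preserves_disc (moebius A) -> sq z = 1 ->
  sq (A 0 0 * z + A 0 1) = sq (A 1 0 * z + A 1 1).
Proof.
move=> dA P z1; apply/eqP; rewrite eq_le disc_moebius_out ?z1// andbT -subr_ge0.
rewrite (sqDJ (A 1 0 * z)) (sqDJ (A 0 0 * z)).
set q1 := complex.Re _ *+ 2; set q0 := complex.Re _ *+ 2.
rewrite !sqM z1 !mulr1.
have -> : sq (A 1 0) + sq (A 1 1) + q1 - (sq (A 0 0) + sq (A 0 1) + q0) =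
  (sq (A 1 1) - sq (A 0 1)) + (q1 - q0) + (sq (A 1 0) - sq (A 0 0)) by ring.
apply: quad_ge0_at1 => t /andP[t0 t1].
have st : sq (t%:C%C : Cplx R) = t ^+ 2 by rewrite /sq /= expr0n addr0.
have : sq (t%:C%C * z) < 1 by rewrite sqM st z1 mulr1 expr_lt1.
move=> /(disc_moebius_in P); rewrite -subr_gt0 !sqDJ !sqM st z1.
have lin p q : complex.Re (p * (t%:C%C * z) * q) = t * complex.Re (p * z * q).
  by rewrite !cE /=; ring.
by rewrite !lin; congr (0 < _); rewrite /q1 /q0 !mulr2n; ring.
Qed.

(** The pairs |a|^2, |b|^2 and |c|^2, |d|^2 have equal sums and products, so they coincide up to
    order, and |b| < |d| fixes the order. Solving with the determinant gives a^* = k d and b^* = k c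
    for the real k = |d|^2 - |b|^2, and comparing moduli gives k = 1. *)
Lemma su_of_det1 a b c d : a * d - b * c = 1 -> sq a + sq b = sq c + sq d ->
  a * b^* = c * d^* -> sq b < sq d -> d = a^* /\ c = b^*.
Proof.
move=> det e1 e2 lt.
have m : sq a * sq b = sq c * sq d.
  by rewrite -(sqJ b) -(sqJ d) -!sqM e2.
have bc : sq b = sq c.
  apply/eqP; rewrite -subr_eq0; apply/eqP.
  have : (sq b - sq d) * (sq b - sq c) = 0.
    transitivity (sq b ^+ 2 - sq b * (sq c + sq d) + sq c * sq d); first by ring.
    by rewrite -e1 -m; ring.
  by move=> /eqP; rewrite mulf_eq0 => /orP[|/eqP//]; rewrite subr_eq0 => /eqP e; move: lt; rewrite e ltxx.
have ad : sq a = sq d by move: e1; rewrite bc addrC => /addrI.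
pose k : R := sq d - sq b.
have e2' : a^* * b = c^* * d.
  by have := congr1 (fun z : Cplx R => z^*) e2; rewrite !rmorphM/= !conjCK.
have ea : a^* = k%:C%C * d.
  transitivity (a^* * (a * d - b * c)); first by rewrite det mulr1.
  transitivity ((a * a^*) * d - (a^* * b) * c); first by ring.
  rewrite e2' /k -ad bc rmorphB/= -!mulJ; ring.
have eb : b^* = k%:C%C * c.
  transitivity (b^* * (a * d - b * c)); first by rewrite det mulr1.
  transitivity ((a * b^*) * d - (b * b^*) * c); first by ring.
  rewrite e2 /k rmorphB/= -!mulJ; ring.
have k1 : k = 1.
  have k0 : 0 < k by rewrite /k subr_gt0.
  have d0 : 0 < sq d by rewrite (le_lt_trans _ lt)// sq_ge0.
  have : k ^+ 2 * sq d = sq d.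
    by rewrite -[in RHS]ad -(sqJ a) ea sqM; congr (_ * _); rewrite /sq /= expr0n addr0.
  move=> h; have : k ^+ 2 = 1 by apply: (mulIf (lt0r_neq0 d0)); rewrite h mul1r.
  by move=> /eqP; rewrite sqrp_eq1 ?ltW// => /eqP.
by rewrite ea eb k1 !mul1r.
Qed.

Lemma rep_exists g : is_moebius g -> preserves_disc g -> exists a b, rep g a b.
Proof.
move=> /moebius_normalize[A dA ->] P; exists (A 0 0), (A 0 1).
have dA0 : \det A != 0 by rewrite dA oner_neq0.
have C z : sq z = 1 -> sq (A 0 0) + sq (A 0 1) + complex.Re (A 0 0 * z * (A 0 1)^*) *+ 2 =
    sq (A 1 0) + sq (A 1 1) + complex.Re (A 1 0 * z * (A 1 1)^*) *+ 2.
  by move=> z1; have := disc_moebius_circle dA0 P z1; rewrite !sqDJ !sqM z1 !mulr1.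
have sqi : sq ('i%C : Cplx R) = 1 by rewrite /sq /= expr0n expr1n add0r.
(* Evaluating the equality of moduli at 1, -1, i and -i separates the constant term from the real
   and imaginary parts of the cross terms. *)
have := C 1 (sq1 _); have := C (-1); rewrite sqN sq1 => /(_ erefl).
have := C _ sqi; have := C (- 'i%C); rewrite sqN sqi => /(_ erefl).
set S0 := sq (A 0 0) + _; set S1 := sq (A 1 0) + _.
have lin1 p q : complex.Re (p * 1 * q^*) = complex.Re (p * q^* : Cplx R) by rewrite mulr1.
have linN p q r : complex.Re (p * - r * q^*) = - complex.Re (p * r * q^* : Cplx R).
  by rewrite mulrN mulNr cReN.
have lini p q : complex.Re (p * 'i%C * q^*) = - complex.Im (p * q^* : Cplx R).
  by rewrite !cE /=; ring.
rewrite !linN !lini !lin1 !mulr2n => h1 h2 h3 h4.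
have lt : sq (A 0 1) < sq (A 1 1).
  by have := @disc_moebius_in A 0 P; rewrite !mulr0 !add0r sq0; apply; exact: ltr01.
have [||||e1 e2] := @su_of_det1 (A 0 0) (A 0 1) (A 1 0) (A 1 1).
- by rewrite -det2.
- by rewrite -/S0 -/S1; lra.
- by apply: cplxP; lra.
- exact: lt.
split.
  by apply: complexI; rewrite -det_su det2 !suE -e1 -e2 -det2 dA.
congr moebius; apply/matrixP => i j; rewrite mxE.
have ord2 (k : 'I_2) : k = 0 \/ k = 1 by case: k => -[|[|//]] ?; [left|right]; apply/val_inj.
by case: (ord2 i) => ->; case: (ord2 j) => -> /=; rewrite ?eqxx.
Qed.
End DiscPreserving.

(** * Action on the circle, derivatives and displacement of the origin *)

HB.lock Definition act (R : realType) (g : smap R) (x : circle R) : circle R :=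
  xget x [set y | g (on_sphere x) = on_sphere y].
(** The point g^-1(0). On the circle |g'| is the Poisson kernel of this point, as [der_ctr]
    states. *)
HB.lock Definition ctr (R : realType) (g : smap R) : Cplx R := finpart (sinv g) 0.
(** Equals |a|^2 for a matrix [su a b] of [g] ([rep_nrm]), that is, cosh^2(r/2) with r the
    hyperbolic distance from 0 to g(0). *)
HB.lock Definition nrm (R : realType) (g : smap R) : R := (1 - sq (finpart g 0))^-1.
HB.lock Definition der (R : realType) (g : smap R) (x : circle R) : R :=
  mderiv g (set_val x).

Section CircleAction.
Variable R : realType.
Implicit Types (z w a b c d n : Cplx R) (g h u : smap R) (x y xi : circle R).

Lemma sq_circle x : sq (set_val x) = 1.
Proof. by apply/norm_eq1; have := set_valP x. Qed.

Lemma circle_ext x y : set_val x = set_val y -> x = y.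
Proof. by move=> h; apply: val_inj. Qed.

Definition mkcircle z (h : sq z = 1) : circle R :=
  SigSub (mem_set ((norm_eq1 z).2 h) : z \in @circle_set R).
Lemma val_mkcircle z (h : sq z = 1) : set_val (mkcircle h) = z.
Proof. by []. Qed.

(** Squared chordal distance. Its triangle inequality [csq_tri] costs a factor 2, which is where the
    quarters in later separation arguments come from. *)
Definition csq x y : R := sq (set_val x - set_val y).
Definition isu g := exists a, exists b, rep g a b.

Lemma csq_ge0 x y : 0 <= csq x y. Proof. exact: sq_ge0. Qed.
Lemma csqC x y : csq x y = csq y x. Proof. exact: sqBC. Qed.
Lemma csqxx x : csq x x = 0. Proof. by rewrite /csq subrr sq0. Qed.
Lemma csq_eq0 x y : csq x y = 0 -> x = y.
Proof.
by move=> /eqP; rewrite sq_eq0 subr_eq0 => /eqP h; exact: circle_ext.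
Qed.
Lemma csq_gt0 x y : x != y -> 0 < csq x y.
Proof.
move=> xy; rewrite lt_neqAle csq_ge0 andbT eq_sym; apply/negP => /eqP /csq_eq0 e.
by rewrite e eqxx in xy.
Qed.
Lemma csq_tri x y xi : csq x xi <= csq x y *+ 2 + csq y xi *+ 2.
Proof. exact: sq_dist_le. Qed.
Lemma csq_le4 x y : csq x y <= 4.
Proof. by have := sqD_le (set_val x) (- set_val y); rewrite sqN !sq_circle /csq; lra. Qed.

Lemma isu_sinv g : isu g -> [/\ isu (sinv g), g \o sinv g = id & sinv g \o g = id].
Proof. by move=> [a [b /rep_sinv[h1 h2 h3]]]; split => //; exists a^*, (- b). Qed.
Lemma isu_comp g h : isu g -> isu h -> isu (g \o h).
Proof.
by move=> [a [b r]] [c [d r']]; exists (a * c + b * d^*), (a * d + b * c^*); exact: rep_comp.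
Qed.
Lemma isu_id : isu id. Proof. by exists 1, 0; exact: rep_id. Qed.

Lemma rep_nrm g a b : rep g a b -> nrm g = sq a.
Proof.
move=> gab; rewrite nrm.unlock (finpart_rep _ gab) mulr0 add0r mulr0 add0r sqM sqV sqJ.
case: gab => ab _; have a0 : sq a != 0.
  by rewrite sq_eq0; apply/negP => /eqP a0; move: ab; rewrite a0 sq0; have := sq_ge0 b; lra.
by rewrite -[in X in X - _](divff a0) -mulrBl ab div1r invrK.
Qed.

Lemma nrm_ge1 g : isu g -> 1 <= nrm g.
Proof. by move=> [a [b r]]; rewrite (rep_nrm r); case: r => ab _; have := sq_ge0 b; lra. Qed.
Lemma nrm_gt0 g : isu g -> 0 < nrm g.
Proof. by move=> /nrm_ge1; lra. Qed.

Lemma nrm_sinv g : isu g -> nrm (sinv g) = nrm g.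
Proof. by move=> [a [b r]]; have [r' _ _] := rep_sinv r; rewrite (rep_nrm r) (rep_nrm r') sqJ. Qed.

(** The triangle inequality for displacements of the origin, in multiplicative form. *)
Lemma nrm_comp g h : isu g -> isu h -> nrm (g \o h) <= 4 * nrm g * nrm h.
Proof.
move=> [a [b r]] [c [d r']]; rewrite (rep_nrm (rep_comp r r')) (rep_nrm r) (rep_nrm r').
apply: le_trans (sqD_le _ _) _; rewrite !sqM sqJ.
case: r => ab _; case: r' => cd _; have := sq_ge0 b; have := sq_ge0 d; have := sq_ge0 a.
nra.
Qed.

Lemma rep_act g a b x : rep g a b ->
  set_val (act g x) = (a * set_val x + b) / (b^* * set_val x + a^*) /\
  g (on_sphere x) = on_sphere (act g x).
Proof.
move=> r; have x1 := sq_circle x.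
have e := @rep_Some _ g a b (set_val x) r (ltac:(by rewrite x1)).
set p := _ / _ in e *.
have p1 : sq p = 1.
  rewrite sqM sqV -[X in X / _](_ : sq (b^* * set_val x + a^*) = _); first rewrite divff//.
    by rewrite sq_eq0; apply: (rep_den_neq0 r); rewrite x1.
  rewrite !sqDJ !sqM !sqJ x1 !mulr1 conjCK [sq b + _]addrC; congr (_ + _).
  by congr (_ *+ 2); rewrite !cE; ring.
have ex : g (on_sphere x) = on_sphere (mkcircle p1) by exact: e.
suff -> : act g x = mkcircle p1 by [].
rewrite act.unlock.
apply: xget_unique => //= y; rewrite ex => -[h]; exact: circle_ext.
Qed.

Lemma actE g x : isu g -> g (on_sphere x) = on_sphere (act g x).
Proof. by move=> [a [b r]]; case: (rep_act x r). Qed.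
Lemma on_sphere_inj x y : on_sphere x = on_sphere y -> x = y.
Proof. by move=> -[]; exact: circle_ext. Qed.
Lemma act_id x : act id x = x.
Proof. by apply: on_sphere_inj; rewrite -actE//; exact: isu_id. Qed.
Lemma act_comp g h x : isu g -> isu h -> act (g \o h) x = act g (act h x).
Proof.
move=> ig ih; apply: on_sphere_inj; have igh := isu_comp ig ih.
by rewrite -(actE _ igh) -(actE _ ig) -(actE _ ih).
Qed.
Lemma actK g x : isu g -> act (sinv g) (act g x) = x.
Proof. by move=> ig; have [is_ _ e] := isu_sinv ig; rewrite -act_comp// e act_id. Qed.
Lemma actKV g x : isu g -> act g (act (sinv g) x) = x.
Proof. by move=> ig; have [is_ e _] := isu_sinv ig; rewrite -act_comp// e act_id. Qed.
Lemma act_inj g : isu g -> injective (act g).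
Proof. by move=> ig x y /(congr1 (act (sinv g))); rewrite !actK. Qed.

Lemma rep_der g a b x : rep g a b -> der g x = (sq (b^* * set_val x + a^*))^-1.
Proof. by move=> r; rewrite der.unlock; apply: mderiv_rep => //; rewrite sq_circle. Qed.

Lemma der_gt0 g x : isu g -> 0 < der g x.
Proof.
move=> [a [b r]]; rewrite (rep_der _ r) invr_gt0 sq_gt0.
by apply: (rep_den_neq0 r); rewrite sq_circle.
Qed.

Lemma csq_act g x y : isu g -> csq (act g x) (act g y) = der g x * der g y * csq x y.
Proof.
move=> [a [b r]]; rewrite !(rep_der _ r) /csq; have [-> _] := rep_act x r; have [-> _] := rep_act y r.
have e1 : sq a - sq b = 1 by case: r.
have aE : a * a^* - b * b^* = 1 by rewrite !mulJ -rmorphB e1.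
have dx : b^* * set_val x + a^* != 0 by apply: (rep_den_neq0 r); rewrite sq_circle.
have dy : b^* * set_val y + a^* != 0 by apply: (rep_den_neq0 r); rewrite sq_circle.
rewrite -!sqV -!sqM; congr sq.
transitivity ((b^* * set_val x + a^*)^-1 * (b^* * set_val y + a^*)^-1 *
   ((a * a^* - b * b^*) * (set_val x - set_val y))); last by rewrite aE mul1r.
by field; rewrite dx dy.
Qed.

Lemma der_id x : der id x = 1.
Proof. by rewrite (rep_der _ (rep_id R)) rmorph0 mul0r add0r rmorph1 sq1 invr1. Qed.

Lemma der_comp g h x : isu g -> isu h -> der (g \o h) x = der g (act h x) * der h x.
Proof.
move=> [a [b r]] [c [d r']]; rewrite (rep_der _ (rep_comp r r')) (rep_der _ r) (rep_der _ r').
have [-> _] := rep_act x r'; have dx : d^* * set_val x + c^* != 0.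
  by apply: (rep_den_neq0 r'); rewrite sq_circle.
rewrite -invfM -sqM; congr (sq _)^-1; rewrite !rmorphD !rmorphM/= !conjCK.
by field.
Qed.

Lemma der_sinv g x : isu g -> der (sinv g) (act g x) = (der g x)^-1.
Proof.
move=> ig; have [is_ _ e] := isu_sinv ig.
have := der_comp x is_ ig; rewrite e der_id => h.
by apply: (mulIf (lt0r_neq0 (der_gt0 x ig))); rewrite -h mulVf// lt0r_neq0// der_gt0.
Qed.

Lemma der_ge g x : isu g -> (4 * nrm g)^-1 <= der g x.
Proof.
move=> ig; have := der_gt0 x ig; case: ig => [a [b r]].
rewrite (rep_nrm r) (rep_der _ r) invr_gt0 => d0.
have a0 : 0 < 4 * sq a by have := sq_ge0 b; case: r; lra.
rewrite lef_pV2//; apply: le_trans (sqD_le _ _) _; rewrite sqM !sqJ sq_circle.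
have := sq_ge0 b; case: r; lra.
Qed.

Lemma der_le g x : isu g -> der g x <= 4 * nrm g.
Proof.
move=> ig; have [is_ _ _] := isu_sinv ig; have := der_ge (act g x) is_.
rewrite nrm_sinv// der_sinv// lef_pV2// ?posrE ?der_gt0//.
by rewrite mulr_gt0// nrm_gt0.
Qed.

(** On the unit circle the numerator and the denominator of [g] have the same modulus, and the
    numerator a x + b is a times x - g^-1(0). *)
Lemma der_ctr g x : isu g -> der g x * (nrm g * sq (set_val x - ctr g)) = 1.
Proof.
move=> ig; have := der_gt0 x ig; case: ig => [a [b r]] d0.
have [r' _ _] := rep_sinv r; rewrite ctr.unlock (finpart_rep _ r') mulr0 add0r mulr0 add0r conjCK.
move: d0; rewrite (rep_der _ r) (rep_nrm r) invr_gt0 => d0.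
have a0 : a != 0.
  by rewrite -sq_gt0; have := sq_ge0 b; case: r; lra.
rewrite -sqM (_ : a * (set_val x - - b / a) = a * set_val x + b); last by field.
suff -> : sq (a * set_val x + b) = sq (b^* * set_val x + a^*) by rewrite mulVf// gt_eqF.
rewrite !sqDJ !sqM !sqJ sq_circle !mulr1 conjCK [sq a + _]addrC; congr (_ + _).
by congr (_ *+ 2); rewrite !cE; ring.
Qed.

Lemma der_max g : isu g -> exists x, nrm g <= der g x.
Proof.
move=> [a [b r]]; pose s := Num.sqrt (sq a); pose t := Num.sqrt (sq b).
have s2 : s ^+ 2 = sq a by rewrite sqr_sqrtr// sq_ge0.
have t2 : t ^+ 2 = sq b by rewrite sqr_sqrtr// sq_ge0.
have st : s ^+ 2 - t ^+ 2 = 1 by rewrite s2 t2; case: r.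
have s0 : 0 <= s by exact: sqrtr_ge0.
have t0 : 0 <= t by exact: sqrtr_ge0.
have s_gt0 : 0 < s by nra.
have [b0|b0] := eqVneq b 0.
  exists (circle1 R); rewrite (rep_nrm r) (rep_der _ r) b0 rmorph0 mul0r add0r sqJ.
  by case: r => + _; rewrite b0 sq0 subr0 => ->; rewrite invr1.
have t_gt0 : 0 < t by rewrite sqrtr_gt0 sq_gt0.
have sqr k : sq (k%:C%C : Cplx R) = k ^+ 2 by rewrite /sq /= expr0n addr0.
(* The point at which the two terms of the denominator are opposite: its modulus there is |a| - |b|,
   so the derivative is (|a| + |b|)^2, at least |a|^2. *)
have x1 : sq (- (a^* * b) * ((s * t)^-1)%:C%C) = 1.
  rewrite sqM sqN sqM sqJ sqr -s2 -t2 exprVn exprMn mulfV// mulf_neq0// expf_neq0// gt_eqF//.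
exists (mkcircle x1); rewrite (rep_nrm r) (rep_der _ r) val_mkcircle.
have -> : b^* * (- (a^* * b) * ((s * t)^-1)%:C%C) + a^* = a^* * (1 - t / s)%:C%C.
  transitivity (a^* * (1 - (b * b^*) * ((s * t)^-1)%:C%C)); first by ring.
  rewrite mulJ -t2 -rmorphM/= -(rmorph1 (real_complex R)) -rmorphB/=.
  by congr (_ * _%:C%C); field; lra.
rewrite sqM sqJ sqr -s2.
have -> : s ^+ 2 * (1 - t / s) ^+ 2 = (s - t) ^+ 2 by field; lra.
have lt : 0 < s - t by nra.
rewrite -exprVn ler_pXn2r// ?nnegrE ?invr_ge0 ?(ltW lt) ?(ltW s_gt0)//.
rewrite -[leRHS]div1r ler_pdivlMr//; nra.
Qed.
End CircleAction.

(** * Topology of the circle and of its arcs *)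

Section CircleTopology.
Variable R : realType.
Implicit Types (x y p q : circle R) (A B : set (circle R)) (g h : smap R).

Lemma nbhs_csq x A : nbhs x A <-> exists2 e : R, 0 < e & forall y, csq x y < e -> A y.
Proof.
split.
  rewrite nbhsE => -[U [[W oW WU] Ux] UA].
  have : nbhs (set_val x) W by apply: open_nbhs_nbhs; split => //; rewrite -WU in Ux.
  move=> /nbhs_ballP[e /= e0 eW].
  have [r r0 er] : exists2 r : R, 0 < r & e = r%:C%C.
    move: e0; rewrite ltcE /= => /andP[/eqP i0 r0]; exists (complex.Re e) => //.
    by case: e i0 {eW r0} => a b /= ->.
  exists (r ^+ 2); first exact: exprn_gt0.
  move=> y xy; apply: UA; rewrite -WU; apply: eW.
  by rewrite /ball /= er norm_lt.
move=> [e e0 H].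
have s0 : 0 < Num.sqrt e by rewrite sqrtr_gt0.
pose B := ball (set_val x) ((Num.sqrt e)%:C%C : Cplx R).
have nB : nbhs (set_val x) B by apply: nbhsx_ballx; rewrite ltcE /= eqxx.
rewrite nbhsE; exists (set_val @^-1` B°).
  split; last exact: nB.
  by exists B° => //; exact: open_interior.
move=> y /= /interior_subset; rewrite /B /ball /= norm_lt// sqr_sqrtr ?ltW//; exact: H.
Qed.

Lemma interior_csq A x : A° x <-> exists2 e : R, 0 < e & forall y, csq x y < e -> A y.
Proof. exact: nbhs_csq. Qed.

Lemma closure_csq A x :
  closure A x <-> forall e : R, 0 < e -> exists2 y, A y & csq x y < e.
Proof.
split=> [cA e e0|H B /nbhs_csq[e e0 eB]].
  have /cA[y [Ay xy]] : nbhs x [set y | csq x y < e] by apply/nbhs_csq; exists e.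
  by exists y.
by have [y Ay xy] := H e e0; exists y; split => //; exact: eB.
Qed.

Lemma circle_hausdorff : hausdorff_space (circle R).
Proof.
move=> x y H; apply/eqP/negPn/negP => /csq_gt0 xy.
have e0 : 0 < csq x y / 4 by rewrite divr_gt0.
have [||z [xz yz]] := H [set z | csq x z < csq x y / 4] [set z | csq y z < csq x y / 4].
- by apply/nbhs_csq; exists (csq x y / 4).
- by apply/nbhs_csq; exists (csq x y / 4).
have := csq_tri x z y; rewrite (csqC z) /= in xz yz *; lra.
Qed.

Definition ang (t : R) : circle R :=
  @mkcircle R (Complex (cos t) (sin t)) (cos2Dsin2 t).

Lemma csq_ang s t : csq (ang s) (ang t) = 2 - 2 * cos (s - t).
Proof.
rewrite /csq !val_mkcircle /sq /= cosB.
have := cos2Dsin2 s; have := cos2Dsin2 t; nra.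
Qed.

Lemma ang_continuous : continuous ang.
Proof.
move=> s B /nbhs_csq[e e0 eB].
have : (fun t => cos (s - t)) t @[t --> s] --> cos (s - s).
  apply: (@continuous_comp _ _ _ (fun t => s - t) cos); last exact: continuous_cos.
  by apply: continuousB => //; exact: cst_continuous.
rewrite subrr cos0 => /cvgrPdist_lt /(_ (e / 2)).
rewrite divr_gt0// => /(_ isT); apply: filterS => t /= h; apply: eB.
rewrite csq_ang; have := ler_norm (1 - cos (s - t)); lra.
Qed.

Lemma ang_surj x : exists2 t, 0 <= t < 2 * pi & ang t = x.
Proof.
have := sq_circle x; set z := set_val x; rewrite /sq => z1.
have c1 : -1 <= complex.Re z <= 1.
  by have := sqr_ge0 (complex.Im z); nra.
have a0 := acos_ge0 c1; have api := acos_lepi c1; have p0 := pi_gt0 R.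
have ca : cos (acos (complex.Re z)) = complex.Re z by exact: acosK.
have sa : sin (acos (complex.Re z)) = `|complex.Im z|.
  rewrite sin_acos// -sqrtr_sqr; congr Num.sqrt; lra.
have [i0|i0] := leP 0 (complex.Im z).
  exists (acos (complex.Re z)); first by apply/andP; split => //; lra.
  by apply: circle_ext; apply: cplxP; rewrite /= ?ca// sa ger0_norm.
have ne : acos (complex.Re z) != 0.
  by apply/negP => /eqP h; move: sa; rewrite h sin0 ltr0_norm//; lra.
exists (2 * pi - acos (complex.Re z)).
  by apply/andP; split; [lra|have := lt0r_neq0; rewrite ltrBlDr ltrDl lt_neqAle eq_sym ne].
have e2 : 2 * pi = pi *+ 2 :> R by rewrite mulr_natl.
apply: circle_ext; apply: cplxP; rewrite /= addrC e2 ?cosD2pi ?sinD2pi ?cosN ?sinN ?ca//.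
by rewrite sa ltr0_norm ?opprK.
Qed.

Lemma ang_surj_from a x : exists2 t, a <= t < a + 2 * pi & ang t = x.
Proof.
pose z : Cplx R := set_val x * (set_val (ang a))^*.
have z1 : sq z = 1 by rewrite /z sqM sqJ !sq_circle mulr1.
have [t t0 ht] := ang_surj (mkcircle z1); exists (a + t); first by rewrite lerDl ltrD2l.
have [hc hs] : cos t = complex.Re z /\ sin t = complex.Im z.
  by have := congr1 (fun y : circle R => set_val y) ht; rewrite !val_mkcircle => <-.
have := cos2Dsin2 a; move: hc hs; rewrite /z !cE /= => hc hs a1.
apply: circle_ext; apply: cplxP; rewrite /= ?cosD ?sinD hc hs.
  transitivity (complex.Re (set_val x) * (cos a ^+ 2 + sin a ^+ 2)); [ring|by rewrite a1 mulr1].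
transitivity (complex.Im (set_val x) * (cos a ^+ 2 + sin a ^+ 2)); [ring|by rewrite a1 mulr1].
Qed.

(** Uses 1 - cos v = 2 sin^2(v/2) and the positivity of sin on ]0, pi[. *)
Lemma ang_inj s t : `|s - t| < 2 * pi -> ang s = ang t -> s = t.
Proof.
wlog st : s t / s <= t.
  move=> H; have [|/ltW ts] := leP s t; first exact: H.
  by rewrite distrC => h e; apply/esym/H.
move=> + e; have : csq (ang s) (ang t) = 0 by rewrite e csqxx.
rewrite csq_ang -cosN opprB distrC ger0_norm ?subr_ge0// => c1 lt.
pose u := (t - s) / 2.
have cu : cos (t - s) = cos u ^+ 2 *+ 2 - 1 by rewrite -cos_mulr2n /u; congr cos; rewrite -[RHS]mulr_natr divfK.
have su0 : sin u = 0.
  by apply/eqP; rewrite -sqrf_eq0; apply/eqP; have := cos2Dsin2 u; move: c1; rewrite cu mulr2n; lra.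
apply/eqP; rewrite eq_le st /= -subr_le0 leNgt; apply/negP => ts.
suff : 0 < sin u by rewrite su0 ltxx.
by apply: sin_gt0_pi; rewrite /u; apply/andP; split; lra.
Qed.

Lemma circle_compact : compact [set: circle R].
Proof.
suff -> : [set: circle R] = ang @` `[0, 2 * pi].
  by apply: continuous_compact; [exact: continuous_subspaceT ang_continuous|exact: segment_compact].
apply/esym/seteqP; split => // x _; have [t /andP[t0 t1] <-] := ang_surj x.
by exists t => //=; rewrite in_itv /= t0 ltW.
Qed.

Lemma circle_cluster (u : nat -> circle R) :
  exists p, forall e : R, 0 < e -> forall n, exists2 m, (n <= m)%N & csq p (u m) < e.
Proof.
have [p [_ cp]] := circle_compact (F := u @ \oo) _ filterT.
exists p => e e0 n.
have n1 : (u @ \oo) (u @` [set m | (n <= m)%N]) by exists n => // m /= nm; exists m.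
have n2 : nbhs p [set y | csq p y < e] by apply/nbhs_csq; exists e.
by have [_ [[m nm <-] pm]] := cp _ _ n1 n2; exists m.
Qed.

Lemma circle_perfect x (e : R) : 0 < e -> exists2 y, y != x & csq x y < e.
Proof.
move=> e0; have [s _ <-] := ang_surj x.
have /ang_continuous : nbhs (ang s) [set y | csq (ang s) y < e] by apply/nbhs_csq; exists e.
move=> /nbhs_ballP[r /= r0 rB].
pose d := Num.min (r / 2) 1.
have d0 : 0 < d by rewrite lt_min divr_gt0//= ltr01.
have dr : d < r by rewrite (@le_lt_trans _ _ (r / 2)) ?ge_min ?lexx//; lra.
have d1 : d <= 1 by rewrite ge_min lexx orbT.
exists (ang (s + d)); last first.
  by apply: rB; rewrite /ball /= opprD addrA subrr add0r normrN gtr0_norm.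
apply/negP => /eqP /ang_inj h; have : s + d = s.
  by apply: h; rewrite addrAC subrr add0r gtr0_norm// (le_lt_trans d1)//; have := pi_ge2 R; lra.
lra.
Qed.

(** No point of the circle is isolated. This is what allows finitely many bad points to be
    ignored. *)
Lemma open_infinite A x (F : set (circle R)) : finite_set F -> A° x ->
  exists2 y, A y & ~ F y.
Proof.
move=> fF Ax; pose B := [set y | A y /\ y != x].
have clF : closed (F `\ x).
  apply: compact_closed; first exact: circle_hausdorff.
  by apply: finite_compact; exact: finite_setD.
have : (A `&` ~` (F `\ x))° x.
  rewrite interiorI; split => //.
  by rewrite ((interior_id _).1 (closed_openC clF)) => -[_ /=].
move=> /interior_csq[e e0 H]; have [y yx xy] := circle_perfect x e0.
have [Ay nF] := H _ xy; exists y => // Fy; apply: nF; split => //; exact/eqP.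
Qed.

Lemma closed_arc_facts A : closed_arc A ->
  [/\ closed A, A `<=` closure A°, finite_set (A `\` A°) & A° !=set0].
Proof.
move=> [a [b [ab ba eA]]].
have AE : A = ang @` `[a, b].
  rewrite eA; apply/seteqP; split => x /=.
    by move=> [t tab xt]; exists t; [rewrite /= in_itv|exact: circle_ext].
  by move=> [t /=]; rewrite in_itv /= => tab <-; exists t.
have segc c d : closed (ang @` `[c, d]).
  apply: compact_closed; first exact: circle_hausdorff.
  by apply: continuous_compact; [exact: continuous_subspaceT ang_continuous|exact: segment_compact].
(* The open arc is the complement of the complementary closed arc, which is compact. *)
have opn : open (ang @` `]a, b[).
  have -> : ang @` `]a, b[ = ~` (ang @` `[b, a + 2 * pi]).
    apply/seteqP; split => x /=.
      move=> [t /=]; rewrite in_itv /= => /andP[at_ tb] <- [s /=]; rewrite in_itv /= => /andP[bs sa] e.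
      have [sE|sE] := eqVneq s (a + 2 * pi).
        move: e; have -> : ang s = ang a.
          by apply: circle_ext; apply: cplxP; rewrite /= sE mulr_natl ?cosD2pi ?sinD2pi.
        move=> /ang_inj; rewrite ltr0_norm ?subr_lt0// => H.
        have : a = t by apply: H; lra.
        lra.
      have st : s < a + 2 * pi by rewrite lt_neqAle sE.
      move: e => /ang_inj; rewrite gtr0_norm ?subr_gt0 ?(lt_le_trans tb)// => H.
      have : s = t by apply: H; lra.
      lra.
    move=> nx; have [t /andP[t1 t2] tx] := ang_surj_from a x.
    exists t => //=; rewrite in_itv /=.
    have [bt|tb] := leP b t.
      by exfalso; apply: nx; exists t => //=; rewrite in_itv /= bt ltW.
    rewrite andbT lt_neqAle t1 andbT; apply/negP => /eqP ta; apply: nx.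
    exists (a + 2 * pi); first by rewrite /= in_itv /= lexx andbT ltW.
    by rewrite -tx -ta; apply: circle_ext; apply: cplxP; rewrite /= mulr_natl ?cosD2pi ?sinD2pi.
  exact: closed_openC.
have sub : ang @` `]a, b[ `<=` A.
  by rewrite AE; apply: image_subset; exact: subset_itv_oo_cc.
have subi : ang @` `]a, b[ `<=` A°.
  by rewrite -((interior_id _).1 opn); exact: interiorS.
split.
- by rewrite AE; exact: segc.
- move=> x; rewrite {1}AE => -[t /=]; rewrite in_itv /= => /andP[at_ tb] tx.
  apply: (closureS subi).
  apply/closure_csq => e e0; have /ang_continuous : nbhs (ang t) [set y | csq (ang t) y < e].
    by apply/nbhs_csq; exists e.
  move=> /nbhs_ballP[r /= r0 rB].
  (* Moving [t] slightly towards the midpoint [c] enters the open arc even from an endpoint. *)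
  pose c := (a + b) / 2; pose d := Num.min (r / (2 * (b - a))) (1 / 2).
  have ba0 : 0 < b - a by rewrite subr_gt0.
  have d0 : 0 < d by rewrite lt_min !divr_gt0// mulr_gt0.
  have d1 : d <= 1 / 2 by rewrite ge_min lexx orbT.
  have dr : d * (b - a) <= r / 2.
    have : d <= r / (2 * (b - a)) by rewrite ge_min lexx.
    by rewrite ler_pdivlMr ?mulr_gt0//; lra.
  exists (ang (t + d * (c - t))).
    exists (t + d * (c - t)) => //=; rewrite in_itv /= /c; apply/andP; split; nra.
  rewrite -tx; apply: rB; rewrite /ball /= opprD addrA subrr add0r normrN normrM gtr0_norm//.
  have : `|c - t| <= b - a by rewrite ler_norml /c; lra.
  by move=> /(ler_wpM2l (ltW d0)); lra.
- apply: (@sub_finite_set _ _ [set ang a; ang b]); last exact: finite_set2.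
  move=> x [Ax nx]; move: Ax; rewrite AE => -[t /=]; rewrite in_itv /= => /andP[at_ tb] tx.
  have [ta|ta] := eqVneq t a; first by left; rewrite -tx ta.
  have [tb'|tb'] := eqVneq t b; first by right; rewrite -tx tb'.
  exfalso; apply: nx; apply: subi; exists t => //=.
  by rewrite in_itv /= !lt_neqAle at_ tb tb' eq_sym ta.
- exists (ang ((a + b) / 2)); apply: subi; exists ((a + b) / 2) => //=.
  by rewrite in_itv /=; apply/andP; split; lra.
Qed.

Lemma closed_arc_proper A : closed_arc A -> exists x, ~ A x.
Proof.
move=> [a [b [ab ba ->]]]; exists (ang ((a + b) / 2 + pi)) => -[t /andP[at_ tb] h].
have : ang ((a + b) / 2 + pi) = ang t by exact: circle_ext.
move=> /ang_inj; rewrite ltr_norml => H.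
have : (a + b) / 2 + pi = t by apply: H; apply/andP; split; lra.
lra.
Qed.

Lemma act_open g A : isu g -> open A -> open (act g @^-1` A).
Proof.
move=> ig; rewrite !openE => oA x /= /oA /nbhs_csq[e e0 H].
apply/nbhs_csq; exists (e / (4 * nrm g) ^+ 2).
  by rewrite divr_gt0// exprn_gt0// mulr_gt0// nrm_gt0.
move=> y; rewrite ltr_pdivlMr ?exprn_gt0 ?mulr_gt0 ?nrm_gt0// => xy; apply: H.
rewrite csq_act//; apply: le_lt_trans xy; rewrite mulrC ler_wpM2l ?csq_ge0//.
by rewrite expr2 ler_pM ?der_le// ltW// der_gt0.
Qed.

Lemma act_interior g A : isu g -> (act g @^-1` A)° = act g @^-1` A°.
Proof.
have S h B : isu h -> act h @^-1` B° `<=` (act h @^-1` B)°.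
  move=> ih; rewrite -[X in X `<=` _]((interior_id _).1 (act_open ih (open_interior B))).
  by apply: interiorS => x /=; exact: interior_subset.
move=> ig; apply/seteqP; split; last exact: S.
have [ig' _ _] := isu_sinv ig.
move=> x; rewrite -{1}(actK x ig) => /(S _ _ ig').
by apply: interiorS => y /=; rewrite actKV.
Qed.

Lemma act_closure g A : isu g -> closure (act g @^-1` A) = act g @^-1` closure A.
Proof.
move=> ig; apply: setC_inj.
by rewrite -interiorC preimage_setC act_interior// interiorC preimage_setC.
Qed.
End CircleTopology.

(** * Estimates for derivatives on the circle *)

Section Estimates.
Variable R : realType.
Implicit Types (a b c d : Cplx R) (x y : circle R) (S : set (circle R)) (g h u : smap R).

Lemma rep_der_num g a b x : rep g a b -> sq (a * set_val x + b) = (der g x)^-1.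
Proof.
move=> r; rewrite (rep_der _ r) invrK.
rewrite !sqDJ !sqM !sqJ sq_circle !mulr1 conjCK [sq a + _]addrC; congr (_ + _).
by congr (_ *+ 2); rewrite !cE; ring.
Qed.

(** Geometrically: h^-1(0) and u^-1(0) are close if both maps expand at [x] by comparable amounts
    that nearly exhaust their norms. The entry of the product matrix is rewritten through the
    numerators of [h] and [u] at [x], whose squared moduli are the inverse derivatives. *)
Lemma nrm_quot h u x : isu h -> isu u ->
  nrm (h \o sinv u) <= 2 * (nrm u / der h x) + 2 * (nrm h / der u x).
Proof.
move=> [a [b r]] [c [d r']]; have [r'' _ _] := rep_sinv r'.
rewrite (rep_nrm (rep_comp r r'')) rmorphN/= (rep_nrm r) (rep_nrm r').
rewrite -(rep_der_num x r) -(rep_der_num x r').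
set z := set_val x; have z1 : z * z^* = 1 by rewrite mulJ sq_circle.
have -> : a * c^* + b * - d^* = (a * z + b) * (c^* * z^*) - b * (c * z + d)^*.
  transitivity (a * c^* * (z * z^*) + b * - d^*); first by rewrite z1 mulr1.
  by rewrite rmorphD rmorphM/=; ring.
apply: le_trans (sqD_le _ _) _; rewrite sqN !sqM !sqJ sq_circle mulr1.
have := sq_ge0 (c * z + d); have := sq_ge0 b; case: r => ab _; nra.
Qed.

Lemma sqr_lt_norm (s e : R) : 0 < e -> s ^+ 2 < e ^+ 2 -> `|s| < e.
Proof.
by move=> e0; rewrite -(real_normK (num_real s)) ltr_pXn2r ?nnegrE// ltW.
Qed.

Lemma circle_Re_continuous : continuous (fun x : circle R => complex.Re (set_val x) : R).
Proof.
move=> x B /nbhs_ballP[e /= e0 eB]; apply/nbhs_csq; exists (e ^+ 2); first exact: exprn_gt0.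
move=> y xy /=; apply: eB; rewrite /ball /=; apply: sqr_lt_norm => //; apply: le_lt_trans xy.
by rewrite /csq /sq !cE lerDl sqr_ge0.
Qed.
Lemma circle_Im_continuous : continuous (fun x : circle R => complex.Im (set_val x) : R).
Proof.
move=> x B /nbhs_ballP[e /= e0 eB]; apply/nbhs_csq; exists (e ^+ 2); first exact: exprn_gt0.
move=> y xy /=; apply: eB; rewrite /ball /=; apply: sqr_lt_norm => //; apply: le_lt_trans xy.
by rewrite /csq /sq !cE lerDr sqr_ge0.
Qed.

Lemma der_continuous g : isu g -> continuous (der g).
Proof.
move=> [a [b r]].
pose k (x : circle R) : R := sq b + sq a + 2 * (complex.Re (b^* * a) * complex.Re (set_val x)
   - complex.Im (b^* * a) * complex.Im (set_val x)).
have e x : der g x = (k x)^-1.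
  rewrite (rep_der _ r) sqDJ sqM !sqJ sq_circle mulr1 conjCK /k mulr2n; congr (_^-1).
  by rewrite !cE; ring.
have k0 x : k x != 0.
  by rewrite -invr_eq0 -e; apply: lt0r_neq0; apply: der_gt0; exists a, b.
rewrite (_ : der g = fun x => (k x)^-1); last exact: funext.
move=> x; apply: (@continuousV _ _ k x (k0 x)).
have cRe := @circle_Re_continuous x; have cIm := @circle_Im_continuous x.
apply: (@continuousD _ _ _ (fun=> sq b + sq a)); first exact: cst_continuous.
apply: (@continuousM _ _ (fun=> 2)); first exact: cst_continuous.
apply: (@continuousB _ _ _ (fun y : circle R => complex.Re (b^* * a) * complex.Re (set_val y))
  (fun y : circle R => complex.Im (b^* * a) * complex.Im (set_val y))).
  by apply: (@continuousM _ _ (fun=> complex.Re (b^* * a))); [exact: cst_continuous|exact: cRe].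
by apply: (@continuousM _ _ (fun=> complex.Im (b^* * a))); [exact: cst_continuous|exact: cIm].
Qed.

Lemma der_le_closure g S (K : R) : isu g -> (forall y, S y -> der g y <= K) ->
  forall y, closure S y -> der g y <= K.
Proof.
move=> ig H; have cl : closed [set y | der g y <= K].
  apply: (closed_comp (f := der g) (D := [set t | t <= K])); last exact: closed_le.
  by move=> y _; exact: der_continuous.
by move=> y /(closureS H); rewrite -((closure_id _).1 cl).
Qed.

(** Two points at squared distance at least [c] cannot both be within c/4 of [ctr g]. At the one
    that is not, the derivative is at most 4 / (c nrm g) by [der_ctr], and the distortion bound [B]
    spreads this over [S]. *)
Lemma der_le_far g S y1 y2 (c B : R) : isu g -> 0 < c -> S y1 -> S y2 ->
  c <= csq y1 y2 -> (forall y y', S y -> S y' -> der g y <= B * der g y') ->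
  forall y, S y -> der g y <= 4 * B / c / nrm g.
Proof.
move=> ig c0 S1 S2 c12 H y Sy; have N0 := nrm_gt0 ig.
have far z : c / 4 <= sq (set_val z - ctr g) -> der g z <= 4 / c / nrm g.
  move=> h; have := der_ctr z ig; have := der_gt0 z ig => d0 e.
  rewrite !ler_pdivlMr//.
  have := ler_wpM2l (ltW (mulr_gt0 d0 N0)) h; rewrite -[X in _ <= X]mulrA e; lra.
have [z [Sz hz]] : exists z, S z /\ c / 4 <= sq (set_val z - ctr g).
  have := sq_dist_le (set_val y1) (set_val y2) (ctr g).
  rewrite -/(csq y1 y2) [sq (ctr g - _)]sqBC.
  have [h1|h1] := leP (c / 4) (sq (set_val y1 - ctr g)); first by exists y1.
  have [h2|h2] := leP (c / 4) (sq (set_val y2 - ctr g)); first by exists y2.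
  lra.
have B0 : 0 <= B.
  by have := H _ _ Sz Sz; have := der_gt0 z ig; nra.
apply: le_trans (H _ _ Sy Sz) _; have := ler_wpM2l B0 (far _ hz).
by rewrite !mulrA [B * 4]mulrC.
Qed.
End Estimates.

(** * Discreteness and finiteness in Fuchsian groups *)

Section FuchsianGroup.
Variables (R : realType) (G0 : set (smap R)).
Hypothesis hF : fuchsian G0.
Implicit Types (g h : smap R).

Lemma fuchs_isu g : G0 g -> isu g.
Proof. by case: hF => _ H _ /H[m p]; exact: rep_exists. Qed.
Lemma fuchs_id : G0 id. Proof. by case: hF => -[]. Qed.
Lemma fuchs_comp g h : G0 g -> G0 h -> G0 (g \o h).
Proof. by case: hF => -[_ + _] _ _; exact. Qed.
Lemma fuchs_sinv g : G0 g -> G0 (sinv g).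
Proof. by case: hF => -[_ _ +] _ _; exact. Qed.

Lemma fuchs_near_id : exists2 e : R, 0 < e & forall g a b, G0 g -> rep g a b ->
  sq (a - 1) < e -> sq b < e -> g = id.
Proof.
case: hF => _ _ /(_ (su 1 0)).
have [d1 e1] := rep_id R.
rewrite det_su sq1 sq0 subr0 -e1 => /(_ erefl fuchs_id) /nbhs_ballP[r /= r0 H].
have [s s0 rs] : exists2 s : R, 0 < s & r = s%:C%C.
  move: r0; rewrite ltcE /= => /andP[/eqP i0 s0]; exists (complex.Re r) => //.
  by case: r i0 {H s0} => x y /= ->.
exists (s ^+ 2); first exact: exprn_gt0.
move=> g a b Gg [ab eg] sa sb.
have sub : su a b = su 1 0.
  apply: H; [|by rewrite det_su ab|by rewrite -eg].
  split=> // i j; rewrite /ball /= !mxE rs norm_lt//.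
  case: ifP => _; case: ifP => _.
  - by rewrite sqBC.
  - by rewrite sub0r sqN.
  - by rewrite rmorph0 sub0r sqN sqJ.
  - by rewrite rmorph1 -(rmorph1 (Num.conj)) -rmorphB sqJ sqBC.
by rewrite eg sub -e1.
Qed.

(** Composing with h^-1 moves the isolation of the identity to [h]. It multiplies differences of
    entries by entries of [h], of squared modulus at most [r], whence the division by 4 r. *)
Lemma fuchs_close : forall r : R, 1 <= r -> exists2 e : R, 0 < e & forall g h a b c d,
  G0 g -> G0 h -> rep g a b -> rep h c d -> nrm h <= r ->
  sq (a - c) < e -> sq (b - d) < e -> g = h.
Proof.
move=> r r1; have [e e0 H] := fuchs_near_id; exists (e / (4 * r)).
  by rewrite divr_gt0// mulr_gt0//; lra.
move=> g h a b c d Gg Gh gab hcd; rewrite (rep_nrm hcd) => cr.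
rewrite !ltr_pdivlMr ?mulr_gt0//; [|lra|lra] => ac bd.
have [hr hh hh'] := rep_sinv hcd.
have e1 : sq c - sq d = 1 by case: hcd.
have cE' : c * c^* - d * d^* = 1 by rewrite !mulJ -rmorphB e1.
have := sq_ge0 d; have := sq_ge0 (a - c); have := sq_ge0 (b - d) => s1 s2 s3.
have : g \o sinv h = id.
  apply: (H _ _ _ (fuchs_comp Gg (fuchs_sinv Gh)) (rep_comp gab hr)).
    rewrite rmorphN/= -[X in _ - X]cE'.
    have -> : a * c^* + b * - d^* - (c * c^* - d * d^*) =
      (a - c) * c^* + - ((b - d) * d^*) by ring.
    apply: le_lt_trans (sqD_le _ _) _; rewrite sqN !sqM !sqJ; nra.
  have -> : a * - d + b * c^*^* = (b - d) * c + - ((a - c) * d) by rewrite conjCK; ring.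
  apply: le_lt_trans (sqD_le _ _) _; rewrite sqN !sqM; nra.
move=> /(congr1 (fun k : smap R => k \o h)).
by rewrite -compA hh'.
Qed.

Lemma truncn_close (x y s : R) : 0 < s -> 0 <= x -> 0 <= y ->
  Num.truncn (x / s) = Num.truncn (y / s) -> (x - y) ^+ 2 < s ^+ 2.
Proof.
move=> s0 x0 y0 e.
have /andP[h1 h2] := truncn_itv (divr_ge0 x0 (ltW s0)).
have /andP[h3 h4] := truncn_itv (divr_ge0 y0 (ltW s0)).
rewrite e in h1 h2; move: h1 h2 h3 h4; set n := Num.truncn _.
rewrite -natr1 !ler_pdivlMr// !ltr_pdivrMr//; nra.
Qed.

(** Box counting: the matrix entries lie in a bounded box, and two elements in the same cell of side
    [s] coincide by [fuchs_close]. The choice s^2 = e/2 leaves room for the real and imaginary parts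
    together. *)
Lemma nrm_finite (r : R) : finite_set [set g | G0 g /\ nrm g <= r].
Proof.
wlog r1 : r / 1 <= r.
  move=> H; apply: (@sub_finite_set _ _ [set g | G0 g /\ nrm g <= Num.max r 1]).
    by move=> g [Gg gr]; split => //; rewrite le_max gr.
  by apply: H; rewrite le_max lexx orbT.
have [e e0 H] := fuchs_close r1.
pose s := Num.sqrt (e / 2); have s0 : 0 < s by rewrite sqrtr_gt0 divr_gt0.
have s2 : s ^+ 2 = e / 2 by rewrite sqr_sqrtr// ltW// divr_gt0.
pose pr g : Cplx R * Cplx R := xget (0, 0) [set p | rep g p.1 p.2].
have prP g : G0 g -> rep g (pr g).1 (pr g).2.
  move=> /fuchs_isu[a [b ab]].
  by apply: (@xgetPex _ (0, 0) [set p : Cplx R * Cplx R | rep g p.1 p.2]); exists (a, b).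
pose tc (x : R) := Num.truncn ((x + r) / s).
pose cl g := (tc (complex.Re (pr g).1), tc (complex.Im (pr g).1),
              tc (complex.Re (pr g).2), tc (complex.Im (pr g).2)).
pose K := (Num.truncn ((r + r) / s)).+1.
have coord : forall k, G0 k -> nrm k <= r ->
  [/\ -r <= complex.Re (pr k).1 <= r, -r <= complex.Im (pr k).1 <= r,
      -r <= complex.Re (pr k).2 <= r & -r <= complex.Im (pr k).2 <= r].
  move=> k Gg; rewrite (rep_nrm (prP _ Gg)); case: (prP _ Gg); rewrite /sq => e1 _ h.
  by split; apply/andP; split; nra.
have tcK x : -r <= x <= r -> (tc x < K)%N.
  move=> /andP[x1 x2]; rewrite /K ltnS /tc; apply: le_truncn.
  by rewrite ler_pM2r ?invr_gt0// lerD2r.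
have tcs : forall x y, -r <= x <= r -> -r <= y <= r -> tc x = tc y -> (x - y) ^+ 2 < s ^+ 2.
  move=> x y /andP[x1 x2] /andP[y1 y2] h.
  have -> : x - y = (x + r) - (y + r) by ring.
  by apply: truncn_close => //; lra.
set A := [set g | _].
have fB : finite_set (`I_K `*` `I_K `*` `I_K `*` `I_K).
  by do 3 (apply: finite_setX; last exact: finite_II); exact: finite_II.
have fA : finite_set (cl @` A).
  apply: sub_finite_set fB => _ [g [Gg gr] <-] /=.
  by have [c1 c2 c3 c4] := coord _ Gg gr; rewrite !tcK.
have inj : {in A &, injective cl}.
  move=> g h /set_mem[Gg gr] /set_mem[Gh hr] [h1 h2 h3 h4].
  have [c1 c2 c3 c4] := coord _ Gg gr; have [d1 d2 d3 d4] := coord _ Gh hr.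
  have := tcs _ _ c1 d1 h1; have := tcs _ _ c2 d2 h2.
  have := tcs _ _ c3 d3 h3; have := tcs _ _ c4 d4 h4.
  rewrite s2 => e4 e3 e2 e1.
  apply: (H _ _ _ _ _ _ Gg Gh (prP _ Gg) (prP _ Gh) hr); rewrite /sq !cE; lra.
by move: fA; rewrite (eq_finite_set (inj_card_eq inj)).
Qed.

Lemma fuchs_countable : countable G0.
Proof.
have : countable (\bigcup_(n in [set: nat]) [set g | G0 g /\ nrm g <= n%:R]).
  apply: bigcup_countable; first exact: countableP.
  by move=> n _; apply: finite_set_countable; exact: nrm_finite.
apply: sub_countable; apply: subset_card_le => g Gg.
exists (Num.truncn (nrm g)).+1 => //; split => //.
exact/ltW/truncnS_gt.
Qed.
End FuchsianGroup.

(** * Words and cylinders of the Bowen-Series map *)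

Section BowenSeriesWords.
Variables (R : realType) (G0 : set (smap R)) (S0 : finType).
Variables (I : S0 -> set (circle R)) (e : S0 -> smap R) (f : circle R -> circle R).
Hypothesis hF : fuchsian G0.
Hypothesis hB : bowen_series G0 I e f.
Implicit Types (a b c : S0) (w v : seq S0) (x y z : circle R).

Lemma e_isu a : isu (e a).
Proof. exact: (fuchs_isu hF (bs_in hB a)). Qed.
Lemma sinv_isu a : isu (sinv (e a)).
Proof. by case: (isu_sinv (e_isu a)). Qed.

Lemma winv_cons a w : winv e (a :: w) = winv e w \o sinv (e a).
Proof.
pose F (g : smap R) b := sinv (e b) \o g.
have H w' g : foldl F g w' = foldl F id w' \o g.
  elim: w' g => [|b w' IH] g //.
  rewrite -[LHS]/(foldl F (F g b) w') IH.
  by rewrite -[foldl F id (b :: w')]/(foldl F (F id b) w') (IH (F id b)).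
exact: (H w (F id a)).
Qed.
Lemma winv_cat w v : winv e (w ++ v) = winv e v \o winv e w.
Proof. by elim: w => [|a w IH] //; rewrite cat_cons !winv_cons IH compA. Qed.
Lemma winv1 a : winv e [:: a] = sinv (e a).
Proof. by rewrite winv_cons. Qed.
Lemma winv_rcons w a : winv e (rcons w a) = sinv (e a) \o winv e w.
Proof. by rewrite -cats1 winv_cat winv1. Qed.
Lemma winv_G0 w : G0 (winv e w).
Proof.
elim: w => [|a w IH]; first exact: (fuchs_id hF).
by rewrite winv_cons; apply: (fuchs_comp hF) => //; apply: (fuchs_sinv hF); exact: (bs_in hB).
Qed.
Lemma winv_isu w : isu (winv e w).
Proof. exact: (fuchs_isu hF (winv_G0 w)). Qed.

Lemma I_closed a : closed (I a).
Proof. by case: (closed_arc_facts (bs_arc hB a)). Qed.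
Lemma I_closure a : I a `<=` closure (I a)°.
Proof. by case: (closed_arc_facts (bs_arc hB a)). Qed.
Lemma I_bd_finite a : finite_set (I a `\` (I a)°).
Proof. by case: (closed_arc_facts (bs_arc hB a)). Qed.
Lemma I_int_neq0 a : (I a)° !=set0.
Proof. by case: (closed_arc_facts (bs_arc hB a)). Qed.
Lemma closure_intI a : closure (I a)° = I a.
Proof.
apply/seteqP; split; last exact: I_closure.
by rewrite [X in _ `<=` X]((closure_id _).1 (@I_closed a)); apply: closureS; exact: interior_subset.
Qed.

Lemma f_in a x : (I a)° x -> f x = act (sinv (e a)) x.
Proof.
by move=> ax; apply: on_sphere_inj; rewrite (bs_res hB ax) actE//; exact: sinv_isu.
Qed.

Lemma meet_int (U : set (circle R)) a y : open U -> U y -> I a y ->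
  exists2 z, U z & (I a)° z.
Proof.
move=> oU Uy /I_closure cy; have [z [az Uz]] := cy U (open_nbhs_nbhs (conj oU Uy)).
by exists z.
Qed.

Lemma letter_uniq a b x : (I a)° x -> (I b)° x -> a = b.
Proof.
move=> ax bx; apply/eqP/negPn/negP => /(bs_disj hB) /seteqP[+ _].
by move=> /(_ x); apply.
Qed.

(** Removes from an inclusion the finitely many points at which [f] does not follow the expected
    branch. *)
Lemma open_sub_closed (U C P : set (circle R)) : open U -> closed C -> finite_set P ->
  U `<=` C `|` P -> U `<=` C.
Proof.
move=> oU cC fP H y Uy; apply: contrapT => nC.
have : (U `&` ~` C)° y.
  by rewrite ((interior_id _).1 (openI oU (closed_openC cC))).
by move=> /(open_infinite fP)[z [/H[]]].
Qed.

(** The transition relation expressed by the branch e_a^-1 instead of [f], hence blind to the values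
    of [f] at endpoints; by [tr_sigma] it is the condition defining [Sigma]. *)
Definition tr a b : Prop := (I b)° `<=` act (e a) @^-1` (I a)°.
Definition trb a b : bool := `[< tr a b >].
Lemma trbP a b : reflect (tr a b) (trb a b).
Proof. exact: asboolP. Qed.

Lemma fI_sub a : exists2 P, finite_set P &
  closure (f @` I a) `<=` act (e a) @^-1` I a `|` P.
Proof.
pose P := f @` (I a `\` (I a)°); exists P; first exact/finite_image/I_bd_finite.
have cP : closed P.
  apply: compact_closed; [exact: circle_hausdorff|apply: finite_compact].
  exact/finite_image/I_bd_finite.
have sub : f @` I a `<=` act (e a) @^-1` (I a)° `|` P.
  move=> _ [x Ix <-]; have [ix|nx] := EM ((I a)° x); last by right; exists x.
  by left => /=; rewrite (f_in ix) actKV//; exact: e_isu.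
apply: subset_trans (closureS sub) _.
by rewrite closureU -((closure_id _).1 cP) act_closure ?closure_intI//; exact: e_isu.
Qed.

Lemma act_int_open a : open (act (e a) @^-1` (I a)°).
Proof. by apply: act_open; [exact: e_isu|exact: open_interior]. Qed.

Lemma tr_of_sub a b : I b `<=` closure (f @` I a) \/ (I b)° `<=` closure (f @` I a) -> tr a b.
Proof.
move=> H; have {}H : (I b)° `<=` closure (f @` I a).
  by case: H => // H; apply: subset_trans H; exact: interior_subset.
have [P fP sP] := fI_sub a.
have cl : closed (act (e a) @^-1` I a).
  rewrite -{1}closure_intI -act_closure; last exact: e_isu.
  exact: closed_closure.
have := open_sub_closed (open_interior _) cl fP (subset_trans H sP).
move=> /interiorS; rewrite act_interior ?((interior_id _).1 (open_interior _))//.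
exact: e_isu.
Qed.

Lemma tr_int a b : tr a b -> (I b)° `<=` (f @` I a)°.
Proof.
move=> h; apply: subset_trans h _; rewrite -{1}((interior_id _).1 (act_int_open a)).
apply: interiorS => y /= ay; exists (act (e a) y); first exact: interior_subset.
by rewrite (f_in ay) actK//; exact: e_isu.
Qed.

Lemma tr_sigma a b : tr a b <-> (I b)° `<=` (f @` I a)°.
Proof.
split; first exact: tr_int.
move=> h; apply: tr_of_sub; right; apply: subset_trans h _.
by apply: subset_trans (@subset_closure _ _); exact: interior_subset.
Qed.

Lemma tr_meet a b y : (I b)° y -> (I a)° (act (e a) y) -> tr a b.
Proof.
move=> yb ya; apply: tr_of_sub; left; apply: (bs_markov hB); exists y; split => //.
rewrite /mkset; have : (act (e a) @^-1` (I a)°)° y by rewrite ((interior_id _).1 (act_int_open a)).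
apply: interiorS => z /= az; exists (act (e a) z); first exact: interior_subset.
by rewrite (f_in az) actK//; exact: e_isu.
Qed.

(** If [y] is an endpoint, [f y] need not be e_b^-1(y). But e_b^-1(y) is a limit of points of
    e_b^-1(int I_b), and one of the finitely many closed arcs contains such points arbitrarily near;
    it provides [c]. *)
Lemma next_letter b y : I b y -> exists c, tr b c /\ I c (act (sinv (e b)) y).
Proof.
move=> by_; set z := act _ y; set V := act (e b) @^-1` (I b)°.
have zV : closure V z by rewrite act_closure ?closure_intI /= ?actKV//; exact: e_isu.
apply: contrapT => H.
have {}H c : \forall t \near z, ~ (V `&` I c) t.
  have : ~ closure (V `&` I c) z.
    move=> cz; apply: H; exists c; split; last first.
      by rewrite ((closure_id _).1 (@I_closed c)); apply: closureS cz => t [].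
    have [t [[Vt ct] _]] := cz setT filterT.
    have [s Vs cs] := meet_int (act_int_open b) Vt ct.
    exact: tr_meet cs Vs.
  by rewrite -[~ _]/((~` closure _) z) -interiorC.
have /zV[t [Vt nt]] : nbhs z [set t | forall c, ~ (V `&` I c) t].
  exact: (@filter_forall _ _ (fun c t => ~ (V `&` I c) t) (nbhs z) _ H).
have : (\bigcup_a I a) t by rewrite (bs_cover hB).
by move=> [c _ ct]; exact: (nt c).
Qed.

(** Open cylinders defined by group elements. They differ from those of [f] by finite sets and are
    their interiors along admissible words ([cyl_int]). *)
Fixpoint icyl w : set (circle R) :=
  if w is a :: w' then (I a)° `&` act (sinv (e a)) @^-1` icyl w' else setT.

Lemma icyl_open w : open (icyl w).
Proof.
elim: w => [|a w IH] /=; first exact: openT.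
by apply: openI; [exact: open_interior|apply: act_open => //; exact: sinv_isu].
Qed.

(** By the Markov inclusions the condition on the last letter implies all earlier ones. *)
Lemma icyl_path a w : path trb a w ->
  icyl (a :: w) = act (winv e (belast a w)) @^-1` (I (last a w))°.
Proof.
elim: w a => [|c w IH] a.
  by move=> _ /=; rewrite setIT; apply: funext => x /=; rewrite act_id.
move=> pcw; have /andP[/trbP ac pw] : trb a c && path trb c w by exact: pcw.
have E : icyl (a :: c :: w) = (I a)° `&` act (sinv (e a)) @^-1` icyl (c :: w) by [].
have e1 x : act (winv e (a :: belast c w)) x = act (winv e (belast c w)) (act (sinv (e a)) x).
  by rewrite winv_cons act_comp//; [exact: winv_isu|exact: sinv_isu].
rewrite E IH//; apply/seteqP; split => x.
  by move=> [_] h; rewrite /= e1.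
rewrite /= e1 => h; split => //.
have : icyl (c :: w) (act (sinv (e a)) x) by rewrite IH.
by move=> [/ac /=]; rewrite actKV//; exact: e_isu.
Qed.

Lemma icyl_closure a w : path trb a w ->
  closure (icyl (a :: w)) = act (winv e (belast a w)) @^-1` I (last a w).
Proof. by move=> /icyl_path ->; rewrite act_closure ?closure_intI//; exact: winv_isu. Qed.

Lemma icyl_neq0 a w : path trb a w -> icyl (a :: w) !=set0.
Proof.
move=> /icyl_path ->; have [y hy] := I_int_neq0 (last a w).
by exists (act (sinv (winv e (belast a w))) y); rewrite /= actKV//; exact: winv_isu.
Qed.

Lemma icyl_sub_cyl w : icyl w `<=` cyl I f w.
Proof.
elim: w => [|a w IH] x //= [ax /IH h]; split; first exact: interior_subset.
by rewrite /= (f_in ax).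
Qed.

Lemma cyl_sub_icyl w : exists2 P, finite_set P & cyl I f w `<=` icyl w `|` P.
Proof.
elim: w => [|a w [P fP sP]]; first by exists set0 => //= x _; left.
exists ((I a `\` (I a)°) `|` act (e a) @` P).
  by rewrite finite_setU; split; [exact: I_bd_finite|exact: finite_image].
move=> x /= [ax fx]; have [ix|nx] := EM ((I a)° x); last by right; left.
have := fx; rewrite /preimage /= (f_in ix) => /sP[h|h]; first by left.
by right; right; exists (act (sinv (e a)) x) => //; rewrite actKV//; exact: e_isu.
Qed.

Lemma cyl_int a w : path trb a w -> (cyl I f (a :: w))° = icyl (a :: w).
Proof.
move=> pw; apply/seteqP; split; last first.
  by rewrite -{1}((interior_id _).1 (icyl_open (a :: w))); apply: interiorS; exact: icyl_sub_cyl.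
have [P fP sP] := cyl_sub_icyl (a :: w).
have : (cyl I f (a :: w))° `<=` closure (icyl (a :: w)).
  apply: (open_sub_closed (open_interior _) (@closed_closure _ _) fP).
  apply: subset_trans (@interior_subset _ _) (subset_trans sP _).
  by apply: setSU; exact: subset_closure.
move=> /interiorS; rewrite ((interior_id _).1 (open_interior _)) icyl_closure//.
by rewrite act_interior -?icyl_path//; exact: winv_isu.
Qed.

Lemma icyl_prefix v w x : icyl v x -> icyl w x -> (size v <= size w)%N -> v = take (size v) w.
Proof.
elim: v w x => [|a v IH] [|b w] x //=; rewrite ?take0// => -[ax hv] [bx hw] vw.
by rewrite -(letter_uniq ax bx) -(IH w _ hv) //; move: hw; rewrite (letter_uniq ax bx).
Qed.

Lemma icyl_cat v w : icyl (v ++ w) `<=` icyl v.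
Proof. by elim: v => [|a v IH] x //= [ax /IH]. Qed.

Lemma sinv_id : sinv (id : smap R) = id.
Proof. exact: sinv_uniq. Qed.

(** Otherwise the iterates of [f] keep [I d] inside itself up to finite sets, and transitivity
    leaves [d] as the only letter; yet a single closed arc does not cover the circle. *)
Lemma e_neq_id d : e d <> id.
Proof.
move=> ed; have fd x : (I d)° x -> f x = x.
  by move=> /f_in; rewrite ed sinv_id act_id.
have H n : exists2 P, finite_set P & iter n f @` I d `<=` I d `|` P.
  elim: n => [|n [P fP sP]]; first by exists set0 => // _ [x dx <-]; left.
  exists (f @` (P `|` (I d `\` (I d)°))).
    by apply: finite_image; rewrite finite_setU; split => //; exact: I_bd_finite.
  move=> _ [x dx <-]; have /sP[h|h] : (iter n f @` I d) (iter n f x) by exists x.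
    have [ix|nx] := EM ((I d)° (iter n f x)); first by left; rewrite /= fd.
    by right; exists (iter n f x) => //; right.
  by right; exists (iter n f x) => //; left.
have all c : c = d.
  have [n sn] := bs_trans hB d c; have [P fP sP] := H n.
  have cP : closed P by apply: compact_closed; [exact: circle_hausdorff|exact: finite_compact].
  have : (I c)° `<=` I d.
    apply: (open_sub_closed (open_interior _) (@I_closed d) fP).
    apply: subset_trans (@interior_subset _ _) (subset_trans sn _).
    rewrite [X in _ `<=` X]((closure_id _).1 (closedU (@I_closed d) cP)).
    exact: closureS.
  move=> /interiorS; rewrite ((interior_id _).1 (open_interior _)) => s.
  by have [y cy] := I_int_neq0 c; apply: letter_uniq cy (s _ cy).
have [x nx] := closed_arc_proper (bs_arc hB d).
have : (\bigcup_a I a) x by rewrite (bs_cover hB).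
by move=> [c _]; rewrite (all c).
Qed.

Lemma winv_words_finite g : G0 g -> g <> id ->
  finite_set [set w | exists a v, [/\ w = a :: v, path trb a v & winv e w = g]].
Proof.
move=> Gg gid; have [N0 /(_ g Gg gid) H] := bs_bnd hB.
apply: (sub_finite_set _ (card_le_finite H (finite_II N0))).
move=> w [a [v [-> pv eg]]]; split=> //.
by rewrite cyl_int//; exact: icyl_neq0.
Qed.

Lemma short_words_finite (r : R) :
  finite_set [set w | exists a v, [/\ w = a :: v, path trb a v & nrm (winv e w) <= r]].
Proof.
pose W g := [set w | exists a v, [/\ w = a :: v, path trb a v & winv e w = g]].
have fW1 : finite_set (\bigcup_(g in [set g | G0 g /\ nrm g <= r] `\ id) W g).
  apply: bigcup_finite; first exact/finite_setD/(nrm_finite hF).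
  by move=> g [[Gg _] /= gid]; exact: winv_words_finite.
have fW2 : finite_set (\bigcup_(d in [set: S0]) [set take (size w).-1 w | w in W (sinv (e d))]).
  apply: bigcup_finite; first exact: finite_finset.
  move=> d _; apply: finite_image; apply: winv_words_finite.
    by apply: (fuchs_sinv hF); exact: (bs_in hB).
  move=> h; apply: (@e_neq_id d); have [_ h1 _] := isu_sinv (e_isu d).
  by move: h1; rewrite h.
apply: (@sub_finite_set _ _ (\bigcup_(g in [set g | G0 g /\ nrm g <= r] `\ id) W g `|`
  \bigcup_(d in [set: S0]) [set take (size w).-1 w | w in W (sinv (e d))])); last first.
  by rewrite finite_setU.
move=> w [a [v [ew pv nr]]]; have [wid|wid] := EM (winv e w = id); last first.
  left; exists (winv e w); last by exists a, v.
  by split => //; split => //; exact: winv_G0.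
have [y /interior_subset/next_letter[c [/trbP tc _]]] := I_int_neq0 (last a v).
(* (Bnd) says nothing about the identity. A word representing it, prolonged by a letter [c],
   represents e_c^-1, which is not the identity. *)
right; exists c => //; exists (rcons w c).
  exists a, (rcons v c); split; first by rewrite ew.
    by rewrite rcons_path pv tc.
  by rewrite winv_rcons wid.
by rewrite size_rcons -cats1 take_size_cat.
Qed.

Lemma long_words (r : R) : exists n, forall a v, path trb a v -> (n <= size v)%N ->
  r < nrm (winv e (a :: v)).
Proof.
have /finite_seqP[s es] := short_words_finite r.
exists (\max_(w <- s) size w)%N => a v pv nv; rewrite ltNge; apply/negP => nr.
have : (a :: v) \in s.
  have : [set` s] (a :: v) by rewrite -es; exists a, v.
  by [].
move=> h; have := @leq_bigmax_seq _ s xpredT size _ h isT.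
by rewrite leqNgt /= ltnS nv.
Qed.

(** Up to a finite set, f^n(I a) is covered by the arcs reachable from [a] in n steps. Transitivity
    makes one of them meet the interior of [I b]. *)
Lemma letters_connected a b : exists2 w, path trb a w & last a w = b.
Proof.
pose Rn n := [set b | exists w, [/\ path trb a w, size w = n & last a w = b]].
have H n : exists2 P, finite_set P & iter n f @` I a `<=` (\bigcup_(c in Rn n) I c) `|` P.
  elim: n => [|n [P fP sP]].
    by exists set0 => // _ [x ax <-]; left; exists a => //; exists [::].
  exists (f @` (P `|` \bigcup_(c in [set: S0]) (I c `\` (I c)°))).
    apply: finite_image; rewrite finite_setU; split => //.
    by apply: bigcup_finite => [|c _]; [exact: finite_finset|exact: I_bd_finite].
  move=> _ [x ax <-]; have /sP[[c Rc cx]|h] : (iter n f @` I a) (iter n f x) by exists x.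
    have [ix|nx] := EM ((I c)° (iter n f x)); last first.
      by right; exists (iter n f x) => //; right; exists c.
    left; have [d [/trbP td dx]] := next_letter cx.
    exists d; last by rewrite /= (f_in ix).
    case: Rc => w [pw sw lw]; exists (rcons w d).
    by rewrite rcons_path pw lw td size_rcons sw last_rcons.
  by right; exists (iter n f x) => //; left.
have [n sn] := bs_trans hB a b; have [P fP sP] := H n.
have cP : closed P by apply: compact_closed; [exact: circle_hausdorff|exact: finite_compact].
have [y0 by0] := I_int_neq0 b; have := by0; rewrite -{1}((interior_id _).1 (open_interior (I b))).
move=> /(open_infinite fP)[y by_ nPy].
have : closure (iter n f @` I a) y by apply: sn; exact: interior_subset.
move=> /(closureS sP); rewrite closureU -((closure_id _).1 cP) => -[cy|//].
have [z [[c [w [pw _ lw]] cz] bz]] := cy _ (open_nbhs_nbhs (conj (open_interior _) by_)).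
have [t bt ct] := meet_int (open_interior _) bz cz.
by exists w => //; rewrite lw (letter_uniq ct bt).
Qed.
End BowenSeriesWords.

(** * Derivatives along the circle *)

Section CircleDerivative.
Variable R : realType.
Implicit Types (x y : circle R) (a b : Cplx R) (g : smap R).

Lemma circle_dnbhs_proper x : ProperFilter (x^' : set_system (circle R)).
Proof.
apply: Build_ProperFilter_ex.
move=> A; rewrite /dnbhs /within /= => /nbhs_csq[r r0 H].
by have [y yx xy] := circle_perfect x r0; exists y; exact: H.
Qed.

Lemma nbhs_set_val x (B : set (Cplx R)) : nbhs (set_val x) B -> nbhs x (set_val @^-1` B).
Proof.
move=> nB; rewrite nbhsE; exists (set_val @^-1` B°).
  by split; [exists B° => //; exact: open_interior|exact: nB].
by move=> y /=; exact: interior_subset.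
Qed.

Lemma inv_affine_continuous (K : numFieldType) (a b c z : K) : (a * z + b) * c != 0 ->
  {for z, continuous (fun t => ((a * t + b) * c)^-1)}.
Proof.
move=> h; apply: (@continuousV _ _ (fun t => (a * t + b) * c) z h).
apply: (@continuousM _ _ (fun t => a * t + b) (fun=> c)); last exact: cst_continuous.
apply: (@continuousD _ _ _ (fun t => a * t) (fun=> b)); last exact: cst_continuous.
apply: (@continuousM _ _ (fun=> a) id); last exact: cvg_id.
exact: cst_continuous.
Qed.

(** The difference quotient of an element of SU(1,1) is the inverse of the product of its
    denominators at the two points, so the limit is explicit. This turns the derivatives in
    [bs_dist] into [der]. *)
Lemma circle_deriv_local (h : circle R -> circle R) g x (U : set (circle R)) :
  isu g -> open U -> U x -> (forall y, U y -> h y = act g y) ->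
  circle_derivable h x /\ circle_deriv h x = der g x.
Proof.
move=> [a [b r]] oU Ux hU.
pose Q (t : Cplx R) := ((b^* * t + a^*) * (b^* * set_val x + a^*))^-1.
have den y : b^* * set_val y + a^* != 0 by apply: (rep_den_neq0 r); rewrite sq_circle.
have cQ : {for set_val x, continuous Q}.
  by apply: inv_affine_continuous; rewrite mulf_neq0.
have e1 : sq a - sq b = 1 by case: r.
have aE : a * a^* - b * b^* = 1 by rewrite !mulJ -rmorphB e1.
have cv : circle_quot h x y @[y --> x^'] --> Q (set_val x).
  move=> B /cQ /nbhs_set_val nB; rewrite /= /dnbhs /within /= /nbhs /=.
  have : nbhs x (set_val @^-1` (Q @^-1` B) `&` U).
    by apply: filterI => //; apply: open_nbhs_nbhs.
  apply: filterS => y [By Uy] yx; rewrite /circle_quot (hU _ Uy) (hU _ Ux).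
  have [-> _] := rep_act x r; have [-> _] := rep_act y r.
  have yx0 : set_val y - set_val x != 0.
    by rewrite subr_eq0; apply/negP => /eqP /circle_ext h'; rewrite h' eqxx in yx.
  suff -> : ((a * set_val y + b) / (b^* * set_val y + a^*) -
    (a * set_val x + b) / (b^* * set_val x + a^*)) / (set_val y - set_val x) = Q (set_val y) by [].
  have -> : Q (set_val y) = (a * a^* - b * b^*) * ((b^* * set_val y + a^*) * (b^* * set_val x + a^*))^-1.
    by rewrite aE mul1r.
  by field; rewrite yx0 !den.
have PF := circle_dnbhs_proper x.
split; first by apply/cvg_ex; exists (Q (set_val x)).
rewrite /circle_deriv (cvg_lim _ cv); last exact: norm_hausdorff.
by rewrite (rep_der x r) cabs_sq /Q sqV sqM -expr2 -exprVn sqrtr_sqr ger0_norm// invr_ge0 sq_ge0.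
Qed.
End CircleDerivative.

Lemma finite_pos_bound (R : realType) (T : finType) (P : T -> R -> Prop) :
  (forall t c c', c' <= c -> P t c -> P t c') ->
  (forall t, exists2 c, 0 < c & P t c) -> exists2 c, 0 < c & forall t, P t c.
Proof.
move=> mono /(_ _)/cid2-/all_sig2[F F0 FP].
exists (\big[Num.min/1]_(t : T) F t).
  by elim/big_ind: _ => // x y x0 y0; rewrite lt_min x0.
move=> t; apply: mono (FP t); rewrite (bigD1 t) //= ge_min lexx //.
Qed.

Lemma finite_upper_bound (R : realType) (T : finType) (F : T -> R) :
  exists2 E, 1 <= E & forall t, F t <= E.
Proof.
exists (1 + \sum_t `|F t|); first by rewrite lerDl sumr_ge0.
move=> t; rewrite (bigD1 t) //=; have := ler_norm (F t).
by have : 0 <= \sum_(i | i != t) `|F i| by [rewrite sumr_ge0]; lra.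
Qed.

(** * Distortion, expansion and shadowing along codes *)

Section Distortion.
Variables (R : realType) (G0 : set (smap R)) (S0 : finType).
Variables (I : S0 -> set (circle R)) (e : S0 -> smap R) (f : circle R -> circle R).
Hypothesis hF : fuchsian G0.
Hypothesis hB : bowen_series G0 I e f.
Implicit Types (a b c : S0) (w v : seq S0) (x y z : circle R).
Local Notation trb := (trb I e).
Local Notation icyl := (icyl I e).

Lemma iter_icyl w k x : icyl w x -> (k <= size w)%N ->
  iter k f x = act (winv e (take k w)) x.
Proof.
elim: w k x => [|a w IH] [|k] x //=; rewrite ?act_id// => -[ax wx] kw.
rewrite -iterS iterSr (f_in hF hB ax) IH//.
rewrite -/(winv e (a :: take k w)) (winv_cons e a) act_comp//; [exact: (winv_isu hF hB)|].
exact: (sinv_isu hF hB).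
Qed.

Lemma take_belast a w : take (size w) (a :: w) = belast a w.
Proof. by rewrite lastI -cats1 take_size_cat// size_belast. Qed.

Lemma bounded_distortion : exists2 B : R, 1 < B & forall a w, path trb a w ->
  forall x y, icyl (a :: w) x -> icyl (a :: w) y ->
  der (winv e (belast a w)) x <= B * der (winv e (belast a w)) y.
Proof.
have [B B1 H] := bs_dist hB; exists B => // a w pw x y wx wy.
have iu := winv_isu hF hB (belast a w).
have loc z : icyl (a :: w) z -> forall t, icyl (a :: w) t ->
    iter (size (a :: w)).-1 f t = act (winv e (belast a w)) t.
  by move=> _ t wt; rewrite (iter_icyl wt) ?leqW//= -/(take (size w) (a :: w)) take_belast.
have [dx ex] := circle_deriv_local iu (icyl_open hF hB (a :: w)) wx (loc x wx).
have [dy ey] := circle_deriv_local iu (icyl_open hF hB (a :: w)) wy (loc y wy).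
rewrite -ex -ey; apply: (H (a :: w)) => // k /andP[k0 kw].
by rewrite (iter_icyl wx kw) (iter_icyl wy kw) !actE//; exact: (winv_isu hF hB).
Qed.

(** [der_le_far] for the inverse branch on the arc of the last letter: its interior contains two
    points whose distance is bounded below uniformly in the letter. Continuity extends the bound to
    the endpoints. *)
Lemma der_inverse_branch : exists2 K : R, 1 <= K & forall a w, path trb a w ->
  forall y, I (last a w) y ->
  der (sinv (winv e (belast a w))) y <= K / nrm (winv e (belast a w)).
Proof.
have [B B1 H] := bounded_distortion.
have [c c0 Hc] : exists2 c : R, 0 < c & forall b, exists y1 y2,
    [/\ (I b)° y1, (I b)° y2 & c <= csq y1 y2].
  apply: finite_pos_bound.
    by move=> b c c' cc [y1 [y2 [h1 h2 h3]]]; exists y1, y2; split => //; exact: le_trans h3.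
  move=> b; have [y by_] := I_int_neq0 hB b.
  have := by_; rewrite -{1}((interior_id _).1 (open_interior (I b))).
  move=> /(open_infinite (finite_set1 y))[z bz zy].
  exists (csq y z); last by exists y, z.
  by apply: csq_gt0; apply/negP => /eqP yz; apply: zy; rewrite yz.
exists (Num.max 1 (4 * B / c)); first by rewrite le_max lexx.
move=> a w pw y Iy; set u := winv e _; have iu : isu u by exact: (winv_isu hF hB).
have [iu' _ _] := isu_sinv iu.
have [y1 [y2 [h1 h2 h3]]] := Hc (last a w).
have cmp z z' : (I (last a w))° z -> (I (last a w))° z' -> der (sinv u) z <= B * der (sinv u) z'.
  move=> hz hz'; rewrite -(actKV z iu) -(actKV z' iu) !der_sinv//.
  have d0 := der_gt0 (act (sinv u) z) iu; have d0' := der_gt0 (act (sinv u) z') iu.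
  rewrite ler_pdivlMr// mulrC ler_pdivrMr//.
  by apply: (H _ _ pw); rewrite (icyl_path hF hB pw) /= actKV.
have far := der_le_far iu' c0 h1 h2 h3 cmp.
rewrite nrm_sinv// in far.
apply: le_trans (der_le_closure iu' far _) _; first by rewrite (closure_intI hB).
by rewrite ler_pM2r ?invr_gt0 ?nrm_gt0// le_max lexx orbT.
Qed.

Lemma der_expansion : exists2 K : R, 1 <= K & forall a w, path trb a w ->
  forall x, closure (icyl (a :: w)) x ->
  nrm (winv e (belast a w)) <= K * der (winv e (belast a w)) x.
Proof.
have [K K1 H] := der_inverse_branch; exists K => // a w pw x.
rewrite (icyl_closure hF hB pw) /= => /(H _ _ pw).
set u := winv e _; have iu : isu u by exact: (winv_isu hF hB).
rewrite der_sinv// ler_pdivlMr ?nrm_gt0// mulrC ler_pdivrMr ?der_gt0//.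
Qed.

Lemma long_prefix (r : R) : exists n, forall a w, path trb a w -> (n <= size w)%N ->
  r < nrm (winv e (belast a w)).
Proof.
(* [belast] drops the last letter, so one more letter is required. *)
have [n H] := long_words hF hB r; exists n.+1 => a w.
case/lastP: w => [|w b]; first by rewrite ltn0.
rewrite rcons_path => /andP[pw _]; rewrite size_rcons ltnS => nw.
by rewrite belast_rcons; exact: H.
Qed.

(** Two points of a cylinder are images under one inverse branch, and [csq_act] bounds their squared
    distance by 4 (K / nrm)^2. *)
Lemma small_cylinders (d : R) : 0 < d -> exists n, forall a w, path trb a w ->
  (n <= size w)%N -> forall x y, closure (icyl (a :: w)) x -> closure (icyl (a :: w)) y ->
  csq x y < d.
Proof.
move=> d0; have [K K1 H] := der_inverse_branch.
(* With a norm above 1, the bound 4 K^2 / nrm < d already gives 4 K^2 / nrm^2 < d. *)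
have [n Hn] := long_prefix (Num.max 1 (4 * K ^+ 2 / d)); exists n => a w pw nw x y.
rewrite !(icyl_closure hF hB pw) /= => /(H _ _ pw) + /(H _ _ pw).
have := Hn _ _ pw nw; set u := winv e _ => Nu.
have iu : isu u by exact: (winv_isu hF hB).
have [iu' _ _] := isu_sinv iu; have N0 := nrm_gt0 iu.
have -> : csq x y = der (sinv u) (act u x) * der (sinv u) (act u y) * csq (act u x) (act u y).
  by rewrite -csq_act// !actK.
move: (act u x) (act u y) => {}x {}y hx hy.
have := der_gt0 x iu'; have := der_gt0 y iu' => dy dx.
move: Nu; rewrite gt_max => /andP[N1]; rewrite ltr_pdivrMr// => Nd.
have KN : K = K / nrm u * nrm u by rewrite divfK// gt_eqF.
have r0 : 0 <= K / nrm u by rewrite divr_ge0 ?(ltW N0)//; lra.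
move: (K / nrm u) hx hy KN r0 Nd N1 N0 => r hx hy -> r0 Nd N1 N0.
have h1 : der (sinv u) x * der (sinv u) y <= r * r by rewrite ler_pM// ltW.
have h2 : 0 <= der (sinv u) x * der (sinv u) y by rewrite mulr_ge0// ltW.
have h3 : 4 * r ^+ 2 * nrm u < d.
  rewrite -(ltr_pM2r N0); have -> : 4 * r ^+ 2 * nrm u * nrm u = 4 * (r * nrm u) ^+ 2 by ring.
  by rewrite [d * _]mulrC.
have h4 := csq_le4 x y; have h5 := csq_ge0 x y.
have h6 : der (sinv u) x * der (sinv u) y * csq x y <= r * r * 4 by rewrite ler_pM.
by have := sqr_ge0 r; rewrite expr2 in h3 *; nra.
Qed.

Lemma code_path (s : nat -> S0) n : (forall i, trb (s i) (s i.+1)) ->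
  [/\ path trb (s 0%N) (mkseq (fun i => s i.+1) n),
     last (s 0%N) (mkseq (fun i => s i.+1) n) = s n,
     belast (s 0%N) (mkseq (fun i => s i.+1) n) = mkseq s n &
     s 0%N :: mkseq (fun i => s i.+1) n = mkseq s n.+1].
Proof.
move=> tr; have E k (g : nat -> S0) : g 0%N :: mkseq (fun i => g i.+1) k = mkseq g k.+1.
  by rewrite /mkseq /= -add1n iotaDl -map_comp.
have S k (g : nat -> S0) : mkseq g k.+1 = rcons (mkseq g k) (g k).
  by rewrite /mkseq -addn1 iotaD map_cat cats1.
have [h1 h2] : path trb (s 0%N) (mkseq (fun i => s i.+1) n) /\
     last (s 0%N) (mkseq (fun i => s i.+1) n) = s n.
  elim: n => [|n [IH1 IH2]] //; rewrite S rcons_path last_rcons IH1 IH2; split => //.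
  exact: tr.
split => //.
have := lastI (s 0%N) (mkseq (fun i => s i.+1) n).
by rewrite E S h2 => /rcons_inj[->].
Qed.

(** Membership in closed arcs: endpoints have codes too, possibly several. *)
Definition coded (s : nat -> S0) x := (forall i, trb (s i) (s i.+1)) /\
  forall n, I (s n) (act (winv e (mkseq s n)) x).

Lemma mkseqS (s : nat -> S0) n : mkseq s n.+1 = rcons (mkseq s n) (s n).
Proof. by rewrite /mkseq -addn1 iotaD map_cat cats1. Qed.

Lemma code_exists a x : I a x -> exists2 s, coded s x & s 0%N = a.
Proof.
move=> ax; have nextP (p : {p : S0 * circle R | I p.1 p.2}) :
    {q : {p : S0 * circle R | I p.1 p.2} | trb (sval p).1 (sval q).1 /\
      (sval q).2 = act (sinv (e (sval p).1)) (sval p).2}.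
  case: p => -[b y] /= by_; apply: cid.
  have [c [tc cy]] := next_letter hF hB by_.
  by exists (exist _ (c, act (sinv (e b)) y) cy); split => //; apply/trbP.
pose q n := iter n (fun p => sval (nextP p)) (exist (fun p : S0 * circle R => I p.1 p.2) (a, x) ax).
exists (fun n => (sval (q n)).1) => //.
have qS n := svalP (nextP (q n)).
split; first by move=> i; case: (qS i).
move=> n; suff <- : (sval (q n)).2 = act (winv e (mkseq (fun n => (sval (q n)).1) n)) x.
  exact: (svalP (q n)).
elim: n => [|n IH]; first by rewrite /= act_id.
rewrite mkseqS (winv_rcons e) act_comp; first by rewrite -IH; case: (qS n).
  exact: (sinv_isu hF hB).
exact: (winv_isu hF hB).
Qed.

Lemma coded_closure s x n : coded s x -> closure (icyl (mkseq s n.+1)) x.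
Proof.
move=> [tr sx]; have [p1 p2 p3 p4] := code_path n tr.
by rewrite -p4 (icyl_closure hF hB p1) p2 p3 /=; exact: sx.
Qed.

Lemma code_of x : exists s, coded s x.
Proof.
have : (\bigcup_a I a) x by rewrite (bs_cover hB).
by move=> [a _ /code_exists[s sx _]]; exists s.
Qed.

Lemma code_der : exists2 K : R, 1 <= K & forall s x n, coded s x ->
  nrm (winv e (mkseq s n)) <= K * der (winv e (mkseq s n)) x.
Proof.
have [K K1 H] := der_expansion; exists K => // s x n sx.
have [p1 p2 p3 p4] := code_path n sx.1.
by have := H _ _ p1 x; rewrite p3 p4; apply; exact: coded_closure.
Qed.

Lemma gen_bound : exists2 E : R, 1 <= E & forall a, nrm (sinv (e a)) <= E.
Proof.
have [E E1 HE] := finite_upper_bound (fun a => nrm (sinv (e a))).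
by exists E.
Qed.

Lemma winv_nrm_le : exists2 E : R, 1 <= E & forall w, nrm (winv e w) <= E ^+ size w.
Proof.
have [E E1 HE] := gen_bound; exists (4 * E); first lra.
elim/last_ind => [|w a IH].
  by rewrite (rep_nrm (rep_id R)) sq1.
rewrite (winv_rcons e) size_rcons exprS.
apply: le_trans (nrm_comp (sinv_isu hF hB a) (winv_isu hF hB w)) _.
rewrite ler_pM ?mulr_ge0 ?ler_wpM2l// ltW// nrm_gt0//.
  exact: (sinv_isu hF hB).
exact: (winv_isu hF hB).
Qed.

(* The geodesic ray towards [x] passes at bounded distance from the points
   [u^-1 0], [u] running over the inverse branches coding [x]. *)
Lemma shadowing (C : R) : exists M : R, forall h x s, isu h -> coded s x ->
  nrm h <= C * der h x -> 1 < der h x ->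
  exists n, der h x <= der (winv e (mkseq s n)) x /\
    nrm (h \o sinv (winv e (mkseq s n))) <= M.
Proof.
have [K K1 HK] := code_der; have [E E1 HE] := gen_bound.
exists (8 * K * E + 2 * C) => h x s ih sx hC h1.
pose u n := winv e (mkseq s n).
have iu n : isu (u n) by exact: (winv_isu hF hB).
have ex : exists n, der h x <= der (u n) x.
  have [n Hn] := long_prefix (K * der h x); exists n.
  have [p1 _ p3 _] := code_path n sx.1.
  have := Hn _ _ p1; rewrite size_mkseq p3 => /(_ (leqnn _)) lt.
  have := HK s x n sx => le; have := lt_le_trans lt le.
  by rewrite ltr_pM2l; [exact: ltW|lra].
(* The first prefix that expands at least as much as [h]. Its predecessor expands less and one
   letter contributes at most 4 E, so its derivative is at most 4 E times that of [h]. *)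
have [n hn min] := ex_minnP ex; exists n; split => //.
case: n hn min => [|n] hn min.
  by move: hn; rewrite /u /= der_id; lra.
have lt : der (u n) x < der h x by rewrite ltNge; apply/negP => /min; rewrite ltnn.
have step : der (u n.+1) x <= 4 * E * der h x.
  rewrite /u mkseqS (winv_rcons e) (der_comp _ (sinv_isu hF hB _) (iu n)).
  apply: ler_pM; [|exact: ltW (der_gt0 _ (iu n))| |exact: ltW].
    by apply/ltW/der_gt0; exact: (sinv_isu hF hB).
  apply: le_trans (der_le _ (sinv_isu hF hB _)) _; exact: ler_wpM2l.
have uK := HK s x n.+1 sx; rewrite -/(u n.+1) in uK.
have dh := der_gt0 x ih; have du := der_gt0 x (iu n.+1).
have q1 : nrm (u n.+1) / der h x <= 4 * K * E.
  rewrite ler_pdivrMr//; apply: le_trans uK _.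
  by have := ler_wpM2l (le_trans ler01 K1) step; lra.
have q2 : nrm h / der (u n.+1) x <= C.
  rewrite ler_pdivrMr//; apply: (le_trans hC).
  have C0 : 0 <= C by rewrite -(pmulr_lge0 C dh) (le_trans _ hC)// ltW// nrm_gt0.
  exact: ler_wpM2l.
by have := nrm_quot x ih (iu n.+1); rewrite -/(u n.+1); lra.
Qed.

(** Follow a code of [y] until its cylinder lies in [V], then connect its last letter to one whose
    arc contains [x]. The inverse branch of the whole word carries [x] into [V]. *)
Lemma dense_orbit x (V : set (circle R)) y : open V -> V y ->
  exists2 g, G0 g & V (act g x).
Proof.
move=> oV; have := oV; rewrite openE => /[apply] /interior_csq[r r0 HV].
have [n Hn] := small_cylinders r0; have [s sy] := code_of y.
have [p1 p2 p3 p4] := code_path n sy.1.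
have : (\bigcup_a I a) x by rewrite (bs_cover hB).
move=> [a _ ax]; have [w pw lw] := letters_connected hF hB (s n) a.
set t := mkseq (fun i => s i.+1) n in p1 p2 p3 p4.
have pt : path trb (s 0%N) (t ++ w) by rewrite cat_path p1 p2.
set u := winv e (belast (s 0%N) (t ++ w)).
have iu : isu u by exact: (winv_isu hF hB).
exists (sinv u); first by apply: (fuchs_sinv hF); exact: (winv_G0 hF hB).
apply: HV; apply: (Hn _ _ p1); first by rewrite size_mkseq.
  by rewrite p4; exact: coded_closure.
have : closure (icyl (s 0%N :: t ++ w)) (act (sinv u) x).
  by rewrite (icyl_closure hF hB pt) /= actKV// last_cat p2 lw.
by rewrite -cat_cons; apply: closureS; exact: icyl_cat.
Qed.
End Distortion.

(** * Fixed points on the circle *)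

Section FixedPoints.
Variable R : realType.
Implicit Types (x y z : circle R) (g h : smap R).

Lemma quadratic_three_roots (K : fieldType) (A B C x y z : K) :
  x != y -> x != z -> y != z ->
  A * x ^+ 2 + B * x + C = 0 -> A * y ^+ 2 + B * y + C = 0 ->
  A * z ^+ 2 + B * z + C = 0 -> A = 0 /\ B = 0.
Proof.
move=> xy xz yz hx hy hz.
have D u v : u != v -> A * u ^+ 2 + B * u + C = 0 -> A * v ^+ 2 + B * v + C = 0 ->
    A * (u + v) + B = 0.
  rewrite -subr_eq0 => uv hu hv; apply: (mulfI uv); rewrite mulr0.
  transitivity ((A * u ^+ 2 + B * u + C) - (A * v ^+ 2 + B * v + C)); first by ring.
  by rewrite hu hv subrr.
have A0 : A = 0.
  have := yz; rewrite -subr_eq0 => yz'; apply: (mulfI yz'); rewrite mulr0.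
  transitivity ((A * (x + y) + B) - (A * (x + z) + B)); first by ring.
  by rewrite !D// subrr.
by split => //; have := D _ _ xy hx hy; rewrite A0 mul0r add0r.
Qed.

(** Fixed points are roots of a quadratic polynomial; if it vanishes, [b] is 0 and [a] is real, so
    the matrix is scalar. *)
Lemma three_fixed_points g x y z : isu g -> x != y -> x != z -> y != z ->
  act g x = x -> act g y = y -> act g z = z -> g = id.
Proof.
move=> [a [b r]] xy xz yz gx gy gz.
have E w : act g w = w -> b^* * set_val w ^+ 2 + (a^* - a) * set_val w + - b = 0.
  move=> gw; have [+ _] := rep_act w r; rewrite gw.
  have den : b^* * set_val w + a^* != 0 by apply: (rep_den_neq0 r); rewrite sq_circle.
  move=> /(congr1 (fun t => t * (b^* * set_val w + a^*))); rewrite divfK// => h.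
  transitivity (set_val w * (b^* * set_val w + a^*) - (a * set_val w + b)); first by ring.
  by rewrite h subrr.
have ne (u v : circle R) : u != v -> set_val u != set_val v :> Cplx R.
  by move=> uv; apply/negP => /eqP h; move: uv; rewrite (circle_ext h) eqxx.
have [b0 a0] := quadratic_three_roots (ne _ _ xy) (ne _ _ xz) (ne _ _ yz) (E _ gx) (E _ gy) (E _ gz).
have {}b0 : b = 0 by rewrite -[b]conjCK b0 rmorph0.
have ar : a^* = a by apply/eqP; rewrite -subr_eq0 a0.
case: r => ab ->; have a1 : a != 0.
  by rewrite -sq_gt0; move: ab; rewrite b0 sq0; lra.
have -> : su a b = a *: su 1 0.
  apply/matrixP => i j; rewrite !mxE b0 ar rmorph0 rmorph1.
  by case: ifP => _; case: ifP => _; rewrite ?mulr0 ?mulr1.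
by rewrite moebius_scale//; case: (rep_id R) => _ <-.
Qed.

Lemma fixed_points_finite g : isu g -> g <> id -> finite_set [set x | act g x = x].
Proof.
move=> ig gid; have [[x hx]|no] := EM (exists x, act g x = x); last first.
  by apply: (@sub_finite_set _ _ set0) => // x hx; exfalso; apply: no; exists x.
have [[y [hy xy]]|no] := EM (exists y, act g y = y /\ x != y); last first.
  apply: (@sub_finite_set _ _ [set x]); last exact: finite_set1.
  by move=> y hy; apply/eqP/negPn/negP => yx; apply: no; exists y; rewrite eq_sym.
apply: (@sub_finite_set _ _ [set x; y]); last exact: finite_set2.
move=> z hz; apply: contrapT => /= nz; apply: gid.
apply: (three_fixed_points ig xy _ _ hx hy hz).
  by apply/negP => /eqP xz; apply: nz; left.
by apply/negP => /eqP yz; apply: nz; right.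
Qed.
End FixedPoints.

(** * Loops in the normal subgroup *)

Section Loops.
Variables (R : realType) (G0 G : set (smap R)) (S0 : finType).
Variables (I : S0 -> set (circle R)) (e : S0 -> smap R) (f : circle R -> circle R).
Hypothesis hF : fuchsian G0.
Hypothesis hN : normal_subgroup G G0.
Hypothesis hB : bowen_series G0 I e f.
Variable g1 : smap R.
Hypotheses (Gg1 : G g1) (g1id : g1 <> id).
Implicit Types (a b c : S0) (w v : seq S0) (x y z : circle R) (g h : smap R).
Local Notation trb := (trb I e).
Local Notation icyl := (icyl I e).

Lemma normal_sub g : G g -> G0 g. Proof. by case: hN => _ + _; exact. Qed.
Lemma normal_comp g h : G g -> G h -> G (g \o h).
Proof. by case: hN => -[_ + _] _ _; exact. Qed.
Lemma normal_sinv g : G g -> G (sinv g).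
Proof. by case: hN => -[_ _ +] _ _; exact. Qed.
Lemma normal_conj g h : G0 h -> G g -> G (sinv h \o g \o h).
Proof.
move=> G0h Gg; have ih := fuchs_isu hF G0h; have [ih' h1 h2] := isu_sinv ih.
case: hN => _ _ /(_ _ _ (fuchs_sinv hF G0h) Gg).
by rewrite (sinv_uniq h2 h1).
Qed.
Lemma normal_isu g : G g -> isu g.
Proof. by move=> /normal_sub; exact: fuchs_isu. Qed.

(** The orbit of [x] leaves the finite fixed point set of [g1]; conjugating [g1] back gives an
    element of [G] that moves [x]. *)
Lemma circle_moved x : exists2 g, G g & act g x != x.
Proof.
have i1 := normal_isu Gg1.
have fin := fixed_points_finite i1 g1id.
have cl : closed [set y | act g1 y = y].
  by apply: compact_closed; [exact: circle_hausdorff|exact: finite_compact].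
have [y _ ny] : exists2 y, [set: circle R] y & ~ [set y | act g1 y = y] y.
  by apply: (@open_infinite _ setT (circle1 R)) => //; rewrite interiorT.
have [h G0h hx] := dense_orbit hF hB x (closed_openC cl) ny.
have ih := fuchs_isu hF G0h; have [ih' _ _] := isu_sinv ih.
exists (sinv h \o g1 \o h); first exact: normal_conj.
apply/negP => /eqP; rewrite act_comp//; last exact: isu_comp.
rewrite act_comp// => /(congr1 (act h)); rewrite actKV//.
Qed.

(** Compactness: counterexamples for every [n] would accumulate at some [p], while an element that
    moves [p] moves all nearby points by a definite amount. A single integer controls both norm and
    displacement. *)
Lemma uniform_move : exists n : nat, forall x, exists g,
  [/\ G g, nrm g <= n%:R & n.+1%:R^-1 <= csq (act g x) x].
Proof.
apply: contrapT => no.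
have H n : exists x, forall g, G g -> nrm g <= n%:R -> csq (act g x) x < n.+1%:R^-1.
  apply: contrapT => no2; apply: no; exists n => x; apply: contrapT => no3; apply: no2.
  exists x => g Gg gn; rewrite ltNge; apply/negP => le; apply: no3; by exists g.
have [u Hu] := choice H; have [p cp] := circle_cluster u.
have [g Gg gp] := circle_moved p; have ig := normal_isu Gg.
have N0 := nrm_gt0 ig; have d0 := csq_gt0 gp; set d := csq _ _ in d0.
pose n := maxn (Num.truncn (nrm g)).+1 (Num.truncn (8 / d)).+1.
(* Two uses of [csq_tri] give d <= (32 nrm^2 + 4) csq p (u m) + 4 q. The radius [r] keeps the first
   term below d/2, and 8 q < d the second. *)
pose r := d / (2 * (32 * nrm g ^+ 2 + 4)).
have m0 : 0 < 2 * (32 * nrm g ^+ 2 + 4) by have := sqr_ge0 (nrm g); lra.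
have r0 : 0 < r by rewrite divr_gt0.
have [m nm pm] := cp r r0 n.
have gm : nrm g <= m%:R.
  apply: ltW (lt_le_trans (truncnS_gt _) _); rewrite ler_nat (leq_trans _ nm)//.
  exact: leq_maxl.
have dm : 8 / d <= m.+1%:R.
  apply: ltW (lt_le_trans (truncnS_gt _) _); rewrite ler_nat (leq_trans _ (leqW nm))//.
  exact: leq_maxr.
have := Hu m g Gg gm; set q := csq _ _ => hq.
have q8 : 8 * q < d.
  have M0 : 0 < m.+1%:R :> R by rewrite ltr0n.
  move: hq; rewrite -[_^-1]div1r ltr_pdivlMr// => hq.
  move: dm; rewrite ler_pdivrMr// => dm.
  have := csq_ge0 (act g (u m)) (u m); rewrite -/q; nra.
have t1 := csq_tri (act g p) (act g (u m)) p.
have t2 := csq_tri (act g (u m)) (u m) p.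
have t3 : csq (act g p) (act g (u m)) <= 16 * nrm g ^+ 2 * csq p (u m).
  rewrite csq_act// ler_wpM2r ?csq_ge0//.
  have := der_le p ig; have := der_le (u m) ig.
  have := der_gt0 p ig; have := der_gt0 (u m) ig; nra.
move: pm; rewrite /r ltr_pdivlMr// => pm.
rewrite -/d -/q (csqC (u m)) in t1 t2; lra.
Qed.

(** A prefix map [u] of a code of [x] blows up a neighbourhood of [x]. Let [z] be a point of strong
    expansion of u^-1 and let [g] in [G] move it to [y] at a definite distance. At u^-1(y), the
    conjugate u^-1 g^-1 u expands under [u], changes little under g^-1, and expands again under u^-1
    at [z]: in total by about nrm(u)^2, which is also the order of its norm. Contraction of u^-1 at
    [y] puts u^-1(y) near [x]. *)
Lemma limit_points : exists2 C : R, 0 < C & forall x (d L : R), 0 < d -> exists g y,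
  [/\ G g, csq x y < d, L < nrm g & nrm g <= C * der g y].
Proof.
have [n Hn] := uniform_move; have [K K1 HK] := code_der hF hB.
pose c : R := n.+1%:R^-1; have c0 : 0 < c by rewrite invr_gt0 ltr0n.
pose m : R := n.+1%:R; have m1 : 1 <= m by rewrite ler1n.
have m0 : 0 < m by rewrite ltr0n.
exists (16 * m * (16 * m) / c); first by rewrite divr_gt0// !mulr_gt0.
move=> x d L d0; have [s sx] := code_of hF hB x.
(* The terms of [T] make [nrm u] large enough for, in turn, the closeness of [z] to the centre of
   u^-1, the bound [L], and the distance [d]. *)
pose T : R := Num.max 1 (4 / c) + 64 * m / c * `|L| + 16 * K / c / d.
have [k Hk] := long_prefix hF hB T.
have [p1 _ p3 _] := code_path k sx.1.
have := Hk _ _ p1; rewrite size_mkseq p3 => /(_ (leqnn _)).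
set u := winv e _ => Tu.
have G0u : G0 u by exact: (winv_G0 hF hB).
have iu := fuchs_isu hF G0u; have [iu' h1 h2] := isu_sinv iu.
have hK : nrm u <= K * der u x by exact: (HK s x k sx).
have N0 := nrm_gt0 iu.
have [z hz] := der_max iu'; rewrite nrm_sinv// in hz.
have [g [Gg gn gz]] := Hn z; set y := act g z in gz.
have ig := normal_isu Gg; have [ig' _ _] := isu_sinv ig.
have L0 := normr_ge0 L; have LL := ler_norm L.
have [T1 T2 T3 T4] : [/\ 1 < nrm u, 4 < c * nrm u, 64 * m * `|L| < c * nrm u
    & 16 * K < d * (c * nrm u)].
  have a1 : 1 <= Num.max 1 (4 / c) by rewrite le_max lexx.
  have a2 : 4 / c <= Num.max 1 (4 / c) by rewrite le_max lexx orbT.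
  have a3 : 0 <= 64 * m / c * `|L| by rewrite mulr_ge0// divr_ge0// ?(ltW c0)//; lra.
  have a4 : 0 < 16 * K / c / d by rewrite !divr_gt0//; lra.
  move: Tu; rewrite /T => Tu; split; first lra.
  - suff : 4 / c < nrm u by rewrite ltr_pdivrMr// [nrm u * c]mulrC.
    lra.
  - suff : 64 * m * `|L| / c < nrm u by rewrite ltr_pdivrMr// [nrm u * c]mulrC.
    by rewrite mulrAC; lra.
  - suff : 16 * K / c / d < nrm u.
      by rewrite !ltr_pdivrMr//; congr (_ < _); ring.
    lra.
have dz0 := der_gt0 z iu'; have dy0 := der_gt0 y iu'.
have ez := der_ctr z iu'; have ey := der_ctr y iu'.
rewrite nrm_sinv// in ez ey.
have sz : sq (set_val z - ctr (sinv u)) <= c / 4.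
  have := sq_ge0 (set_val z - ctr (sinv u)) => s0.
  suff : nrm u * (nrm u * sq (set_val z - ctr (sinv u))) <= 1 by nra.
  by rewrite -ez ler_wpM2r// mulr_ge0// ltW.
have sy : c / 4 <= sq (set_val y - ctr (sinv u)).
  have := sq_dist_le (set_val y) (set_val z) (ctr (sinv u)).
  have := sq_dist_le (set_val y) (set_val z) (set_val z).
  have := sq_dist_le (set_val y) (set_val z) (ctr (sinv u)).
  have := sq_dist_le (set_val y) (ctr (sinv u)) (set_val z).
  rewrite -/(csq y z) [sq (ctr _ - _)]sqBC; move: gz; rewrite -/c; lra.
have dy : der (sinv u) y * (c * nrm u) <= 4.
  have := ler_wpM2l (ltW (mulr_gt0 dy0 N0)) sy.
  by rewrite -[X in _ <= X]mulrA ey; lra.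
pose y' := act (sinv u) y; pose k' := sinv u \o sinv g \o u.
have duy : der u y' * der (sinv u) y = 1.
  have := der_sinv y' iu; rewrite /y' actKV// => ->.
  by rewrite mulfV// gt_eqF// der_gt0.
have i2 : isu (sinv u \o sinv g) by exact: isu_comp.
have dk : der k' y' = der (sinv u) z * der (sinv g) y * der u y'.
  by rewrite /k' der_comp// /y' actKV// der_comp// /y actK.
have dg : 1 <= 4 * m * der (sinv g) y.
  have := der_ge y ig'; rewrite nrm_sinv// -[_^-1]div1r ler_pdivrMr ?mulr_gt0 ?nrm_gt0//.
  have gm : nrm g <= m by apply: le_trans gn _; rewrite ler_nat.
  have := der_gt0 y ig'; nra.
have duy0 := der_gt0 y' iu.
have du' : c * nrm u <= 4 * der u y'.
  have := ler_wpM2l (ltW duy0) dy; rewrite [X in X <= _]mulrA duy; lra.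
have dk' : c * nrm u ^+ 2 <= 16 * m * der k' y'.
  rewrite dk; have s1 : nrm u <= der (sinv u) z * (4 * m * der (sinv g) y).
    by apply: (le_trans hz); rewrite ler_peMr// ltW.
  have := ler_pM (ltW N0) (ltW (mulr_gt0 c0 N0)) s1 du'.
  by rewrite expr2; lra.
have ik' : isu k' by exact: isu_comp.
have nk : nrm k' <= 16 * m * nrm u ^+ 2.
  have gm : nrm g <= m by apply: le_trans gn _; rewrite ler_nat.
  apply: le_trans (nrm_comp i2 iu) _; have := nrm_comp iu' ig'; rewrite !nrm_sinv// => n1.
  have n2 : nrm (sinv u \o sinv g) <= 4 * nrm u * m.
    by apply: le_trans n1 _; rewrite ler_wpM2l// mulr_ge0// ltW.
  by have := ler_wpM2r (ltW N0) n2; rewrite expr2; lra.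
exists k', y'; split.
- by apply: normal_conj => //; exact: normal_sinv.
- have -> : csq x y' = der (sinv u) (act u x) * der (sinv u) y * csq (act u x) y.
    by rewrite -csq_act// actK.
  rewrite der_sinv//; have dx0 := der_gt0 x iu; have h4 := csq_le4 (act u x) y.
  have h5 := csq_ge0 (act u x) y.
  have cN : 0 < c * nrm u by rewrite mulr_gt0.
  have b1 : (der u x)^-1 <= K.
    rewrite -[_^-1]div1r ler_pdivrMr//; lra.
  have b2 : der (sinv u) y * csq (act u x) y * (c * nrm u) <= 16.
    by have := ler_pM (ltW (mulr_gt0 dy0 cN)) h5 dy h4; lra.
  have b3 : 0 <= der (sinv u) y * csq (act u x) y * (c * nrm u).
    by rewrite !mulr_ge0// ltW.
  rewrite -(ltr_pM2r cN); apply: le_lt_trans T4.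
  rewrite -!mulrA [16 * K]mulrC; apply: ler_pM => //; first by rewrite invr_ge0 ltW.
    by rewrite mulrA.
  by rewrite mulrA.
- have := der_le y' ik' => le4.
  have : c * nrm u <= c * nrm u ^+ 2.
    by rewrite ler_pM2l// expr2 ler_peMl//; lra.
  nra.
- rewrite mulrAC ler_pdivlMr//; have := ler_wpM2l (ltW c0) nk.
  have m16 : 0 <= 16 * m by lra.
  have := ler_wpM2l m16 dk'; rewrite !expr2; lra.
Qed.

(** Take [y] in the open cylinder of the word and [g] in [G] that expands at [y] more than shorter
    words can. The prefix of a code of [y] that shadows [g] is then at least as long as the word,
    and begins with it because [y] is interior to the cylinder. *)
Lemma word_extension : exists M : R, forall a w, path trb a w -> exists w' g,
  [/\ path trb a (w ++ w'), G g & nrm (g \o sinv (winv e (a :: w ++ w'))) <= M].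
Proof.
have [C C0 HC] := limit_points; have [M HM] := shadowing hF hB C; exists M.
have [E E1 HE] := winv_nrm_le hF hB.
move=> a w pw; have [p pp] := icyl_neq0 hF hB pw.
have := icyl_open hF hB (a :: w); rewrite openE => /(_ p pp) /interior_csq[d d0 Hd].
(* This threshold puts [der g y] above 1, as shadowing requires, and above 4 E^(|w|+1), which bounds
   the derivative of every prefix shorter than [a :: w]. *)
have [g [y [Gg py Lg gy]]] := HC p d (C + 4 * C * E ^+ (size w).+1) d0.
have wy := Hd _ py; have ig := normal_isu Gg; have [s sy] := code_of hF hB y.
have E0 : 0 <= 4 * C * E ^+ (size w).+1.
  apply: mulr_ge0; first by apply: mulr_ge0 => //; exact: ltW.
  by apply: exprn_ge0; exact: le_trans E1.
have d1 : 1 < der g y.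
  have : C * 1 < C * der g y by rewrite mulr1; apply: lt_le_trans gy; lra.
  by rewrite ltr_pM2l.
have [n [dn nM]] := HM g y s ig sy gy d1.
have nw : ((size w).+1 <= n)%N.
  rewrite leqNgt; apply/negP => nw.
  have iu := winv_isu hF hB (mkseq s n).
  have h1 : nrm (winv e (mkseq s n)) <= E ^+ (size w).+1.
    apply: le_trans (HE _) _; rewrite size_mkseq ler_weXn2l// ltnW//.
  have h2 := le_trans dn (der_le y iu).
  have : C * der g y <= C * (4 * E ^+ (size w).+1).
    by rewrite ler_wpM2l ?(ltW C0)//; apply: le_trans h2 _; rewrite ler_wpM2l.
  lra.
case: n nw dn nM => [//|n] nw dn nM.
have [p1 p2 p3 p4] := code_path n sy.1.
have cy := coded_closure hF hB n sy.
have [z [nz wz]] := cy _ (open_nbhs_nbhs (conj (icyl_open hF hB (a :: w)) wy)).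
have := icyl_prefix hB wz nz; rewrite size_mkseq => /(_ nw) ew.
have ew2 : mkseq s n.+1 = a :: w ++ drop (size w).+1 (mkseq s n.+1).
  by rewrite -cat_cons ew cat_take_drop.
exists (drop (size w).+1 (mkseq s n.+1)), g; split => //; last by rewrite -ew2.
by move: p1; move: p4; rewrite {1}ew2 => -[-> ->].
Qed.

Lemma sinv_comp g h : isu g -> isu h -> sinv (g \o h) = sinv h \o sinv g.
Proof.
move=> /isu_sinv[_ g1' g2'] /isu_sinv[_ h1' h2']; apply: sinv_uniq.
  by rewrite compA -(compA g) h1' -[X in X \o _]/g.
by rewrite compA -(compA (sinv h)) g2' -[X in X \o _]/(sinv h).
Qed.
Lemma sinvK g : isu g -> sinv (sinv g) = g.
Proof. by move=> /isu_sinv[_ g1' g2']; exact: sinv_uniq. Qed.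

Lemma pigeonhole (T : Type) (A : set T) (k : nat -> T) : finite_set A ->
  (forall n, A (k n)) -> exists i j, (i < j)%N /\ k i = k j.
Proof.
move=> fA kA; apply: contrapT => no.
have inj : {in [set: nat] &, injective k}.
  move=> i j _ _ kij; apply/eqP; rewrite eqn_leq; apply/andP; split; rewrite leqNgt.
    by apply/negP => h; apply: no; exists j, i.
  by apply/negP => h; apply: no; exists i, j.
have : finite_set (k @` [set: nat]) by apply: sub_finite_set fA => _ [n _ <-].
rewrite (eq_finite_set (inj_card_eq inj)); exact: infinite_nat.
Qed.

(** Build nested cyclic words at [b], each continuing the previous one by [b :: t] and within
    bounded distance of [G]. By finiteness two of them have equal offsets from [G]. The word between
    them is then conjugate to an element of [G], hence in [G], and it begins with [b :: t]. *)
Lemma loop_exists b t : path trb b t -> exists s,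
  [/\ path trb b (t ++ s), trb (last b (t ++ s)) b & G (winv e (b :: t ++ s))].
Proof.
move=> pt; have [M HM] := word_extension.
have [W HW] : {W : S0 -> seq S0 & forall d, path trb d (W d) /\ last d (W d) = b}.
  apply: (@choice _ _ (fun d w => path trb d w /\ last d w = b)) => d.
  by have [w pw lw] := letters_connected hF hB d b; exists w.
have [E E1 HE] := finite_upper_bound (fun d => nrm (winv e (belast d (W d)))).
(* Cyclic words starting at [b] may be followed by [b :: t] again; the empty word starts the
   iteration. *)
pose ok Y := (Y = [::] \/ exists Y', Y = b :: Y') /\ cycle trb Y.
pose near_G Y := exists2 g, G g & nrm (g \o sinv (winv e Y)) <= 4 * M * E.
have step (Y : {Y | ok Y}) : {Y2 : {Y | ok Y} |
    (exists Z, sval Y2 = sval Y ++ b :: t ++ Z) /\ near_G (sval Y2)}.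
  case: Y => Y [hY cY]; apply: cid.
  have [w0 [ew0 pw0]] : exists w0, Y ++ b :: t = b :: w0 /\ path trb b w0.
    case: hY => [->|[Y' eY]]; first by exists t.
    exists (Y' ++ b :: t); rewrite eY; split => //.
    by move: cY; rewrite eY /= rcons_path cat_path /= pt andbT => /andP[-> ->].
  have [w' [g [pw' Gg hM]]] := HM b w0 pw0.
  set c := last b (w0 ++ w').
  have [y /interior_subset/(next_letter hF hB)[d [tcd _]]] := I_int_neq0 hB c.
  have [pd ld] := HW d.
  have eY2 : Y ++ b :: t ++ (w' ++ belast d (W d)) = b :: (w0 ++ w') ++ belast d (W d).
    transitivity ((Y ++ b :: t) ++ (w' ++ belast d (W d))); first by rewrite -catA.
    by rewrite ew0 /= catA.
  have oY2 : ok (Y ++ b :: t ++ (w' ++ belast d (W d))).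
    rewrite eY2; split; first by right; eexists.
    rewrite /= rcons_cat -{2}ld -lastI cat_path pw' /= pd andbT; exact/trbP.
  exists (exist _ _ oY2); split; first by exists (w' ++ belast d (W d)).
  exists g => //=; rewrite eY2 -cat_cons (winv_cat e).
  have iA := winv_isu hF hB (belast d (W d)); have iB := winv_isu hF hB (b :: w0 ++ w').
  have [iA' _ _] := isu_sinv iA; have [iB' _ _] := isu_sinv iB; have ig := normal_isu Gg.
  rewrite sinv_comp// compA; have iC := isu_comp ig iB'.
  apply: le_trans (nrm_comp iC iA') _; rewrite nrm_sinv//.
  by apply: ler_pM => //; rewrite ?mulr_ge0 ?(ltW (nrm_gt0 _))// ler_wpM2l.
have ok0 : ok [::] by split => //; left.
pose q n := iter n (fun Y => sval (step Y)) (exist _ [::] ok0).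
have qS n : (exists Z, sval (q n.+1) = sval (q n) ++ b :: t ++ Z) /\ near_G (sval (q n.+1)).
  exact: (svalP (step (q n))).
have [k Hk] : {k : nat -> smap R & forall n, G (k n) /\
    nrm (k n \o sinv (winv e (sval (q n.+1)))) <= 4 * M * E}.
  apply: (@choice _ _ (fun n k => G k /\ nrm (k \o sinv (winv e (sval (q n.+1)))) <= 4 * M * E)) => n.
  by have [_ [g Gg hg]] := qS n; exists g.
pose kk n := k n \o sinv (winv e (sval (q n.+1))).
have [i [j [ij ekk]]] : exists i j, (i < j)%N /\ kk i = kk j.
  apply: (pigeonhole (nrm_finite hF (4 * M * E))) => n; have [Gk hk] := Hk n; split => //.
  apply: (fuchs_comp hF); first exact: normal_sub.
  by apply: (fuchs_sinv hF); exact: (winv_G0 hF hB).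
have pre n m : (n < m)%N -> exists Z, sval (q m) = sval (q n) ++ b :: t ++ Z.
  elim: m => // m IH; rewrite ltnS leq_eqVlt => /predU1P[->|/IH[Z eZ]]; first by case: (qS m).
  have [[Z2 eZ2] _] := qS m; exists (Z ++ b :: t ++ Z2).
  by rewrite eZ2 eZ -catA -[(b :: t ++ Z) ++ _]/(b :: (t ++ Z) ++ _) -catA.
have [Z eZ] := pre i.+1 j.+1 ij.
have [Y' eY'] : exists Y', sval (q i.+1) = b :: Y'.
  case: (svalP (q i.+1)) => -[e0|//] _.
  by have [[Z' eZ'] _] := qS i; move: e0; rewrite eZ'; case: (sval (q i)).
exists Z.
have : cycle trb (sval (q j.+1)) by case: (svalP (q j.+1)).
rewrite eZ eY' /= rcons_cat cat_path rcons_cons /= rcons_path.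
move=> /andP[_ /andP[_ /andP[h1 h2]]]; split => //.
set A := winv e (sval (q i.+1)); set s := winv e (b :: t ++ Z).
have ij1 : winv e (sval (q j.+1)) = s \o A by rewrite eZ (winv_cat e).
have iA : isu A by exact: (winv_isu hF hB). have is_ : isu s by exact: (winv_isu hF hB).
have [iA' A1 A2] := isu_sinv iA; have [is' s1 s2] := isu_sinv is_.
have [Gi _] := Hk i; have [Gj _] := Hk j.
have [_ j1 j2] := isu_sinv (normal_isu Gj).
(* Solves k_i A^-1 = k_j (s A)^-1 for s^-1. *)
have es : sinv s = A \o (sinv (k j) \o k i) \o sinv A.
  have : kk i = kk j by [].
  rewrite /kk ij1 sinv_comp// -/A => E2.
  rewrite -[RHS]compA -[X in A \o X]compA E2 [X in A \o (X)]compA j2.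
  by rewrite -[X in A \o X]/(sinv A \o sinv s) compA A1.
have GA : G (A \o (sinv (k j) \o k i) \o sinv A).
  rewrite -{1}(sinvK iA); apply: normal_conj; last exact: normal_comp (normal_sinv Gj) Gi.
  by apply: (fuchs_sinv hF); exact: (winv_G0 hF hB).
by rewrite -(sinvK is_); apply: normal_sinv; rewrite es.
Qed.

Definition loop b r := [/\ path trb b r, trb (last b r) b & G (winv e (b :: r))].

(** Every point is missed by at least one of two disjoint closed cylinders, so one of the loops will
    displace it. The loops follow codes of two interior points until the cylinders have squared
    diameter below a quarter of the squared distance of these points. *)
Lemma two_loops b : exists r1 r2, [/\ loop b r1, loop b r2 &
  forall x, closure (icyl (b :: r1)) x -> closure (icyl (b :: r2)) x -> False].
Proof.
have [p bp] := I_int_neq0 hB b.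
have := bp; rewrite -{1}((interior_id _).1 (open_interior (I b))).
move=> /(open_infinite (finite_set1 p))[q bq pq].
have d0 : 0 < csq p q by apply: csq_gt0; apply/negP => /eqP e0; apply: pq; rewrite e0.
have [n Hn] := small_cylinders hF hB (divr_gt0 d0 (ltr0n _ 4)).
have L x : I b x -> exists2 r, loop b r & forall y, closure (icyl (b :: r)) y -> csq x y < csq p q / 4.
  move=> /(code_exists hF hB)[s sx s0]; have [p1 p2 p3 p4] := code_path n sx.1.
  rewrite s0 in p1 p2 p3 p4; have [t [h1 h2 h3]] := loop_exists p1.
  eexists; first by split; [exact: h1|exact: h2|exact: h3].
  move=> y; rewrite -cat_cons => /(closureS (@icyl_cat _ _ I e _ _)) cy.
  apply: (Hn _ _ p1) => //; first by rewrite size_mkseq.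
  by rewrite p4; exact: (coded_closure hF hB n sx).
have [r1 l1 H1] := L p (interior_subset bp); have [r2 l2 H2] := L q (interior_subset bq).
exists r1, r2; split => // x /H1 h1 /H2; have := csq_tri p x q; rewrite (csqC x q); lra.
Qed.
End Loops.

(** * Cosets *)

Section Cosets.
Variables (R : realType) (G0 G : set (smap R)).
Hypothesis hF : fuchsian G0.
Implicit Types (g h : smap R) (H : set (smap R)).

Lemma lcoset_comp g h H : lcoset (g \o h) H = lcoset g (lcoset h H).
Proof.
apply/seteqP; split => k /=; first by move=> [l Hl <-]; exists (h \o l) => //; exists l.
by move=> [_ [l Hl <-] <-]; exists l.
Qed.
Lemma lcoset_id H : lcoset id H = H.
Proof. by apply/seteqP; split => k /=; [move=> [l Hl <-]|move=> Hk; exists k]. Qed.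
Lemma lcosetK g H : isu g -> lcoset (sinv g) (lcoset g H) = H.
Proof. by move=> /isu_sinv[_ _ gg]; rewrite -lcoset_comp gg lcoset_id. Qed.
Lemma lcosetKV g H : isu g -> lcoset g (lcoset (sinv g) H) = H.
Proof. by move=> /isu_sinv[_ gg _]; rewrite -lcoset_comp gg lcoset_id. Qed.
Lemma quotient_lcoset g H : G0 g -> quotient_group G0 G H -> quotient_group G0 G (lcoset g H).
Proof.
by move=> Gg [h Gh <-]; exists (g \o h); [exact: (fuchs_comp hF)|rewrite lcoset_comp].
Qed.
End Cosets.

(** * Topology and shift structure of the coding space *)

Section CodingSpace.
Variables (R : realType) (G0 G : set (smap R)) (S0 : finType).
Variables (I : S0 -> set (circle R)) (e : S0 -> smap R) (f : circle R -> circle R).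
Hypothesis hF : fuchsian G0.
Hypothesis hB : bowen_series G0 I e f.
Implicit Types (a b c : S0) (w v : seq S0) (g h : smap R) (H : set (smap R)).
Local Notation trb := (trb I e).
Local Notation icyl := (icyl I e).
Local Notation X := (Xspace G0 G I e f).
Implicit Types (x y z : X) (U : set X).

Definition lt_ x i : S0 := (set_val x i).1.
Definition gp x : set (smap R) := (set_val x 0%N).2.
Definition cd x : circle R := codepoint x.

Lemma X_ext x y : (forall i, set_val x i = set_val y i) -> x = y.
Proof. by move=> h; apply: val_inj; apply: funext. Qed.

Lemma X_tr x i : trb (lt_ x i) (lt_ x i.+1).
Proof.
by apply/trbP; have [h _ _] := set_valP x; apply/(tr_sigma hF hB); exact: h.
Qed.

Lemma X_gp x : quotient_group G0 G (gp x).
Proof. by have [_ h _] := set_valP x; exact: h. Qed.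

Lemma X_coord x i : set_val x i = (lt_ x i, lcoset (winv e (mkseq (lt_ x) i)) (gp x)).
Proof.
rewrite [LHS]surjective_pairing; congr pair.
elim: i => [|i IH]; first by rewrite lcoset_id.
have [_ _ ->] := set_valP x.
by rewrite IH mkseqS (winv_rcons e) lcoset_comp.
Qed.

(** Nested cylinders along the letters are nonempty, so by compactness their closures share a point
    and the [get] in [piSigma] is not a default value. *)
Lemma cd_coded x : coded I e (lt_ x) (cd x).
Proof.
have tr := X_tr x; set s := lt_ x in tr *.
have cylE n : closure ((cyl I f (mkseq s n.+1))°) = closure (icyl (mkseq s n.+1)).
  by have [p1 p2 p3 p4] := code_path n tr; rewrite -p4 (cyl_int hF hB p1).
have ex : exists p, forall n, closure ((cyl I f (mkseq s n.+1))°) p.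
  have H n : exists p, icyl (mkseq s n.+1) p.
    have [p1 p2 p3 p4] := code_path n tr; rewrite -p4.
    by have [p] := icyl_neq0 hF hB p1; exists p.
  have [u Hu] := choice H; have [p cp] := circle_cluster u; exists p => n.
  rewrite cylE; apply/closure_csq => r r0; have [m nm pm] := cp r r0 n.
  exists (u m) => //; have := Hu m.
  by rewrite /mkseq -(subnKC nm) -addSn iotaD map_cat => /icyl_cat.
split => // n; have := getPex ex; rewrite -/(cd x) => /(_ n); rewrite cylE.
have [p1 p2 p3 p4] := code_path n tr; rewrite -p4 (icyl_closure hF hB p1) p2 p3.
exact.
Qed.

Lemma coded_uniq (s : nat -> S0) p q : coded I e s p -> coded I e s q -> p = q.
Proof.
move=> sp sq_; apply/eqP/negPn/negP => /csq_gt0 d0.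
have [n Hn] := small_cylinders hF hB d0; have [p1 p2 p3 p4] := code_path n sp.1.
have := Hn _ _ p1; rewrite size_mkseq p4 => /(_ (leqnn n) p q).
by rewrite ltxx => /(_ (coded_closure hF hB n sp) (coded_closure hF hB n sq_)).
Qed.

Lemma cd_uniq x p : coded I e (lt_ x) p -> cd x = p.
Proof. by move=> h; apply: coded_uniq h; exact: cd_coded. Qed.

Lemma nbhs_coord x i : nbhs x [set y | set_val y i = set_val x i].
Proof.
rewrite nbhsE; exists [set y | set_val y i = set_val x i] => //; split => //.
pose W := @proj nat (fun=> discrete_topology (S0 * set (smap R))%type) i @^-1` [set set_val x i].
exists W => //; apply: open_comp; first by move=> t _; exact: proj_continuous.
exact: discrete_open.
Qed.

Lemma nbhs_agree x n : nbhs x [set y | forall i, (i < n)%N -> set_val y i = set_val x i].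
Proof.
elim: n => [|n IH]; first by apply: filterS filterT => y _ i; rewrite ltn0.
apply: filterS (filterI IH (nbhs_coord x n)) => y [h1 h2] i.
by rewrite ltnS leq_eqVlt => /predU1P[->|/h1].
Qed.

Lemma nbhs_basis x U : nbhs x U ->
  exists n, forall y, (forall i, (i < n)%N -> set_val y i = set_val x i) -> U y.
Proof.
rewrite nbhsE => -[V [[W oW WV] Vx] VU].
pose p : seqs R S0 := set_val x.
pose B n : set (seqs R S0) := [set t | forall i, (i < n)%N -> t i = p i].
pose F := filter_from [set: nat] B.
have FF : Filter F.
  apply: filter_from_filter; first by exists 0%N.
  move=> i j _ _; exists (maxn i j) => // t h; split => k hk; apply: h.
    by rewrite (leq_trans hk)// leq_maxl.
  by rewrite (leq_trans hk)// leq_maxr.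
have : F --> (p : prod_topology _).
  apply/cvg_sup => i A; rewrite nbhsE => -[A' [[D oD DA'] A'p] A'A].
  exists i.+1 => // t h; apply: A'A; rewrite -DA' /=; move: A'p; rewrite -DA' /=.
  by rewrite /proj h.
move=> /(_ W) []; last first.
  by move=> n _ nW; exists n => y h; apply: VU; rewrite -WV; apply: nW.
by apply: open_nbhs_nbhs; split => //; rewrite -WV in Vx.
Qed.

Lemma agree_words x y n : gp x = gp y -> mkseq (lt_ x) n = mkseq (lt_ y) n ->
  forall i, (i < n)%N -> set_val x i = set_val y i.
Proof.
move=> gxy ls i ni; rewrite !X_coord gxy.
have e1 k : (k < n)%N -> lt_ x k = lt_ y k.
  by move=> kn; have := congr1 (fun s => nth (lt_ x 0%N) s k) ls; rewrite !nth_mkseq.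
congr (_, lcoset (winv e _) _); first exact: e1.
by apply/eq_in_map => k; rewrite mem_iota /= add0n => kn; apply: e1; exact: ltn_trans ni.
Qed.

Lemma open_finite n (P : set (smap R) -> seq S0 -> Prop) :
  open [set x | P (gp x) (mkseq (lt_ x) n)].
Proof.
rewrite openE => x /= Px; rewrite /interior; apply: filterS (nbhs_agree x n.+1) => y /= h.
have -> : gp y = gp x by rewrite /gp h.
have -> // : mkseq (lt_ y) n = mkseq (lt_ x) n.
by apply/eq_in_map => k; rewrite mem_iota /= add0n => kn; rewrite /lt_ h// ltnW.
Qed.

Lemma closed_finite n (P : set (smap R) -> seq S0 -> Prop) :
  closed [set x | P (gp x) (mkseq (lt_ x) n)].
Proof.
rewrite -[X in closed X]setCK; apply: open_closedC.
exact: (@open_finite n (fun H w => ~ P H w)).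
Qed.

Lemma cd_continuous : continuous cd.
Proof.
move=> x B /nbhs_csq[d d0 dB]; have [n Hn] := small_cylinders hF hB d0.
apply: filterS (nbhs_agree x n.+1) => y h; apply: dB.
have [p1 p2 p3 p4] := code_path n (X_tr x).
have -> := Hn _ _ p1; rewrite ?size_mkseq ?p4//; first exact: (coded_closure hF hB _ (cd_coded x)).
have <- : mkseq (lt_ y) n.+1 = mkseq (lt_ x) n.+1.
  by apply/eq_in_map => k; rewrite mem_iota /= add0n => kn; rewrite /lt_ h.
exact: (coded_closure hF hB _ (cd_coded y)).
Qed.

(** At time i only the cosets [winv e w] H with |w| = i occur, finitely many however large the
    quotient. The fibre thus lies in a product of finite sets, and it is closed there because each
    defining condition involves at most two consecutive coordinates. *)
Lemma fiber_compact H : compact [set x | gp x = H].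
Proof.
move=> F PF FH.
pose A i : set (discrete_topology (S0 * set (smap R))%type) :=
  [set q | exists w : i.-tuple S0, q.2 = lcoset (winv e w) H].
have cA i : compact (A i).
  apply: finite_compact; apply: (@sub_finite_set _ _ ([set: S0] `*`
      [set lcoset (winv e (tval w)) H | w in [set: i.-tuple S0]])).
    by move=> [a q] [w /= ->]; split => //; exists w.
  by apply: finite_setX; [exact: finite_finset|apply: finite_image; exact: finite_finset].
pose F' : set_system (seqs R S0) := fmap (fun x : X => set_val x) F.
have PF' : ProperFilter F' by exact: fmap_proper_filter.
have FA : F' [set t | forall i, A i (t i)].
  suff : F [set x : X | forall i, A i (set_val x i)] by [].
  apply: filterS FH => x gx i; rewrite X_coord [gp x]gx.
  by exists (@Tuple _ _ (mkseq (lt_ x) i) (introT eqP (size_mkseq _ _))).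
have [p [_ cp]] := tychonoff cA PF' FA.
have clp n : exists x, gp x = H /\ forall i, (i < n)%N -> set_val x i = p i.
  pose B : set (seqs R S0) := [set t | forall i, (i < n)%N -> t i = p i].
  have nB : nbhs (p : seqs R S0) B.
    rewrite /B; elim: n {B} => [|n IH].
      by apply: (@filterS _ (nbhs (p : seqs R S0)) (nbhs_filter _) setT); [move=> y _ i; rewrite ltn0|exact: filterT].
    have nc : nbhs (p : seqs R S0) [set t : seqs R S0 | t n = p n].
      pose W := @proj nat (fun=> discrete_topology (S0 * set (smap R))%type) n @^-1` [set p n].
      rewrite nbhsE; exists W => //; split => //.
      apply: open_comp; first by move=> t _; exact: proj_continuous.
      exact: discrete_open.
    have := @filterI _ (nbhs (p : seqs R S0)) (nbhs_filter _) _ _ IH nc.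
    apply: (@filterS _ (nbhs (p : seqs R S0)) (nbhs_filter _)) => y [h1 h2] i.
    by rewrite ltnS leq_eqVlt => /predU1P[->|/h1].
  have FI : F' (set_val @` [set x : X | gp x = H]).
    suff : F [set x : X | exists2 y : X, gp y = H & set_val y = set_val x] by [].
    by apply: filterS FH => x gx; exists x.
  by have [_ [[x gx <-] Bx]] := cp _ _ FI nB; exists x.
have pX : Xset G0 G I e f p.
  split.
  - move=> i; have [x [_ h]] := clp i.+2; have [hs _ _] := set_valP x.
    have : (I (set_val x i.+1).1)° `<=` (f @` I (set_val x i).1)° by exact: hs.
    by rewrite (h i.+1 _)// (h i _)//.
  - move=> i; have [x [_ h]] := clp i.+1; have [_ hs _] := set_valP x.
    have : quotient_group G0 G (set_val x i).2 by exact: hs.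
    by rewrite (h i _).
  - move=> i; have [x [_ h]] := clp i.+2; have [_ _ hs] := set_valP x.
    have : (set_val x i.+1).2 = lcoset (sinv (e (set_val x i).1)) (set_val x i).2 by exact: hs.
    by rewrite (h i.+1 _)// (h i _)//.
exists (SigSub (mem_set pX) : X); split.
  by have [x [gx h]] := clp 1%N; rewrite -gx /= /gp h.
move=> C D FC; rewrite nbhsE => -[V [[W oW WV] Vx] VD].
have FI : F' (set_val @` C).
  suff : F [set x : X | exists2 y : X, C y & set_val y = set_val x] by [].
  by apply: filterS FC => x Cx; exists x.
have nW : nbhs (p : seqs R S0) W.
  by apply: open_nbhs_nbhs; split => //; rewrite -WV in Vx.
have [_ [[x Cx <-] Wx]] := cp _ _ FI nW.
by exists x; split => //; apply: VD; rewrite -WV.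
Qed.

Definition prepend a (t : seqs R S0) : seqs R S0 :=
  fun i => if i is j.+1 then t j else (a, lcoset (e a) (t 0%N).2).

(** The preimage of [x] under the shift with first letter [a]. Where this transition is forbidden
    the value is [x], which keeps [ins a] total and continuous. *)
Definition ins a x : X :=
  if pselect (Xset G0 G I e f (prepend a (set_val x))) is left h then SigSub (mem_set h) else x.

Lemma ins_mem a x : trb a (lt_ x 0%N) -> Xset G0 G I e f (prepend a (set_val x)).
Proof.
move=> /trbP ta; have [h1 h2 h3] := set_valP x.
split => -[|i] /=; rewrite /letters //=.
- exact: (tr_int hF hB ta).
- exact: h1.
- by apply: (quotient_lcoset hF); [exact: (bs_in hB)|exact: h2].
- exact: h2.
- by rewrite lcosetK//; exact: (e_isu hF hB).
- exact: h3.
Qed.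

Lemma insE a x i : trb a (lt_ x 0%N) -> set_val (ins a x) i = prepend a (set_val x) i.
Proof. by move=> /ins_mem h; rewrite /ins; case: pselect. Qed.
Lemma ins_out a x : ~~ trb a (lt_ x 0%N) -> ins a x = x.
Proof.
move=> nt; rewrite /ins; case: pselect => // h; exfalso; have [h1 _ _] := h; move/negP: nt; apply.
by apply/trbP/(tr_sigma hF hB); exact: (h1 0%N).
Qed.
Lemma ins_lt0 a x : trb a (lt_ x 0%N) -> lt_ (ins a x) 0%N = a.
Proof. by move=> h; rewrite /lt_ insE. Qed.
Lemma ins_ltS a x i : trb a (lt_ x 0%N) -> lt_ (ins a x) i.+1 = lt_ x i.
Proof. by move=> h; rewrite /lt_ insE. Qed.
Lemma ins_gp a x : trb a (lt_ x 0%N) -> gp (ins a x) = lcoset (e a) (gp x).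
Proof. by move=> h; rewrite /gp insE. Qed.

Lemma mkseq_cons (s : nat -> S0) n : mkseq s n.+1 = s 0%N :: mkseq (fun i => s i.+1) n.
Proof. by rewrite /mkseq /= -add1n iotaDl -map_comp. Qed.

Lemma ins_cd a x : trb a (lt_ x 0%N) -> cd (ins a x) = act (e a) (cd x).
Proof.
move=> h; apply: cd_uniq; split; first exact: X_tr.
have [_ cx] := cd_coded x; have ia := e_isu hF hB a; have [ia' _ _] := isu_sinv ia.
have E n : act (winv e (mkseq (lt_ (ins a x)) n.+1)) (act (e a) (cd x)) =
    act (winv e (mkseq (lt_ x) n)) (cd x).
  rewrite mkseq_cons ins_lt0// (winv_cons e) act_comp//; last exact: (winv_isu hF hB).
  by rewrite actK//; congr (act (winv e _) _); apply: eq_map => i; rewrite ins_ltS.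
case=> [|n]; last by rewrite E ins_ltS.
rewrite ins_lt0//= act_id; have /trbP ta := h.
have := cx 0%N; rewrite /= act_id -(closure_intI hB).
by move=> /(closureS ta); rewrite act_closure// (closure_intI hB).
Qed.

Lemma ins_of_shift y x : shifts_to y x -> trb (lt_ y 0%N) (lt_ x 0%N) /\ y = ins (lt_ y 0%N) x.
Proof.
move=> h; have t : trb (lt_ y 0%N) (lt_ x 0%N) by rewrite /(lt_ x) -h; exact: X_tr.
split => //; apply: X_ext => -[|i]; rewrite insE//=.
have [_ _ h3] := set_valP y; rewrite -(h 0%N) h3 lcosetKV; last exact: (e_isu hF hB).
exact: surjective_pairing.
Qed.

Lemma ins_shifts a x : trb a (lt_ x 0%N) -> shifts_to (ins a x) x.
Proof. by move=> h i; rewrite insE. Qed.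

Lemma ins_continuous a : continuous (ins a).
Proof.
move=> x B /nbhs_basis[n Hn]; apply: filterS (nbhs_agree x n.+1) => y h; apply: Hn.
have l0 : lt_ y 0%N = lt_ x 0%N by rewrite /lt_ h.
have [t|t] := boolP (trb a (lt_ x 0%N)).
  move=> [|i] ni; rewrite !insE ?l0//=; first by rewrite (h 0%N).
  by apply: h; exact: (leq_trans (leqnSn _) (leqW ni)).
move=> i ni; rewrite !ins_out ?l0//; apply: h; exact: ltnW.
Qed.

(** The derivative of e_a^-1 at e_a(p) is inverse to that of e_a at p, which cancels the sign in
    [phiX]. *)
Lemma phiX_ins (d : R) a x : trb a (lt_ x 0%N) ->
  expR (phiX d (ins a x)) = der (e a) (cd x) `^ d.
Proof.
move=> h; have ia := e_isu hF hB a; have d0 := der_gt0 (cd x) ia.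
have -> : phiX d (ins a x) =
  - d * ln (mderiv (sinv (e (lt_ (ins a x) 0%N))) (set_val (cd (ins a x)))) by [].
rewrite ins_lt0// ins_cd//.
have -> : mderiv (sinv (e a)) (set_val (act (e a) (cd x))) = (der (e a) (cd x))^-1.
  by rewrite -der_sinv// der.unlock.
by rewrite lnV ?posrE// mulrNN /powR gt_eqF.
Qed.

End CodingSpace.

(** * Measures with a density *)

Section WeightedMeasure.
Local Open Scope ereal_scope.
Context (d : measure_display) (T : measurableType d) (R : realType).
Variables (m : {measure set T -> \bar R}) (w : T -> R).
Hypotheses (mw : measurable_fun setT w) (w0 : forall x, (0 <= w x)%R).

(** Taking the conditions on [w] as arguments lets the measure structure be found from the term
    alone. *)
Definition wmeas of measurable_fun setT w & (forall x, (0 <= w x)%R) :=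
  fun A => \int[m]_(x in A) (w x)%:E.

Let mwE D : measurable D -> measurable_fun D (fun x => (w x)%:E).
Proof. by move=> mD; apply/measurable_EFinP; exact: measurable_funTS. Qed.

Let wmeas0 : wmeas mw w0 set0 = 0.
Proof. by rewrite /wmeas integral_set0. Qed.
Let wmeas_ge0 A : 0 <= wmeas mw w0 A.
Proof. by apply: integral_ge0 => x _; rewrite lee_fin. Qed.
Let wmeas_sigma : semi_sigma_additive (wmeas mw w0).
Proof.
move=> F mF tF mUF; rewrite /wmeas ge0_integral_bigcup//; last 2 first.
- exact: mwE.
- by move=> x _; rewrite lee_fin.
apply: is_cvg_ereal_nneg_natsum_cond => n _ _; apply: integral_ge0 => x _.
by rewrite lee_fin.
Qed.
HB.instance Definition _ := isMeasure.Build _ _ _ (wmeas mw w0) wmeas0 wmeas_ge0 wmeas_sigma.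

Lemma integral_weight_indic A : measurable A ->
  \int[m]_(x in A) (w x)%:E = \int[m]_x ((w x)%:E * (\1_A x)%:E).
Proof.
move=> mA; rewrite integral_mkcond; apply: eq_integral => x _.
by rewrite /patch indicE; case: ifP => _; rewrite ?mule1 ?mule0.
Qed.

Import HBNNSimple.

Lemma wmeas_integral (f : T -> \bar R) : measurable_fun setT f -> (forall x, 0 <= f x) ->
  \int[wmeas mw w0]_x f x = \int[m]_x ((w x)%:E * f x).
Proof.
move=> mf f0.
pose f_ := nnsfun_approx measurableT mf.
have c x : (f_ n x)%:E @[n --> \oo] --> f x by exact: cvg_nnsfun_approx.
transitivity (limn (fun n => \int[wmeas mw w0]_x (f_ n x)%:E)).
  rewrite -monotone_convergence//=.
  - by apply: eq_integral => x _; apply/esym/cvg_lim => //; exact: c.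
  - by move=> n; apply/measurable_EFinP.
  - by move=> n x _; rewrite lee_fin.
  - by move=> x _ n1 n2 n12; rewrite lee_fin; exact/lefP/nd_nnsfun_approx.
transitivity (limn (fun n => \int[m]_x ((w x)%:E * (f_ n x)%:E))); last first.
  rewrite -monotone_convergence//=.
  - by apply: eq_integral => x _; apply/cvg_lim => //; apply: cvgeZl => //; exact: c.
  - by move=> n; apply: emeasurable_funM; [exact: mwE|apply/measurable_EFinP].
  - by move=> n x _; rewrite mule_ge0 ?lee_fin.
  - by move=> x _ n1 n2 n12; rewrite lee_wpmul2l ?lee_fin//; exact/lefP/nd_nnsfun_approx.
congr (limn _); apply: funext => n.
transitivity (\int[wmeas mw w0]_x (\sum_(r \in range (f_ n)) (r * \1_(f_ n @^-1` [set r]) x)%:E)).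
  by apply: eq_integral => x _; rewrite [in LHS]fimfunE -fsumEFin.
rewrite ge0_integral_fsum//; last 2 first.
- by move=> r; apply/measurable_EFinP; apply: measurable_funM.
- by move=> r x _; rewrite EFinM nnfun_muleindic_ge0.
transitivity (\int[m]_x (\sum_(r \in range (f_ n)) ((w x)%:E * (r * \1_(f_ n @^-1` [set r]) x)%:E))); last first.
  apply: eq_integral => x _; rewrite [in RHS]fimfunE -fsumEFin// ge0_mule_fsumr//.
  by move=> r; rewrite EFinM nnfun_muleindic_ge0.
rewrite ge0_integral_fsum//; last 2 first.
- by move=> r; apply: emeasurable_funM; [exact: mwE|apply/measurable_EFinP; exact: measurable_funM].
- by move=> r x _; rewrite mule_ge0 ?lee_fin// -lee_fin EFinM nnfun_muleindic_ge0.
apply: eq_fsbigr => r _; set A := f_ n @^-1` [set r].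
have mA : measurable A by exact: measurable_sfunP.
have [r0|r0] := leP 0%R r; last first.
  by rewrite /A preimage_nnfun0// !integral0_eq// => x _; rewrite indicE in_set0 mulr0 ?mule0.
under eq_integral do rewrite EFinM.
under [RHS]eq_integral do rewrite EFinM muleCA.
rewrite !ge0_integralZl_EFin//.
- by rewrite integral_indic// setIT /= -integral_weight_indic.
all: try by move=> x _; rewrite ?mule_ge0 ?lee_fin.
all: try exact/measurable_EFinP.
by apply: emeasurable_funM; [exact: mwE|apply/measurable_EFinP].
Qed.
End WeightedMeasure.

(** * Change of variables between weighted measures *)

Section Transfer.
Local Open Scope ereal_scope.
Context (d1 d2 : measure_display) (T1 : measurableType d1) (T2 : measurableType d2) (R : realType).
Variables (m1 : {measure set T1 -> \bar R}) (m2 : {measure set T2 -> \bar R}).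
Variables (w1 : T1 -> R) (w2 : T2 -> R) (t : T1 -> T2).
Hypotheses (mw1 : measurable_fun setT w1) (w10 : forall x, (0 <= w1 x)%R).
Hypotheses (mw2 : measurable_fun setT w2) (w20 : forall x, (0 <= w2 x)%R).
Hypothesis mt : measurable_fun setT t.

(** The identity on sets says that the measure w2 m2 is the image of w1 m1 under [t]. *)
Lemma transfer_integral :
  (forall B, measurable B -> \int[m2]_(x in B) (w2 x)%:E = \int[m1]_(x in t @^-1` B) (w1 x)%:E) ->
  forall F : T2 -> \bar R, measurable_fun setT F -> (forall x, 0 <= F x) ->
  \int[m2]_x ((w2 x)%:E * F x) = \int[m1]_x ((w1 x)%:E * F (t x)).
Proof.
move=> H F mF F0.
rewrite -(wmeas_integral m2 mw2 w20)// -(wmeas_integral m1 mw1 w10 (f := F \o t))//.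
all: try exact: measurableT_comp.
rewrite -[RHS](@ge0_integral_pushforward _ _ _ _ R t mt (wmeas m1 mw1 w10) setT F)//.
by apply: eq_measure_integral => B mB _; exact: H.
by move=> x; exact: F0.
Qed.

Lemma transfer_unique (C : set (set T2)) (c : nat -> set T2) :
  measurable = <<s C >> -> setI_closed C -> (forall n, C (c n)) -> \bigcup_n c n = setT ->
  (forall n, \int[m2]_(x in c n) (w2 x)%:E < +oo) ->
  (forall B, C B -> \int[m2]_(x in B) (w2 x)%:E = \int[m1]_(x in t @^-1` B) (w1 x)%:E) ->
  forall B, measurable B -> \int[m2]_(x in B) (w2 x)%:E = \int[m1]_(x in t @^-1` B) (w1 x)%:E.
Proof.
move=> mC CI Cc cT cfin H.
exact: (@measure_unique _ R T2 C c mC CI Cc cT (wmeas m2 mw2 w20)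
  (pushforward (wmeas m1 mw1 w10) t) H cfin).
Qed.
End Transfer.

(** The unions of the tails decrease inside a set of finite measure and keep measure at least [c],
    so by continuity from above their intersection is nonempty. *)
Lemma infinitely_often (d : measure_display) (T : measurableType d) (R : realType)
    (m : {measure set T -> \bar R}) (Y : nat -> set T) (D : set T) (c : R) :
  measurable D -> (m D < +oo)%E -> (forall n, measurable (Y n) /\ Y n `<=` D) -> 0 < c ->
  (forall n, (c%:E <= m (Y n))%E) -> exists z, forall n, exists2 k, (n <= k)%N & Y k z.
Proof.
move=> mD mDoo mY c0 Yc; apply: contrapT => no.
pose A n := \bigcup_(k in [set k | (n <= k)%N]) Y k.
have mA n : measurable (A n) by apply: bigcup_measurable => k _; case: (mY k).
have A0 : \bigcap_n A n = set0.
  rewrite -subset0 => z Az; apply: no; exists z => n.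
  by have [k nk Yk] := Az n I; exists k.
have : m \o A @ \oo --> m (\bigcap_n A n).
  apply: nonincreasing_cvg_mu => //.
  - apply: le_lt_trans mDoo; apply: le_measure; rewrite ?inE//.
    by move=> z [k _ /((mY k).2)].
  - by rewrite A0.
  - by move=> i j ij; apply/subsetPset => z [k jk Yk]; exists k => //=; exact: leq_trans jk.
rewrite A0 measure0 => cv.
have : (c%:E <= 0 :> \bar R)%E.
  rewrite -(cvg_lim _ cv)//; apply: lime_ge; first by apply/cvg_ex; exists 0%E.
  apply: nearW => n /=; apply: le_trans (Yc n) _; apply: le_measure; rewrite ?inE//.
    by case: (mY n).
  by move=> z Yz; exists n => /=.
by rewrite lee_fin leNgt c0.
Qed.

Lemma countable_enum (T : Type) (A : set T) (a0 : T) : A a0 -> countable A ->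
  exists h : nat -> T, (forall n, A (h n)) /\ forall g, A g -> exists n, h n = g.
Proof.
move=> Aa /countable_injP[k kinj].
pose h n := if pselect (exists2 g, A g & k g = n) is left p then s2val (cid2 p) else a0.
exists h; split.
  by move=> n; rewrite /h; case: pselect => // p; case: (cid2 p).
move=> g Ag; exists (k g); rewrite /h; case: pselect => [p|]; last by case; exists g.
by case: (cid2 p) => g' Ag' /= e; apply: kinj; rewrite ?inE.
Qed.

(** * Borel measurability of continuous maps *)

Section BorelMaps.
Variable R : realType.

Lemma borel_preimage_open (T1 T2 : ptopologicalType) (t : T1 -> T2) :
  continuous t -> measurable_fun setT (t : g_sigma_algebraType (@open T1) -> g_sigma_algebraType (@open T2)).
Proof.
move=> /continuousP ct.
apply: (@measurability _ _ (g_sigma_algebraType (@open T1)) (g_sigma_algebraType (@open T2))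
  setT t (@open T2) erefl).
by move=> _ [B oB <-]; rewrite setTI; apply: sub_sigma_algebra; exact: ct.
Qed.

Lemma borel_real_continuous (T1 : ptopologicalType) (t : T1 -> R) :
  continuous t -> measurable_fun setT (t : g_sigma_algebraType (@open T1) -> R).
Proof.
move=> /continuousP ct; apply: (measurability _ (RGenOpens.measurableE R)).
move=> _ [_ [a [b ->] <-]]; rewrite setTI; apply: sub_sigma_algebra; apply: ct.
exact: interval_open.
Qed.
End BorelMaps.

Lemma integral_indicI (d : measure_display) (T : measurableType d) (R : realType)
    (m : {measure set T -> \bar R}) (A D : set T) : measurable A -> measurable D ->
  (\int[m]_(x in D) (\1_A x)%:E = m (A `&` D))%E.
Proof. by move=> mA mD; rewrite integral_indic. Qed.

(** * Eigenmeasures and their Jacobians *)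

Section Eigenmeasures.
Variables (R : realType) (G0 G : set (smap R)) (S0 : finType).
Variables (I : S0 -> set (circle R)) (e : S0 -> smap R) (f : circle R -> circle R).
Hypothesis hF : fuchsian G0.
Hypothesis hB : bowen_series G0 I e f.
Implicit Types (a b c : S0) (w v : seq S0) (g h : smap R) (H : set (smap R)).
Local Notation trb := (trb I e).
Local Notation X := (Xspace G0 G I e f).
Variables (dl : R) (x0 : X).
Implicit Types (x y z : X) (mu : {measure set (borel_at x0) -> \bar R}).

Lemma measurable_finite n (P : set (smap R) -> seq S0 -> Prop) :
  measurable ([set x | P (gp x) (mkseq (lt_ x) n)] : set (borel_at x0)).
Proof. by apply: sub_sigma_algebra; exact: (@open_finite R G0 G S0 I e f n P). Qed.

Lemma measurable_cd : measurable_fun setT (@cd _ _ _ _ _ _ _ : borel_at x0 -> borel_circle R).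
Proof. exact: (@borel_preimage_open (pointed_at x0) (circle R) _ (cd_continuous hF hB)). Qed.

Lemma measurable_ins a : measurable_fun setT (ins a : borel_at x0 -> borel_at x0).
Proof.
exact: (@borel_preimage_open (pointed_at x0) (pointed_at x0) _ (ins_continuous hF hB (a := a))).
Qed.

Lemma measurable_act g : isu g -> measurable_fun setT (act g : borel_circle R -> borel_circle R).
Proof.
move=> ig; apply: borel_preimage_open; apply/continuousP => A; exact: act_open.
Qed.

Lemma measurable_der_pow g : isu g ->
  measurable_fun setT ((fun p => der g p `^ dl) : borel_circle R -> R).
Proof.
move=> ig; apply: (measurableT_comp (measurable_powR dl)).
exact: (borel_real_continuous (der_continuous ig)).
Qed.

Definition La a : set X := [set x | lt_ x 0%N = a].
Definition Da a : set X := [set x | trb a (lt_ x 0%N)].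
Definition fib H : set X := [set x | gp x = H].
(** The indicator removes the points at which [ins a] takes its default value. *)
Definition wa a x : R := der (e a) (cd x) `^ dl * \1_(Da a) x.

Lemma measurable_La a : measurable (La a : set (borel_at x0)).
Proof.
have := @measurable_finite 1%N (fun _ w => head a w = a); congr measurable.
Qed.
Lemma measurable_Da a : measurable (Da a : set (borel_at x0)).
Proof. exact: (@measurable_finite 1%N (fun _ w => trb a (head a w))). Qed.
Lemma measurable_fib H : measurable (fib H : set (borel_at x0)).
Proof. exact: (@measurable_finite 0%N (fun H' _ => H' = H)). Qed.

Lemma measurable_wa a : measurable_fun setT (wa a : borel_at x0 -> R).
Proof.
apply: measurable_funM; last by apply: measurable_indic; exact: measurable_Da.
exact: (measurableT_comp (measurable_der_pow (e_isu hF hB a)) measurable_cd).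
Qed.
Lemma wa_ge0 a x : 0 <= wa a x.
Proof. by rewrite mulr_ge0// powR_ge0. Qed.

Lemma wa_in a x : trb a (lt_ x 0%N) -> wa a x = der (e a) (cd x) `^ dl.
Proof. by move=> h; rewrite /wa indicE mem_set// mulr1. Qed.
Lemma wa_out a x : ~~ trb a (lt_ x 0%N) -> wa a x = 0.
Proof. by move=> h; rewrite /wa indicE memNset ?mulr0//; exact/negP. Qed.

Lemma ruelleE (u : X -> R) x : ruelle dl u x = \sum_b wa b x * u (ins b x).
Proof.
rewrite /ruelle.
have bij : set_bij [set b | trb b (lt_ x 0%N)] [set y | shifts_to y x] (fun b => ins b x).
  split.
  - by move=> b hb; exact: (ins_shifts hF hB).
  - by move=> b c; rewrite !inE /= => hb hc /(congr1 (fun y => lt_ y 0%N)); rewrite !(ins_lt0 hF hB).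
  - by move=> y /(ins_of_shift hF hB)[h1 h2]; exists (lt_ y 0%N).
rewrite (reindex_fsbig _ _ _ _ bij).
have -> : [set b | trb b (lt_ x 0%N)] = [set` [seq b <- enum S0 | trb b (lt_ x 0%N)]].
  by apply/seteqP; split => b /=; rewrite mem_filter mem_enum andbT.
have U : uniq [seq b <- enum S0 | trb b (lt_ x 0%N)] by rewrite filter_uniq// enum_uniq.
rewrite -(fsbig_seq _ _ U) big_filter big_enum_cond big_mkcond /=.
apply: eq_bigr => b _; case: ifPn => hb; last by rewrite wa_out// mul0r.
by rewrite (phiX_ins hF hB)// wa_in.
Qed.

Lemma fiber_finite mu H : radon mu -> (mu (fib H) < +oo)%E.
Proof. by apply; exact: fiber_compact. Qed.

Lemma coset_enum : exists h : nat -> smap R, (forall n, G0 (h n)) /\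
  forall x, exists n, gp x = lcoset (h n) G.
Proof.
have [h [h1 h2]] := countable_enum (fuchs_id hF) (fuchs_countable hF).
exists h; split => // x; have [g Gg <-] := X_gp x.
by have [n <-] := h2 g Gg; exists n.
Qed.

(** The eigenmeasure equation localized to one inverse branch of the shift. Being about sets, it can
    be iterated along words and restricted to fibres. *)
Definition jac mu := forall a (B : set (borel_at x0)), measurable B ->
  (\int[mu]_(x in B) (\1_(La a) x)%:E = \int[mu]_(x in ins a @^-1` B) (wa a x)%:E)%E.

Lemma jac_integral mu a (F : borel_at x0 -> \bar R) : jac mu ->
  measurable_fun setT F -> (forall x, 0 <= F x)%E ->
  (\int[mu]_x ((\1_(La a) x)%:E * F x) = \int[mu]_x ((wa a x)%:E * F (ins a x)))%E.
Proof.
move=> J mF F0; apply: (@transfer_integral _ _ _ _ R mu mu (wa a) (\1_(La a)) (ins a)) => //.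
- exact: measurable_wa.
- exact: wa_ge0.
- by apply: measurable_indic; exact: measurable_La.
- exact: measurable_ins.
- exact: J.
Qed.

(** The empty set is included to make the family stable under intersection. *)
Definition cylinders : set (set (borel_at x0)) :=
  [set B | B = set0 \/ exists H w, B = [set x | gp x = H /\ mkseq (lt_ x) (size w) = w]].

Lemma cylinders_generate : measurable = <<s cylinders >>.
Proof.
apply/seteqP; split; last first.
  apply: smallest_sub; first exact: sigma_algebra_measurable.
  move=> _ [->|[H [w ->]]]; first exact: measurable0.
  exact: (@measurable_finite (size w) (fun H' w' => H' = H /\ w' = w)).
apply: smallest_sub; first exact: smallest_sigma_algebra.
move=> U oU; have [h [_ hx]] := coset_enum.
pose C (q : nat * seq S0) : set X :=
  [set x | gp x = lcoset (h q.1) G /\ mkseq (lt_ x) (size q.2) = q.2].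
pose D (q : nat * seq S0) := if pselect (C q `<=` U) is left _ then C q else set0.
have -> : U = \bigcup_q D q.
  apply/seteqP; split => x; last first.
    by move=> [q _]; rewrite /D; case: pselect => // h'; exact: h'.
  move=> Ux; have [n Hn] : exists n, forall y, (forall i, (i < n)%N -> set_val y i = set_val x i) -> U y.
    by apply: nbhs_basis; exact: (open_nbhs_nbhs (conj oU Ux)).
  have [k gk] := hx x; exists (k, mkseq (lt_ x) n) => //.
  rewrite /D; case: pselect => [_|nC]; first by split => //=; rewrite size_mkseq.
  exfalso; apply: nC => y [gy ly]; apply: Hn => i ni; apply: agree_words ni.
    by rewrite gy gk.
  by move: ly; rewrite /= size_mkseq.
apply: (@countable_bigcupT_measurable _ (g_sigma_algebraType cylinders)); first exact: countableP.
move=> q; rewrite /D; case: pselect => [_|_]; last exact: measurable0.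
by apply: sub_sigma_algebra; right; exists (lcoset (h q.1) G), q.2.
Qed.

Lemma cylinders_setI : setI_closed cylinders.
Proof.
move=> A B [->|[H [w ->]]]; first by rewrite set0I => _; left.
move=> [->|[H' [w' ->]]]; first by rewrite setI0; left.
wlog ww : H H' w w' / (size w <= size w')%N.
  by move=> Hw; have [/Hw//|/ltnW/Hw] := leqP (size w) (size w'); rewrite setIC.
set S := _ `&` _.
have [[z [[z1 z2] [z3 z4]]]|no] := EM (S !=set0); last first.
  by left; rewrite -subset0 => z Sz; apply: no; exists z.
right; exists H', w'; apply/seteqP; split => y; first by case.
move=> [y1 y2]; split; last by split.
have tk (s : nat -> S0) : mkseq s (size w) = take (size w) (mkseq s (size w')).
  by rewrite /mkseq -map_take take_iota (minn_idPl ww).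
split; first by rewrite y1 -z3.
by rewrite tk y2 -z4 -tk z2.
Qed.

Lemma indic_fin_continuous n (P : set (smap R) -> seq S0 -> Prop) :
  continuous (\1_[set x | P (gp x) (mkseq (lt_ x) n)] : X -> R).
Proof.
move=> x B nB; apply: filterS (nbhs_agree x n.+1) => y h /=.
have gy : gp y = gp x by rewrite /gp h.
have ly : mkseq (lt_ y) n = mkseq (lt_ x) n.
  by apply/eq_in_map => k; rewrite mem_iota /= add0n => kn; rewrite /lt_ h// ltnW.
suff -> : \1_[set x | P (gp x) (mkseq (lt_ x) n)] y = \1_[set x | P (gp x) (mkseq (lt_ x) n)] x :> R.
  exact: nbhs_singleton.
rewrite !indicE; congr ((_ : bool)%:R); apply/idP/idP; rewrite !inE /=; by rewrite gy ly.
Qed.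

(** For a cylinder [B] the indicator of B intersected with [La a] is continuous with compact
    support, hence a test function, and only the branch [a] contributes to its Ruelle transform.
    Cylinders generate the Borel sets, and countably many fibres of finite mass cover the space. *)
Lemma eigen_jac mu : eigenmeasure dl mu -> jac mu.
Proof.
move=> [rmu eig] a; have [en [_ hx]] := coset_enum.
apply: (@transfer_unique _ _ _ _ R mu mu (wa a) (\1_(La a)) (ins a) (measurable_wa a) (wa_ge0 a)
  _ _ (measurable_ins a) cylinders (fun n => fib (lcoset (en n) G))).
- by apply: measurable_indic; exact: measurable_La.
- by [].
- exact: cylinders_generate.
- exact: cylinders_setI.
- by move=> n; right; exists (lcoset (en n) G), [::]; apply/seteqP; split => x //= [].
- by rewrite -subTset => x _; have [n gx] := hx x; exists n.
- move=> n; apply: le_lt_trans (fiber_finite (lcoset (en n) G) rmu).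
  rewrite (integral_indicI mu (measurable_La a) (measurable_fib _)).
  apply: le_measure; rewrite ?inE; [|exact: measurable_fib|exact: subIsetr].
  by apply: measurableI; [exact: measurable_La|exact: measurable_fib].
move=> B [->|[H [w eB]]]; first by rewrite preimage_set0 !integral_set0.
have mB : measurable (B : set (borel_at x0)).
  by rewrite eB; exact: (@measurable_finite (size w) (fun H' w' => H' = H /\ w' = w)).
have mBi : measurable (ins a @^-1` B : set (borel_at x0)).
  by rewrite -[X in measurable X]setTI; exact: measurable_ins.
pose P (H' : set (smap R)) s := H' = H /\ take (size w) s = w /\ head a s = a.
have eBa : B `&` La a = [set x | P (gp x) (mkseq (lt_ x) (size w).+1)].
  have tk x : take (size w) (mkseq (lt_ x) (size w).+1) = mkseq (lt_ x) (size w).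
    by rewrite mkseqS -cats1 take_cat size_mkseq ltnn subnn cats0.
  apply/seteqP; split => x; rewrite eB /P /= tk; first by move=> [[h1 h2] h3].
  by move=> [h1 [h2 h3]].
pose u : X -> R := \1_(B `&` La a).
have cu : continuous u by rewrite /u eBa; exact: indic_fin_continuous.
have su : compact (closure [set x | u x != 0]).
  have -> : [set x | u x != 0] = B `&` La a.
    apply/seteqP; split => x /=; rewrite /u indicE; last by move=> h; rewrite mem_set// oner_neq0.
    by move=> ux; apply: contrapT => nB; move: ux; rewrite memNset// eqxx.
  have cl : closed (B `&` La a) by rewrite eBa; exact: closed_finite.
  rewrite -((closure_id _).1 cl); apply: (subclosed_compact cl (@fiber_compact _ _ _ _ _ _ _ H)).
  by move=> x [+ _]; rewrite eB => -[].
have := eig u cu su.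
rewrite (integral_indicI mu (measurable_La a) mB).
rewrite (integral_indicI mu (measurableI _ _ mB (measurable_La a)) measurableT).
rewrite setIT setIC => <-.
rewrite integral_weight_indic//.
apply: eq_integral => x _; rewrite ruelleE (bigD1 a)//= big1 ?addr0; last first.
  move=> b ba; have [tb|tb] := boolP (trb b (lt_ x 0%N)); last by rewrite wa_out// mul0r.
  rewrite /u indicE memNset ?mulr0// => -[_]; rewrite /La /= (ins_lt0 hF hB)// => h.
  by rewrite h eqxx in ba.
have [ta|ta] := boolP (trb a (lt_ x 0%N)); last by rewrite wa_out// mul0r mul0e.
rewrite -EFinM; congr (_ * _)%:E; rewrite /u !indicE; congr ((_ : bool)%:R).
apply/idP/idP; rewrite !inE /=; first by case.
by move=> h; split => //; rewrite /La /= (ins_lt0 hF hB).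
Qed.

Lemma jac_ruelle mu (v : borel_at x0 -> R) : jac mu ->
  measurable_fun setT v -> (forall x, 0 <= v x) ->
  measurable_fun setT (ruelle dl v : borel_at x0 -> R) /\
  (\int[mu]_x (ruelle dl v x)%:E = \int[mu]_x (v x)%:E)%E.
Proof.
move=> J mv v0.
have mi a : measurable_fun setT (fun x : borel_at x0 => wa a x * v (ins a x)).
  apply: measurable_funM; first exact: measurable_wa.
  exact: (measurableT_comp mv (measurable_ins a)).
have rE : ruelle dl v = (fun x : borel_at x0 => \sum_b wa b x * v (ins b x)).
  by apply: funext => x; exact: ruelleE.
split; first by rewrite rE; apply: measurable_sum => b; exact: mi.
transitivity (\int[mu]_x (\sum_b ((wa b x)%:E * (v (ins b x))%:E)))%E.
  by apply: eq_integral => x _; rewrite ruelleE -sumEFin; apply: eq_bigr => b _; rewrite EFinM.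
rewrite ge0_integral_sum//; last 2 first.
- by move=> b; apply/measurable_EFinP; exact: mi.
- by move=> b x _; rewrite -EFinM lee_fin mulr_ge0// wa_ge0.
transitivity (\sum_b \int[mu]_x ((\1_(La b) x)%:E * (v x)%:E))%E.
  apply: eq_bigr => b _; rewrite (jac_integral b J (F := fun x => (v x)%:E))//.
  exact/measurable_EFinP.
rewrite -ge0_integral_sum//; last 2 first.
- move=> b; apply/measurable_EFinP; apply: measurable_funM => //.
  by apply: measurable_indic; exact: measurable_La.
- by move=> b x _; rewrite -EFinM lee_fin mulr_ge0.
apply: eq_integral => x _; rewrite (bigD1 (lt_ x 0%N))//= big1; last first.
  by move=> b bx; rewrite indicE memNset ?mul0e// => h; rewrite -h eqxx in bx.
by rewrite indicE mem_set// mul1e adde0.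
Qed.

(** Test functions may change sign. Positive and negative parts are treated by [jac_ruelle] and are
    integrable, being bounded by a multiple of the indicator of a compact set. *)
Lemma jac_eigen mu : radon mu -> jac mu -> eigenmeasure dl mu.
Proof.
move=> rmu J; split => // u cu ku.
have mu_ : measurable_fun setT (u : borel_at x0 -> R) by exact: (@borel_real_continuous _ (pointed_at x0)).
pose K := closure [set x | u x != 0].
have mK : measurable (K : set (borel_at x0)).
  rewrite -[K]setCK; apply: measurableC; apply: sub_sigma_algebra.
  exact: (closed_openC (@closed_closure _ _)).
have [M [M0 HM]] : exists M : R, 0 <= M /\ forall x, `|u x| <= M * \1_K x.
  have ck : compact (u @` K).
    by apply: continuous_compact => //; exact: continuous_subspaceT.
  have [M [_ HM]] := compact_bounded ck.
  exists (`|M| + 1); split => [|x]; first by rewrite addr_ge0.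
  have [Kx|nK] := EM (K x); rewrite indicE; last first.
    rewrite memNset// mulr0 normr_le0; apply/negPn/negP => ux.
    by apply: nK; apply: subset_closure.
  rewrite mem_set// mulr1; apply: (HM (`|M| + 1)); last by exists x.
  by rewrite (le_lt_trans (ler_norm M))// ltrDl.
have int_fin (v : borel_at x0 -> R) : measurable_fun setT v -> (forall x, 0 <= v x) ->
    (\int[mu]_x (v x)%:E < +oo)%E -> mu.-integrable setT (fun x => (v x)%:E).
  move=> mv v0 fv; apply/integrableP; split; first exact/measurable_EFinP.
  by under eq_integral do rewrite gee0_abs ?lee_fin//.
pose up : borel_at x0 -> R := fun x => Num.max (u x) 0.
pose um : borel_at x0 -> R := fun x => Num.max (- u x) 0.
have uE x : u x = up x - um x.
  have [h|h] : 0 <= u x \/ u x <= 0 by [apply/orP; exact: le_total]; rewrite /up /um.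
    by rewrite max_l// max_r ?subr0// oppr_le0.
  by rewrite max_r// max_l ?oppr_ge0// opprK add0r.
have mup : measurable_fun setT up by exact: measurable_maxr.
have mum : measurable_fun setT um by apply: measurable_maxr => //; exact: measurableT_comp.
have up0 x : 0 <= up x by rewrite le_max lexx orbT.
have um0 x : 0 <= um x by rewrite le_max lexx orbT.
have fin (v : borel_at x0 -> R) : measurable_fun setT v -> (forall x, 0 <= v x) ->
    (forall x, v x <= `|u x|) -> (\int[mu]_x (v x)%:E < +oo)%E.
  move=> mv v0 vu; apply: (@le_lt_trans _ _ (\int[mu]_x (M%:E * (\1_K x)%:E)))%E.
    apply: ge0_le_integral => //.
    - by move=> x _; rewrite lee_fin.
    - exact/measurable_EFinP.
    - by apply/measurable_EFinP/measurable_funM => //; exact: measurable_indic.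
    - by move=> x _; rewrite -EFinM lee_fin; apply: le_trans (vu x) (HM x).
  rewrite ge0_integralZl_EFin//.
  - by rewrite integral_indic// setIT lte_mul_pinfty ?lee_fin//; exact: rmu.
  all: try by move=> x _; rewrite lee_fin.
  all: try by apply/measurable_EFinP; exact: measurable_indic.
have upu x : up x <= `|u x| by rewrite ge_max ler_norm normr_ge0.
have umu x : um x <= `|u x| by rewrite ge_max normr_ge0 andbT -normrN ler_norm.
have fup := fin up mup up0 upu; have fum := fin um mum um0 umu.
have [mrp erp] := jac_ruelle J mup up0; have [mrm erm] := jac_ruelle J mum um0.
have r0 (v : X -> R) x : (forall x, 0 <= v x) -> 0 <= ruelle dl v x.
  by move=> v0; rewrite ruelleE sumr_ge0// => b _; rewrite mulr_ge0// wa_ge0.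
transitivity (\int[mu]_x ((ruelle dl up x)%:E - (ruelle dl um x)%:E))%E.
  apply: eq_integral => x _; rewrite -EFinB !ruelleE -sumrB; congr (_%:E).
  by apply: eq_bigr => b _; rewrite -mulrBr -uE.
transitivity (\int[mu]_x ((up x)%:E - (um x)%:E))%E; last first.
  by apply: eq_integral => x _; rewrite -EFinB -uE.
have ip := int_fin _ mup up0 fup; have im := int_fin _ mum um0 fum.
have irp : mu.-integrable setT (fun x => (ruelle dl up x)%:E).
  by apply: int_fin => //; [move=> x; exact: r0|rewrite erp].
have irm : mu.-integrable setT (fun x => (ruelle dl um x)%:E).
  by apply: int_fin => //; [move=> x; exact: r0|rewrite erm].
rewrite (integralB measurableT irp irm) (integralB measurableT ip im).
by rewrite erp erm.
Qed.
End Eigenmeasures.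

(** * Points of the circle are null in every fibre *)

Section NullFibers.
Variables (R : realType) (G0 G : set (smap R)) (S0 : finType).
Variables (I : S0 -> set (circle R)) (e : S0 -> smap R) (f : circle R -> circle R).
Hypothesis hF : fuchsian G0.
Hypothesis hN : normal_subgroup G G0.
Hypothesis hB : bowen_series G0 I e f.
Variable g1 : smap R.
Hypotheses (Gg1 : G g1) (g1id : g1 <> id).
Variable dl : R.
Hypothesis dl0 : 0 <= dl.
Implicit Types (a b c : S0) (w v : seq S0) (g h : smap R) (H : set (smap R)).
Local Notation trb := (trb I e).
Local Notation icyl := (icyl I e).
Local Notation X := (Xspace G0 G I e f).
Local Notation loop := (loop G I e).

(* Inserting a loop [b :: r] after a prefix [w] of a code of [xi] displaces
   [xi] inside the cylinder of [w b]; for one of two loops it moves [xi], and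
   the derivative changes by a bounded factor. *)
Lemma loop_choice : exists2 k : R, 0 < k & forall b p, I b p -> exists r,
  [/\ loop b r, act (sinv (winv e (b :: r))) p <> p &
      forall w, path trb (head b w) (behead (rcons w b)) ->
      k * der (sinv (winv e w)) p <= der (sinv (winv e (w ++ b :: r))) p].
Proof.
have [K K1 HK] := der_inverse_branch hF hB.
have tl b := two_loops hF hN hB Gg1 g1id b.
have [r1 Hr1] := choice tl; have [r2 Hr2] := choice Hr1.
have [E1 E11 HE1] := finite_upper_bound (fun b => nrm (winv e (b :: r1 b))).
have [E2 E21 HE2] := finite_upper_bound (fun b => nrm (winv e (b :: r2 b))).
pose E := E1 + E2; have E0 : 0 < E by rewrite /E; lra.
have K0 : 0 < K by lra.
(* The derivative before insertion is at most K / nrm. After it, the inverse branch of [w]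
   contributes at least 1 / (4 nrm) and the inverse loop at least 1 / (4 E). *)
exists (16 * E * K)^-1; first by rewrite invr_gt0 !mulr_gt0.
move=> b p bp; have [l1 l2 nl] := Hr2 b.
have main r : loop b r -> nrm (winv e (b :: r)) <= E -> forall w, path trb (head b w) (behead (rcons w b)) ->
    (16 * E * K)^-1 * der (sinv (winv e w)) p <= der (sinv (winv e (w ++ b :: r))) p.
  move=> lr Er w pw; have iu := winv_isu hF hB w; have ir := winv_isu hF hB (b :: r).
  have [iu' _ _] := isu_sinv iu; have [ir' _ _] := isu_sinv ir.
  rewrite (winv_cat e) sinv_comp// der_comp//.
  have up : der (sinv (winv e w)) p <= K / nrm (winv e w).
    case: w pw {iu iu'} => [|a w] /= pw.
      by rewrite sinv_id der_id (rep_nrm (rep_id R)) sq1 divr1.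
    have := HK a (rcons w b) pw p; rewrite last_rcons belast_rcons; exact.
  have lo1 := der_ge (act (sinv (winv e (b :: r))) p) iu'.
  have lo2 := der_ge p ir'; rewrite !nrm_sinv// in lo1 lo2.
  have N0 := nrm_gt0 iu; have N1 := nrm_gt0 ir.
  apply: le_trans (ler_pM _ _ lo1 lo2); rewrite ?invr_ge0 ?mulr_ge0 ?(ltW N0) ?(ltW N1)//.
  have : (16 * E * K)^-1 * der (sinv (winv e w)) p <= (16 * E * K)^-1 * (K / nrm (winv e w)).
    by rewrite ler_wpM2l// invr_ge0 !mulr_ge0// ltW.
  move=> /le_trans; apply.
  have -> : (16 * E * K)^-1 * (K / nrm (winv e w)) = (4 * nrm (winv e w))^-1 * (4 * E)^-1.
    by field; rewrite !gt_eqF.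
  rewrite ler_wpM2l ?invr_ge0 ?mulr_ge0 ?(ltW N0)// lef_pV2 ?posrE ?mulr_gt0// ler_pM2l//.
have inC r : loop b r -> closure (icyl (b :: r)) (act (sinv (winv e (b :: r))) p).
  move=> [pr tr _]; have pr' : path trb b (rcons r b) by rewrite rcons_path pr.
  have : closure (icyl (b :: rcons r b)) (act (sinv (winv e (b :: r))) p).
    rewrite (icyl_closure hF hB pr') last_rcons belast_rcons /= actKV//.
    exact: (winv_isu hF hB).
  by rewrite -cats1 -cat_cons; apply: closureS; exact: icyl_cat.
have [c1|c1] := EM (closure (icyl (b :: r1 b)) p).
  exists (r2 b); split => //; last by apply: main => //; have := HE2 b; rewrite /E; lra.
  by move=> pe; apply: (nl p c1); rewrite -pe; exact: inC.
exists (r1 b); split => //; last by apply: main => //; have := HE1 b; rewrite /E; lra.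
by move=> pe; apply: c1; rewrite -pe; exact: inC.
Qed.

(** [loop_choice] at the point reached after reading [w], carried back by the inverse branch. The
    displaced point stays in the closed cylinder of w b, hence approaches [xi] as [w] grows. *)
Lemma loop_displace : exists2 k : R, 0 < k & forall xi w b,
  sorted trb (rcons w b) -> I b (act (winv e w) xi) -> exists r,
  let y := act (sinv (winv e (w ++ b :: r))) (act (winv e w) xi) in
  [/\ loop b r, sorted trb (rcons (w ++ b :: r) b), y <> xi,
   k * der (sinv (winv e w)) (act (winv e w) xi) <=
     der (sinv (winv e (w ++ b :: r))) (act (winv e w) xi) &
   closure (icyl (rcons w b)) y].
Proof.
have [k k0 Hk] := loop_choice; exists k => // xi w b sw; set p := act _ _ => bp.
have [r [lr mv Hd]] := Hk b p bp; exists r => y; have [pr tb _] := lr.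
have sw' : path trb (head b w) (behead (rcons w b)) by case: (w) sw.
have s2 : sorted trb (rcons (w ++ b :: r) b).
  rewrite rcons_cat /=; case: (w) sw => [|a w1] /=; first by rewrite rcons_path pr tb.
  by rewrite cat_path /= !rcons_path pr tb !andbT.
have iu := winv_isu hF hB w; have [iu' _ _] := isu_sinv iu.
have ir := winv_isu hF hB (b :: r); have [ir' _ _] := isu_sinv ir.
have cl W : sorted trb (rcons W b) -> closure (icyl (rcons W b)) (act (sinv (winv e W)) p).
  case: W => [|a W] s.
    have pb : path trb b [::] by [].
    rewrite [rcons _ _]/= (icyl_closure hF hB pb).
    change (I b (act (winv e [::]) (act (sinv (winv e [::])) p))).
    by rewrite actKV//; exact: (winv_isu hF hB).
  rewrite [rcons _ _]/= (icyl_closure hF hB s) last_rcons belast_rcons.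
  change (I b (act (winv e (a :: W)) (act (sinv (winv e (a :: W))) p))).
  by rewrite actKV//; exact: (winv_isu hF hB).
split=> //.
- rewrite /y (winv_cat e) sinv_comp// act_comp// => yx; apply: mv.
  by rewrite -[LHS](actKV _ iu) yx.
- exact: Hd.
- have := cl _ s2; rewrite rcons_cat rcons_cons -cat_rcons.
  by apply: closureS; exact: icyl_cat.
Qed.

(** g h = h (h^-1 g h), and normality puts the last factor in [G]. Inserting a loop in [G] therefore
    preserves the fibre. *)
Lemma normal_coset g H : G g -> quotient_group G0 G H -> lcoset g H = H.
Proof.
move=> Gg [h Gh <-]; have ih := fuchs_isu hF Gh; have [ih' h1 h2] := isu_sinv ih.
have Gk := normal_conj hF hN Gh Gg; have [_ k1 k2] := isu_sinv (normal_isu hF hN Gk).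
have e1 : g \o h = h \o (sinv h \o g \o h) by rewrite compA (compA h) h1.
rewrite -lcoset_comp e1 lcoset_comp; congr (lcoset h).
apply/seteqP; split => l /=; first by move=> [l' Gl <-]; exact: (normal_comp hN).
move=> Gl; exists (sinv (sinv h \o g \o h) \o l).
  by apply: (normal_comp hN) => //; exact: (normal_sinv hN).
by rewrite compA k1.
Qed.

Section Null.
Variable x0 : X.
Variable mu : {measure set (borel_at x0) -> \bar R}.
Hypotheses (rmu : radon mu) (jmu : jac dl mu).
Implicit Types (x y z : X).

Definition insw w x : X := foldr (fun a y => ins a y) x w.
Definition valid w x : bool := sorted trb (rcons w (lt_ x 0%N)).
(** The weight of the composite branch [insw w], zero where [w] may not precede [x]. *)
Definition ww w x : R := if valid w x then der (sinv (winv e w)) (cd x) `^ dl else 0.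

Lemma insw_facts w x : valid w x ->
  [/\ mkseq (lt_ (insw w x)) (size w) = w, forall i, lt_ (insw w x) (size w + i) = lt_ x i,
      gp (insw w x) = lcoset (sinv (winv e w)) (gp x) &
      cd (insw w x) = act (sinv (winv e w)) (cd x)].
Proof.
elim: w => [|a w IH] v; first by split; rewrite //= ?sinv_id ?lcoset_id ?act_id.
have v' : valid w x by case: w v {IH} => [|b w] //= /andP[].
have [h1 h2 h3 h4] := IH v'.
have ta : trb a (lt_ (insw w x) 0%N).
  case: w v {IH v' h3 h4} h1 h2 => [|b w] v h1 h2; first by case/andP: v.
  have -> : lt_ (insw (b :: w) x) 0%N = b by case: h1.
  by case/andP: v.
have iw := winv_isu hF hB w; have ia := e_isu hF hB a; have ia' := sinv_isu hF hB a.
have es : sinv (winv e (a :: w)) = e a \o sinv (winv e w).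
  by rewrite (winv_cons e) sinv_comp// sinvK.
have [iw' _ _] := isu_sinv iw.
split.
- rewrite -[size (a :: w)]/(size w).+1 mkseq_cons /= (ins_lt0 hF hB)//; congr cons.
  transitivity (mkseq (lt_ (insw w x)) (size w)); last exact: h1.
  by apply: eq_map => i; rewrite (ins_ltS hF hB).
- by move=> i; rewrite /= addSn (ins_ltS hF hB).
- by rewrite /= (ins_gp hF hB)// h3 es lcoset_comp.
- by rewrite /= (ins_cd hF hB)// h4 es act_comp.
Qed.

Lemma valid_cons a w x : valid (a :: w) x = valid w x && trb a (lt_ (insw w x) 0%N).
Proof.
case: w => [|b w]; first by rewrite /valid /= andbT.
change (trb a b && valid (b :: w) x = valid (b :: w) x && trb a (lt_ (insw (b :: w) x) 0%N)).
rewrite andbC.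
have [v|//] := boolP (valid (b :: w) x).
by have [h1 _ _ _] := insw_facts v; have -> : lt_ (insw (b :: w) x) 0%N = b by case: h1.
Qed.

Definition Lw w : set X := [set x | mkseq (lt_ x) (size w) = w].
Lemma measurable_Lw w : measurable (Lw w : set (borel_at x0)).
Proof. exact: (@measurable_finite _ _ _ _ _ _ _ x0 (size w) (fun _ s => s = w)). Qed.

(** Iterates the one-letter Jacobian relation; the chain rule multiplies the weights. *)
Lemma jac_word w (F : borel_at x0 -> \bar R) :
  measurable_fun setT F -> (forall x, 0 <= F x)%E ->
  (\int[mu]_x ((\1_(Lw w) x)%:E * F x) = \int[mu]_x ((ww w x)%:E * F (insw w x)))%E.
Proof.
elim: w F => [|a w IH] F mF F0.
  apply: eq_integral => x _; rewrite indicE mem_set// /ww /valid /= sinv_id der_id.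
  by rewrite powR1.
pose F1 x := ((\1_(Lw (a :: w)) x)%:E * F x)%E.
have mL v : measurable_fun setT (fun x : borel_at x0 => (\1_(Lw v) x)%:E : \bar R).
  by apply/measurable_EFinP/measurable_indic; exact: measurable_Lw.
have mF1 : measurable_fun setT (F1 : borel_at x0 -> \bar R) by exact: emeasurable_funM.
have F10 x : (0 <= F1 x)%E by rewrite mule_ge0// lee_fin.
transitivity (\int[mu]_x ((\1_(La a) x)%:E * F1 x))%E.
  apply: eq_integral => x _; rewrite /F1 muleA -EFinM; congr ((_)%:E * _)%E.
  rewrite !indicE -natrM mulnb; congr ((_ : bool)%:R); rewrite andb_idl//.
  by rewrite !inE /La /Lw /= mkseq_cons => -[].
rewrite (jac_integral hF hB a jmu mF1 F10).
pose F2 x := ((wa dl a x)%:E * F (ins a x))%E.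
have mF2 : measurable_fun setT (F2 : borel_at x0 -> \bar R).
  apply: emeasurable_funM; first by apply/measurable_EFinP; exact: (measurable_wa hF hB).
  have h := measurable_ins hF hB a (x0:=x0).  have h2 := measurableT_comp mF h. exact: h2.
have F20 x : (0 <= F2 x)%E by rewrite mule_ge0// lee_fin wa_ge0.
transitivity (\int[mu]_x ((\1_(Lw w) x)%:E * F2 x))%E.
  apply: eq_integral => x _; have [ta|ta] := boolP (trb a (lt_ x 0%N)); last first.
    by rewrite /F2 wa_out// !mul0e mule0.
  rewrite /F1 /F2 !muleA; congr (_ * _)%E; rewrite muleC; congr ((_)%:E * _)%E.
  rewrite !indicE; congr ((_ : bool)%:R).
  have E : mkseq (fun i => lt_ (ins a x) i.+1) (size w) = mkseq (lt_ x) (size w).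
    by apply: eq_map => i; rewrite (ins_ltS hF hB).
  apply/idP/idP; rewrite !inE /Lw /= mkseq_cons (ins_lt0 hF hB)// E; first by case.
  by move=> h; congr cons.
rewrite (IH F2 mF2 F20); apply: eq_integral => x _; rewrite /F2 muleA; congr (_ * _)%E.
rewrite -EFinM; congr (_%:E); rewrite /ww valid_cons.
have [v|v] := boolP (valid w x); last by rewrite mul0r.
have [ta|ta] /= := boolP (trb a _); last by rewrite wa_out// mulr0.
have [_ _ _ h4] := insw_facts v.
have iw := winv_isu hF hB w; have [iw' _ _] := isu_sinv iw.
rewrite wa_in// h4 (winv_cons e) sinv_comp// ?sinvK//; [|exact: (e_isu hF hB)|exact: (sinv_isu hF hB)].
by rewrite der_comp//; [rewrite powRM 1?mulrC// ltW// der_gt0//; exact: (e_isu hF hB)|exact: (e_isu hF hB)].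
Qed.
Lemma measurable_pt (p : circle R) : measurable ([set p] : set (borel_circle R)).
Proof.
rewrite -[X in measurable X]setCK; apply: measurableC; apply: sub_sigma_algebra.
apply: closed_openC; apply: accessible_closed_set1.
exact: (hausdorff_accessible (@circle_hausdorff R)).
Qed.

(** The letter at time [n] is recorded because one point of the circle may have several codes. *)
Definition point_set n b p H : set X := [set x | [/\ lt_ x n = b, cd x = p & gp x = H]].

Lemma measurable_point_set n b p H : measurable (point_set n b p H : set (borel_at x0)).
Proof.
have -> : point_set n b p H =
    [set x | gp x = H /\ last b (mkseq (lt_ x) n.+1) = b] `&` ((fun x : X => cd x) @^-1` [set p]).
  have E x : last b (mkseq (lt_ x) n.+1) = lt_ x n by rewrite mkseqS last_rcons.
  apply/seteqP; split => x; first by move=> [xb xp xH]; split => //; split; rewrite ?E.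
  by move=> [[xH]]; rewrite E => xb xp; split.
have m1 := @measurable_finite _ _ _ _ _ _ _ x0 n.+1 (fun (K : set (smap R)) s => K = H /\ last b s = b).
have m2 := measurable_cd hF hB (x0:=x0) measurableT (measurable_pt p); rewrite setTI in m2.
exact: (measurableI _ _ m1 m2).
Qed.

Lemma jac_point w b p H : sorted trb (rcons w b) ->
  (mu (Lw w `&` point_set (size w) b (act (sinv (winv e w)) p) (lcoset (sinv (winv e w)) H)) =
   (der (sinv (winv e w)) p `^ dl)%:E * mu (point_set 0 b p H))%E.
Proof.
move=> sw; set A := point_set (size w) _ _ _; set B := point_set 0 b p H.
have iu := winv_isu hF hB w; have [iu' _ _] := isu_sinv iu.
have mA : measurable (A : set (borel_at x0)) by exact: measurable_point_set.
have mB : measurable (B : set (borel_at x0)) by exact: measurable_point_set.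
have mi (D : set (borel_at x0)) : measurable D ->
    measurable_fun setT (fun x : borel_at x0 => (\1_D x)%:E : \bar R).
  by move=> mD; apply/measurable_EFinP/measurable_indic.
transitivity (\int[mu]_x ((\1_(Lw w) x)%:E * (\1_A x)%:E))%E.
  have mLA : measurable ((Lw w `&` A) : set (borel_at x0)) by apply: measurableI => //; exact: measurable_Lw.
  rewrite -[LHS](congr1 mu (setIT _)) -(integral_indicI mu mLA measurableT).
  by apply: eq_integral => x _; rewrite -EFinM indicI.
rewrite (jac_word w (mi _ mA)); last by move=> x; rewrite lee_fin.
transitivity (\int[mu]_x ((der (sinv (winv e w)) p `^ dl)%:E * (\1_B x)%:E))%E; last first.
  rewrite ge0_integralZl_EFin ?powR_ge0//; last exact: mi.
  by rewrite (integral_indicI mu mB measurableT) setIT.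
apply: eq_integral => x _; rewrite -!EFinM; congr (_%:E).
have [v|v] := boolP (valid w x); last first.
  rewrite /ww (negbTE v) mul0r indicE; have [|] := boolP (x \in B); last by rewrite mulr0.
  by rewrite inE => -[bx _ _]; move: v; rewrite /valid bx sw.
have [_ h2 h3 h4] := insw_facts v; have := h2 0%N; rewrite addn0 => h20.
rewrite /ww v !indicE.
have -> : (insw w x \in A) = (x \in B).
  apply/idP/idP; rewrite !inE => -[]; rewrite ?h20 ?h3 ?h4 => a1 a2 a3.
    split => //; first by apply: (act_inj iu').
    by rewrite -(lcosetKV (gp x) iu) a3 (lcosetKV H iu).
  by split; rewrite ?h20 ?h3 ?h4 ?a2 ?a3.
have [|] := boolP (x \in B); last by rewrite !mulr0.
by rewrite inE => -[_ -> _].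
Qed.

(** Write v = w b. The mass on codes of [xi] through [v] is compared by [jac_point] with the mass on
    codes in which a loop in [G] is inserted after [w]. Both come from the same set of tails, so the
    ratio of masses is a ratio of derivatives, at least k^delta. *)
Lemma null_step xi H v : quotient_group G0 G H -> forall k, 0 < k ->
  (forall xi w b, sorted trb (rcons w b) -> I b (act (winv e w) xi) -> exists r,
  let y := act (sinv (winv e (w ++ b :: r))) (act (winv e w) xi) in
  [/\ loop b r, sorted trb (rcons (w ++ b :: r) b), y <> xi,
   k * der (sinv (winv e w)) (act (winv e w) xi) <=
     der (sinv (winv e (w ++ b :: r))) (act (winv e w) xi) &
   closure (icyl (rcons w b)) y]) -> v <> [::] ->
  exists Y : set (borel_at x0), [/\ measurable Y, Y `<=` fib H `&` Lw v,
    ((k `^ dl)%:E * mu ([set x : X | gp x = H /\ cd x = xi] `&` Lw v) <= mu Y)%E &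
    forall y, Y y -> [/\ sorted trb v, cd y <> xi, closure (icyl v) xi & closure (icyl v) (cd y)]].
Proof.
move=> qH k k0 Hk; case/lastP: v => // w b _.
have [[x [[xH xx] xL]]|nx] := EM (exists x, ([set x : X | gp x = H /\ cd x = xi] `&` Lw (rcons w b)) x); last first.
  exists set0; split => //; last first.
    have -> : [set x : X | gp x = H /\ cd x = xi] `&` Lw (rcons w b) = set0.
      by apply/seteqP; split => // x hx; apply: nx; exists x.
    by rewrite !measure0 mule0.
have [n nw] : exists n, n = size w by exists (size w).
have eL z : Lw (rcons w b) z <-> Lw w z /\ lt_ z (size w) = b.
  rewrite /Lw /= size_rcons mkseqS; split; last by case=> -> ->.
  by move=> h; have [] := rcons_inj h.
have [xw xb] := (eL x).1 xL.
have cx := cd_coded hF hB x; rewrite xx in cx.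
have sw : sorted trb (rcons w b).
  rewrite -xL size_rcons; have [h1 _ _ <-] := code_path (size w) cx.1; exact: h1.
have Ib : I b (act (winv e w) xi) by have := cx.2 (size w); rewrite xw xb.
have [r [lr s2 ne dk cl]] := Hk xi w b sw Ib.
set p := act (winv e w) xi in ne dk cl.
have iu := winv_isu hF hB w; have iU := winv_isu hF hB (w ++ b :: r).
have [pr tb Gr] := lr.
have hH : lcoset (winv e (w ++ b :: r)) H = lcoset (winv e w) H.
  rewrite (winv_cat e) lcoset_comp normal_coset//; apply: (quotient_lcoset hF) => //.
  exact: (winv_G0 hF hB).
pose W := w ++ b :: r.
pose Y : set X := Lw W `&` point_set (size W) b (act (sinv (winv e W)) p) (lcoset (sinv (winv e W)) (lcoset (winv e w) H)).
have ceqH : lcoset (sinv (winv e W)) (lcoset (winv e w) H) = H by rewrite -hH lcosetK.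
exists Y; split.
- by apply: measurableI; [exact: measurable_Lw | exact: measurable_point_set].
- move=> y [yW [yb yc yg]]; rewrite ceqH in yg; split => //; apply/eL.
  have tk : mkseq (lt_ y) (size w).+1 = rcons w b.
    have : take (size w).+1 (mkseq (lt_ y) (size W)) = take (size w).+1 W by rewrite yW.
    rewrite /W -cat_rcons take_cat size_rcons ltnn subnn take0 cats0 => <-.
    rewrite /mkseq -map_take take_iota; congr map; congr iota.
    by apply/esym/minn_idPl; rewrite size_cat size_rcons leq_addr.
  by apply/eL; rewrite /Lw /= size_rcons.
- rewrite /Y (jac_point _ _ s2).
  have -> : [set x : X | gp x = H /\ cd x = xi] `&` Lw (rcons w b) =
      Lw w `&` point_set (size w) b (act (sinv (winv e w)) p) (lcoset (sinv (winv e w)) (lcoset (winv e w) H)).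
    rewrite /p actK// lcosetK//; apply/seteqP; split => z /=.
      by move=> [[z1 z2] /eL[z3 z4]].
    by move=> [z1 [z2 z3 z4]]; split => //; apply/eL.
  rewrite (jac_point _ _ sw) muleA -EFinM lee_wpmul2r// lee_fin -powRM ?(ltW k0)//; last first.
    by apply/ltW/der_gt0; have [] := isu_sinv iu.
  by rewrite ge0_ler_powR ?nnegrE ?mulr_ge0 ?(ltW k0)//; apply/ltW/der_gt0; [have [] := isu_sinv iu|have [] := isu_sinv iU].
- move=> y [_ [_ yc _]]; rewrite yc; split => //.
  by have := coded_closure hF hB (size w) cx; rewrite mkseqS xw xb.
Qed.

(** Since [xi] may have many codes, its mass is split by the words of length n + 1 and each piece is
    displaced separately. The union keeps mass at least k^delta mu(Z) in a fibre of finite mass, so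
    some [z] belongs to it for arbitrarily large n. Its coded point differs from [xi], yet shares
    arbitrarily small cylinders with it. *)
Lemma fiber_point_null xi H : quotient_group G0 G H ->
  mu [set x : X | gp x = H /\ cd x = xi] = 0.
Proof.
move=> qH; set Z := [set x : X | _].
have mZ : measurable (Z : set (borel_at x0)).
  have -> : Z = fib H `&` ((fun x : X => cd x) @^-1` [set xi]) by [].
  apply: measurableI.  exact: (@measurable_fib _ _ _ _ _ _ _ x0 H).
  by rewrite -[X in measurable X]setTI; apply: (measurable_cd hF hB (x0:=x0)) => //; exact: measurable_pt.
have finH := fiber_finite H rmu.
have finZ : (mu Z < +oo)%E.
  apply: le_lt_trans finH; apply: le_measure; rewrite ?inE//; first exact: (@measurable_fib _ _ _ _ _ _ _ x0 H).
  by move=> x [].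
have [//|nz] := eqVneq (mu Z) 0%E.
have Z0 : (0 < mu Z)%E by rewrite lt0e nz measure_ge0.
have [k k0 Hk] := loop_displace.
have step v : exists Y : set (borel_at x0), v <> [::] -> [/\ measurable Y, Y `<=` fib H `&` Lw v,
    ((k `^ dl)%:E * mu (Z `&` Lw v) <= mu Y)%E &
    forall y, Y y -> [/\ sorted trb v, cd y <> xi, closure (icyl v) xi & closure (icyl v) (cd y)]].
  have [v0|v0] := EM (v = [::]); first by exists set0 => h; case: (h v0).
  by have [Y hY] := null_step xi qH k0 Hk v0; exists Y.
have [Y HY] := choice step.
pose YY n : set (borel_at x0) := \bigcup_(t in [set: n.+1.-tuple S0]) Y t.
have tn n (t : n.+1.-tuple S0) : (t : seq S0) <> [::] by case: t => -[].
have mY n (t : n.+1.-tuple S0) : measurable (Y t) by have [] := HY t (tn _ t).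
have triv n (A : n.+1.-tuple S0 -> set X) : (forall t, A t `<=` Lw t) -> trivIset setT A.
  move=> AL; apply/trivIsetP => t1 t2 _ _ t12; apply/seteqP; split => // x [/AL h1 /AL h2].
  move: h1 h2; rewrite /Lw /= !size_tuple => h1 h2.
  by case/eqP: t12; apply: val_inj; exact: etrans (esym h1) h2.
have mYY n : measurable (YY n) /\ YY n `<=` fib H.
  split; last by move=> y [t _ Yt]; have [_ h _ _] := HY t (tn _ t); have [] := h _ Yt.
  by apply: fin_bigcup_measurable => //; exact: finite_finset.
have low n : ((k `^ dl * fine (mu Z))%:E <= mu (YY n))%E.
  have mZL (t : n.+1.-tuple S0) : measurable ((Z `&` Lw t) : set (borel_at x0)).
    by apply: measurableI => //; exact: measurable_Lw.
  have ZE : Z = \bigcup_(t in [set: n.+1.-tuple S0]) (Z `&` Lw t).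
    apply/seteqP; split => x; last by case=> t _ [].
    move=> Zx; exists (mktuple (fun i => lt_ x i)) => //; split => //.
    rewrite /Lw /= size_map size_enum_ord /mkseq -val_enum_ord -map_comp; exact: eq_map.
  rewrite EFinM fineK ?ge0_fin_numE// {1}ZE.
  rewrite measure_fin_bigcup//; [|exact: finite_finset|by apply: triv => t x []].
  rewrite measure_fin_bigcup//; [|exact: finite_finset|].
    rewrite ge0_mule_fsumr//; apply: lee_fsum; first exact: finite_finset.
    by move=> t _; have [_ _ h _] := HY t (tn _ t).
  by apply: triv => t x Yt; have [_ h _ _] := HY t (tn _ t); have [] := h _ Yt.
have c0 : 0 < k `^ dl * fine (mu Z).
  by rewrite mulr_gt0 ?powR_gt0// fine_gt0// Z0.
have [z Hz] := infinitely_often (@measurable_fib _ _ _ _ _ _ _ x0 H) finH mYY c0 low.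
have spec n : YY n z -> exists a w, [/\ path trb a w, size w = n, cd z <> xi, closure (icyl (a :: w)) xi & closure (icyl (a :: w)) (cd z)].
  case=> t _ Yt; have [_ _ _ h] := HY t (tn _ t); have [] := h _ Yt.
  case: t {Yt h} => -[//|a w] /= /eqP[sz] *; by exists a, w.
have [m _ /spec[_ [_ [_ _ zx _ _]]]] := Hz 0%N.
have d0 : 0 < csq (cd z) xi by apply: csq_gt0; apply/eqP.
have [n0 Hn] := small_cylinders hF hB d0.
have [m2 nm /spec[a [w [pw sz _ c1 c2]]]] := Hz n0.
by have := Hn a w pw; rewrite sz => /(_ nm _ _ c2 c1); rewrite ltxx.
Qed.
End Null.
End NullFibers.

(** * The countable exceptional set *)

Section ExceptionalSet.
Variables (R : realType) (G0 : set (smap R)) (S0 : finType).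
Variables (I : S0 -> set (circle R)) (e : S0 -> smap R) (f : circle R -> circle R).
Hypothesis hF : fuchsian G0.
Hypothesis hB : bowen_series G0 I e f.
Local Notation icyl := (icyl I e).

Lemma icyl_mkseq (s : nat -> S0) x n :
  (forall i, (I (s i))° (act (winv e (mkseq s i)) x)) -> icyl (mkseq s n) x.
Proof.
elim: n s x => [//|n IH] s x h; rewrite mkseq_cons /=; split.
  by have := h 0%N; rewrite /= act_id.
apply: IH => i; have := h i.+1; rewrite mkseq_cons (winv_cons e) act_comp//.
  exact: (winv_isu hF hB).
exact: (sinv_isu hF hB).
Qed.

Lemma exists_exceptional : exists C : set (circle R),
  [/\ countable C, (forall g x, G0 g -> ~ C x -> ~ C (act g x)),
    (forall a x, ~ C x -> I a x -> (I a)° x) &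
    forall h x, G0 h -> ~ C x -> exists w w',
      [/\ icyl w x, icyl w' (act h x) & winv e w = winv e w' \o h]].
Proof.
have [E fE HE] := bs_orb hB.
have fB : finite_set (\bigcup_(a in [set: S0]) (I a `\` (I a)°)).
  by apply: bigcup_finite => [|a _]; [exact: finite_finset|exact: (I_bd_finite hB)].
(* All translates of the exceptions in (Orb) and of the arc endpoints, together with the fixed
   points of nontrivial elements. Off the latter, u x = u' h x implies u = u' h. *)
pose C := \bigcup_(g in G0) ([set act g y | y in E `|` \bigcup_(a in [set: S0]) (I a `\` (I a)°)]
  `|` [set x | g <> id /\ act g x = x]).
have EC x : E x \/ (exists a, I a x /\ ~ (I a)° x) -> C x.
  move=> h; exists id; first exact: (fuchs_id hF).
  left; exists x; last exact: act_id.
  by case: h => [Ex|[a h]]; [left|right; exists a].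
have inv g x : G0 g -> C (act g x) -> C x.
  move=> Gg; have ig := fuchs_isu hF Gg; have [ig' g1 g2] := isu_sinv ig.
  have Gg' := fuchs_sinv hF Gg.
  case=> h Gh [[y Ey yx]|[hid fx]]; have ih := fuchs_isu hF Gh.
    exists (sinv g \o h); first exact: (fuchs_comp hF).
    by left; exists y => //; rewrite act_comp// yx actK.
  exists (sinv g \o (h \o g)); first by do 2 apply: (fuchs_comp hF) => //.
  right; split; last by rewrite (act_comp _ ig' (isu_comp ih ig)) (act_comp _ ih ig) fx actK.
  move=> k; apply: hid.
  have : g \o (sinv g \o (h \o g)) \o sinv g = h.
    by change ((g \o sinv g) \o h \o (g \o sinv g) = h); rewrite g1.
  by rewrite k => <-; exact: g1.
have Cint a x : ~ C x -> I a x -> (I a)° x.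
  by move=> nC Ix; apply: contrapT => nI; apply: nC; apply: EC; right; exists a.
exists C; split => //.
- apply: bigcup_countable; first exact: (fuchs_countable hF).
  move=> g Gg; apply: finite_set_countable; rewrite finite_setU; split.
    by apply: finite_image; rewrite finite_setU.
  have [gid|gid] := EM (g = id).
    by apply: (sub_finite_set _ (finite_set0 _)) => x [].
  apply: sub_finite_set (fixed_points_finite (fuchs_isu hF Gg) gid) => x []; by [].
- by move=> g x Gg nC /(inv _ _ Gg).
move=> h x Gh nC; have ih := fuchs_isu hF Gh.
have nC' : ~ C (act h x) by move/(inv _ _ Gh).
have codes y : ~ C y -> exists s, forall n, icyl (mkseq s n) y.
  move=> ny; have [s [st sy]] := code_of hF hB y; exists s => n; apply: icyl_mkseq => i.
  apply: Cint => //; move=> /(inv _ _ (winv_G0 hF hB (mkseq s i))); exact: ny.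
have [s Hs] := codes _ nC; have [s' Hs'] := codes _ nC'.
have nE : ~ E x by move=> Ex; apply: nC; apply: EC; left.
have nE' : ~ E (act h x) by move=> Ex; apply: nC'; apply: EC; left.
(* By (Orb) the [f]-orbits of x and h x merge; along their codes the iterates of [f] are the group
   elements [winv e]. *)
have [n [m nm]] : exists n m, iter n f (act h x) = iter m f x.
  by apply/(HE _ _ nE' nE); exists h => //; rewrite actE.
have it t y k : icyl (mkseq t k) y -> iter k f y = act (winv e (mkseq t k)) y.
  by move=> ty; have := iter_icyl hF hB ty (k := k); rewrite size_mkseq take_oversize ?size_mkseq// => ->.
rewrite (it _ _ _ (Hs' n)) (it _ _ _ (Hs m)) in nm.
have key : winv e (mkseq s m) = winv e (mkseq s' n) \o h; last first.
  by exists (mkseq s m), (mkseq s' n); split; [exact: Hs|exact: Hs'|exact: key].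
set u := winv e (mkseq s m) in nm *; set u' := winv e (mkseq s' n) in nm *.
have Gu : G0 u by exact: (winv_G0 hF hB).
have Gu' : G0 u' by exact: (winv_G0 hF hB).
have iu := fuchs_isu hF Gu; have iu' := fuchs_isu hF Gu'.
have [iis h1 h2] := isu_sinv iu.
have [kid|kid] := EM (sinv u \o (u' \o h) = id).
  have E1 : u \o (sinv u \o (u' \o h)) = u' \o h.
    by apply/funext => y; exact: (congr1 (fun F => F (u' (h y))) h1).
  by transitivity (u \o (sinv u \o (u' \o h))); [rewrite kid|exact: E1].
exfalso; apply: nC; exists (sinv u \o (u' \o h)).
  by apply: (fuchs_comp hF); [exact: (fuchs_sinv hF)|exact: (fuchs_comp hF)].
right; split => //; by rewrite (act_comp _ iis (isu_comp iu' ih)) (act_comp _ iu' ih) nm actK.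
Qed.

Lemma countable_null (m : {measure set (borel_circle R) -> \bar R}) (C : set (borel_circle R)) :
  (forall x, measurable [set x : borel_circle R]) -> countable C ->
  measurable C /\ ((forall x, m [set x] = 0%E) -> m C = 0%E).
Proof.
move=> mp cC; have [[c0 Cc]|nC] := EM (exists x, C x); last first.
  by have -> : C = set0 by [apply/seteqP; split => // x Cx; apply: nC; exists x]; split => // _; rewrite measure0.
have [h [hC Ch]] := countable_enum Cc cC.
have -> : C = \bigcup_n [set h n].
  by apply/seteqP; split => x; [move=> /Ch[n <-]; exists n|case=> n _ ->].
split; first by apply: bigcup_measurable => n _; exact: mp.
move=> m0; have [B [mB mB0 AB]] : m.-negligible (\bigcup_n [set h n]).
  by apply: negligible_bigcup => n; exists [set h n]; split.
apply/eqP; rewrite -measure_le0 -mB0 le_measure ?inE//.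
by apply: bigcup_measurable => n _; exact: mp.
Qed.
End ExceptionalSet.

(** * Weighted images of measures *)

Section WeightedPushforward.
Local Open Scope ereal_scope.
Context d1 d2 (T1 : measurableType d1) (T2 : measurableType d2) (R : realType).
Variables (m : {measure set T1 -> \bar R}) (w : T1 -> R) (t : T1 -> T2).
Hypotheses (mw : measurable_fun setT w) (w0 : forall x, (0 <= w x)%R).
Hypothesis mt : measurable_fun setT t.

Definition wpush of measurable_fun setT w & (forall x, (0 <= w x)%R) & measurable_fun setT t :=
  fun A : set T2 => \int[m]_(x in t @^-1` A) (w x)%:E.

Let wpush0 : wpush mw w0 mt set0 = 0.
Proof. by rewrite /wpush preimage_set0 integral_set0. Qed.

Let wpush_ge0 A : 0 <= wpush mw w0 mt A.
Proof. by apply: integral_ge0 => x _; rewrite lee_fin. Qed.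

Let wpush_sigma : semi_sigma_additive (wpush mw w0 mt).
Proof.
move=> F mF tF mUF; rewrite /wpush preimage_bigcup.
have mtF n : measurable (t @^-1` F n) by rewrite -[X in measurable X]setTI; exact: mt.
apply: (@measure_semi_sigma_additive _ _ _ (wmeas m mw w0) (fun n => t @^-1` F n)) => //.
- apply/trivIsetP => /= i j _ _ ij; rewrite -preimage_setI.
  by move/trivIsetP : tF => /(_ _ _ _ _ ij) ->//; rewrite preimage_set0.
- by apply: bigcup_measurable => n _.
Qed.

HB.instance Definition _ := isMeasure.Build _ _ _ (wpush mw w0 mt) wpush0 wpush_ge0 wpush_sigma.

Lemma wpush_integral (F : T2 -> \bar R) : measurable_fun setT F -> (forall x, 0 <= F x) ->
  \int[wpush mw w0 mt]_x F x = \int[m]_x ((w x)%:E * F (t x)).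
Proof.
move=> mF F0.
transitivity (\int[wpush mw w0 mt]_x ((cst 1%R x)%:E * F x)).
  by apply: eq_integral => x _; rewrite mul1e.
apply: (@transfer_integral _ _ _ _ R m (wpush mw w0 mt) w (cst 1%R) t) => //.
move=> B mB; have c1 : \int[wpush mw w0 mt]_(x in B) (cst 1%R x)%:E = 1%:E * wpush mw w0 mt B.
  exact: (integral_cst _ mB 1%:E).
by rewrite c1 mul1e.
Qed.
End WeightedPushforward.

Lemma cover_eq (d : measure_display) (T : measurableType d) (R : realType)
    (m1 m2 : {measure set T -> \bar R}) (E : nat -> set T) :
  (forall n, measurable (E n)) -> \bigcup_n E n = setT ->
  (forall n A, measurable A -> A `<=` E n -> m1 A = m2 A) ->
  forall A, measurable A -> m1 A = m2 A.
Proof.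
move=> mE UE HE A mA.
have mS n : measurable (seqDU E n).
  by rewrite /seqDU; apply: measurableD => //; apply: bigsetU_measurable.
have AE : A = \bigcup_n (A `&` seqDU E n) by rewrite -setI_bigcupr -seqDU_bigcup_eq UE setIT.
have tr : trivIset setT (fun n => A `&` seqDU E n) by apply: trivIset_setIl; exact: trivIset_seqDU.
rewrite AE !measure_bigcup//; try by move=> i _; exact: measurableI.
apply: eq_eseriesr => n _; apply: (HE n); first exact: measurableI.
by move=> x [_ []].
Qed.

Lemma indic_nonneg (T : Type) (R : realType) (A : set T) (x : T) : 0 <= \1_A x :> R.
Proof. by rewrite indicE. Qed.

(** * From eigenmeasures to conformal families *)

Section Families.
Variables (R : realType) (G0 G : set (smap R)) (S0 : finType).
Variables (I : S0 -> set (circle R)) (e : S0 -> smap R) (f : circle R -> circle R).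
Hypothesis hF : fuchsian G0.
Hypothesis hN : normal_subgroup G G0.
Hypothesis hB : bowen_series G0 I e f.
Variable dl : R.
Variable C : set (circle R).
Hypotheses (Ccount : countable C) (Cinv : forall g x, G0 g -> ~ C x -> ~ C (act g x)).
Hypothesis Cint : forall a x, ~ C x -> I a x -> (I a)° x.
Hypothesis Corb : forall h x, G0 h -> ~ C x -> exists w w',
  [/\ icyl I e w x, icyl I e w' (act h x) & winv e w = winv e w' \o h].
Implicit Types (a b c : S0) (w v : seq S0) (g h : smap R) (H : set (smap R)).
Local Notation trb := (trb I e).
Local Notation icyl := (icyl I e).
Local Notation X := (Xspace G0 G I e f).
Local Notation bc := (borel_circle R).

(** Off the invariant set [C] no image under a word is an arc endpoint, so every lift of a point has
    the same letters. *)
Lemma letters_icyl (x : X) w : ~ C (cd x) ->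
  (mkseq (lt_ x) (size w) = w <-> icyl w (cd x)).
Proof.
move=> nC; have cx := cd_coded hF hB x.
have Hx n : icyl (mkseq (lt_ x) n) (cd x).
  apply: (icyl_mkseq hF hB) => i; apply: Cint; last exact: cx.2.
  by apply: Cinv => //; exact: (winv_G0 hF hB).
split=> [h|cw]; first by rewrite -h; exact: Hx.
by have := icyl_prefix hB (Hx (size w)) cw; rewrite size_mkseq take_size => /(_ (leqnn _)).
Qed.

Lemma icyl_sorted w b y : icyl w y -> (I b)° (act (winv e w) y) -> sorted trb (rcons w b).
Proof.
elim: w y => [//|a w IH] y [Ia cw] Ib.
have ia := e_isu hF hB a; have ia' := sinv_isu hF hB a.
rewrite (winv_cons e) act_comp// in Ib; last exact: (winv_isu hF hB).
have sw := IH _ cw Ib.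
have meet c : (I c)° (act (sinv (e a)) y) -> trb a c.
  by move=> Ic; apply/trbP; apply: (tr_meet hF hB Ic); rewrite actKV.
case: w {IH} cw Ib sw => [|c w] /=; first by rewrite act_id => _ /meet ->.
by move=> [/meet -> _] _ ->.
Qed.

(** The conformal relation between fibres tested on nonnegative functions, a form in which the chain
    rule composes it directly. *)
Definition conformal_family (M : set (smap R) -> {measure set bc -> \bar R}) : Prop :=
  forall k H (F : bc -> \bar R), G0 k -> quotient_group G0 G H ->
  measurable_fun setT F -> (forall x, 0 <= F x)%E ->
  (\int[M (lcoset k H)]_y F y = \int[M H]_y ((der k y `^ dl)%:E * F (act k y)))%E.

Lemma measurable_point (x : bc) : measurable [set x].
Proof. exact: measurable_pt. Qed.

Lemma measurable_C : measurable (C : set bc).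
Proof. by have [] := countable_null (@mzero _ bc R) measurable_point Ccount. Qed.

Lemma measurable_icyl w : measurable (icyl w : set bc).
Proof. apply: sub_sigma_algebra; exact: (icyl_open hF hB). Qed.

Lemma measurable_der_comp k (F : bc -> \bar R) : isu k -> measurable_fun setT F ->
  measurable_fun setT ((fun y => ((der k y `^ dl)%:E * F (act k y))%E) : bc -> \bar R).
Proof.
move=> ik mF; apply: emeasurable_funM.
  by apply/measurable_EFinP; exact: (measurable_der_pow dl ik).
exact: (measurableT_comp mF (measurable_act ik)).
Qed.

Section OfEigenmeasure.
Variable x0 : X.
Variable mu : {measure set (borel_at x0) -> \bar R}.
Hypotheses (jmu : jac dl mu).
Hypothesis nmu : forall xi H, quotient_group G0 G H -> mu [set x : X | gp x = H /\ cd x = xi] = 0%E.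

Definition fmeas H : {measure set bc -> \bar R} :=
  wpush mu (measurable_indic (@measurable_fib _ _ _ _ _ _ _ x0 H) : measurable_fun setT (\1_(fib H) : borel_at x0 -> R))
    (@indic_nonneg _ R (fib H)) (measurable_cd hF hB (x0:=x0)).

Lemma fmeas_int H (F : bc -> \bar R) : measurable_fun setT F -> (forall x, 0 <= F x)%E ->
  (\int[fmeas H]_y F y = \int[mu]_x ((\1_(fib H) x)%:E * F (cd x)))%E.
Proof. by move=> mF F0; rewrite (wpush_integral mu _ _ _ mF F0). Qed.

Lemma fmeasE H (A : set bc) : measurable A -> fmeas H A = mu [set x : X | gp x = H /\ A (cd x)].
Proof.
move=> mA; rewrite /fmeas /= /wpush integral_indicI//; first exact: measurable_fib.
have := measurable_cd hF hB (x0:=x0) measurableT mA; by rewrite setTI.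
Qed.

Lemma fmeas_C H : quotient_group G0 G H -> fmeas H C = 0%E.
Proof.
move=> qH; have [_ h] := countable_null (fmeas H) measurable_point Ccount.
by apply: h => x; rewrite fmeasE; [exact: nmu|exact: measurable_point].
Qed.

(** [jac_word] read on the circle. For [F] supported in the cylinder of [w] off [C], the indicator
    of [Lw w] may be inserted freely, and where [w] may not precede a point both sides vanish by
    [icyl_sorted]. *)
Lemma fmeas_word w H (F : bc -> \bar R) : measurable_fun setT F -> (forall x, 0 <= F x)%E ->
  (forall x, ~ (icyl w x /\ ~ C x) -> F x = 0%E) ->
  (\int[fmeas H]_y F y = \int[fmeas (lcoset (winv e w) H)]_y
    ((der (sinv (winv e w)) y `^ dl)%:E * F (act (sinv (winv e w)) y)))%E.
Proof.
move=> mF F0 Fw; have iu := winv_isu hF hB w; have [iu' _ _] := isu_sinv iu.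
set u := winv e w in iu iu' *.
have mF' := measurable_der_comp iu' mF.
rewrite (fmeas_int _ mF F0) (fmeas_int _ mF'); last by move=> x; rewrite mule_ge0// lee_fin powR_ge0.
pose F1 (x : X) := ((\1_(fib H) x)%:E * F (cd x))%E.
have mF1 : measurable_fun setT (F1 : borel_at x0 -> \bar R).
  apply: emeasurable_funM; last exact: (measurableT_comp mF (measurable_cd hF hB (x0:=x0))).
  by apply/measurable_EFinP/measurable_indic; exact: measurable_fib.
have F10 (x : X) : (0 <= F1 x)%E by rewrite mule_ge0// lee_fin.
transitivity (\int[mu]_x ((\1_(Lw w) x)%:E * F1 x))%E.
  apply: eq_integral => x _; have [[cw nC]|n] := EM (icyl w (cd x) /\ ~ C (cd x)); last first.
    by rewrite /F1 (Fw _ n) !mule0.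
  have xw : Lw w x by exact: (letters_icyl w nC).2.
  have -> : \1_(Lw w) x = 1 :> R by rewrite indicE mem_set.
  by rewrite mul1e.
rewrite (jac_word hF hB jmu w mF1 F10); apply: eq_integral => x _.
have [v|v] := boolP (valid w x).
  have [_ _ h3 h4] := insw_facts hF hB v.
  rewrite /ww v /F1 h4 muleCA; congr (_ * _)%E; congr ((_)%:E).
  rewrite !indicE; congr ((_ : bool)%:R); apply/idP/idP; rewrite !inE /fib /= h3.
    by move=> <-; rewrite lcosetKV.
  by move=> ->; rewrite lcosetK.
rewrite /ww (negbTE v) mul0e.
have [[cw nC]|n] := EM (icyl w (act (sinv u) (cd x)) /\ ~ C (act (sinv u) (cd x))); last first.
  by rewrite (Fw _ n) !mule0.
case/negP: v; apply: (icyl_sorted cw); rewrite actKV//; apply: Cint.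
  by have := Cinv (winv_G0 hF hB w) nC; rewrite actKV.
have [_ h] := cd_coded hF hB x; by have := h 0%N; rewrite /= act_id.
Qed.

(** Reading [w] at x and [w'] at h x leads to the same point and the same coset, so both fibre
    measures are compared with the one reached there. *)
Lemma fmeas_local h w w' H (F : bc -> \bar R) : G0 h -> winv e w = winv e w' \o h ->
  measurable_fun setT F -> (forall x, 0 <= F x)%E ->
  (forall x, ~ [/\ icyl w x, icyl w' (act h x) & ~ C x] -> F (act h x) = 0%E) ->
  (\int[fmeas (lcoset h H)]_y F y = \int[fmeas H]_y ((der h y `^ dl)%:E * F (act h y)))%E.
Proof.
move=> Gh uE mF F0 Fh; have ih := fuchs_isu hF Gh; have [ih' _ _] := isu_sinv ih.
have iu := winv_isu hF hB w; have [iu' u1 u2] := isu_sinv iu.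
have iv := winv_isu hF hB w'; have [iv' v1 v2] := isu_sinv iv.
rewrite (@fmeas_word w' (lcoset h H) F)//; last first.
  move=> x n; rewrite -(actKV x ih); apply: Fh => -[_ cw' nC]; apply: n.
  by rewrite actKV// in cw'; split => //; have := Cinv Gh nC; rewrite actKV.
rewrite (@fmeas_word w H)//; first last.
- move=> x n; rewrite Fh ?mule0// => -[cw _ nC]; exact: n.
- by move=> x; rewrite mule_ge0// lee_fin powR_ge0.
- exact: measurable_der_comp.
rewrite -lcoset_comp -uE; apply: eq_integral => y _.
have sE : sinv (winv e w') = h \o sinv (winv e w).
  have : winv e w \o sinv (winv e w) = id by [].
  rewrite {1}uE => E; rewrite -[LHS]/(sinv (winv e w') \o id) -E.
  by change ((sinv (winv e w') \o winv e w') \o (h \o sinv (winv e w)) = h \o sinv (winv e w)); rewrite v2.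
rewrite sE act_comp// der_comp// powRM ?(ltW (der_gt0 _ _))// EFinM.
by rewrite /= muleA; congr (_ * _)%E; exact: muleC.
Qed.

Lemma fmeas_family : conformal_family fmeas.
Proof.
move=> h H F Gh qH mF F0.
have ih := fuchs_isu hF Gh; have [ih' _ _] := isu_sinv ih.
have mder := measurable_der_pow dl ih; have mact := measurable_act ih.
have p0 (x : bc) : 0 <= der h x `^ dl by exact: powR_ge0.
pose m2 : {measure set bc -> \bar R} := wpush (fmeas H) mder p0 mact.
have m2E A : measurable A -> (m2 A = \int[fmeas H]_y ((der h y `^ dl)%:E * (\1_A (act h y))%:E))%E.
  move=> mA; have mA' : measurable ((act h : bc -> bc) @^-1` A) by rewrite -[X in measurable X]setTI; exact: (mact measurableT _ mA).
  by rewrite /m2 /= /wpush; exact: (integral_weight_indic _ _ mA').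
suff E : forall A, measurable A -> fmeas (lcoset h H) A = m2 A.
  rewrite -(wpush_integral (fmeas H) mder p0 mact mF F0).
  by apply: eq_measure_integral => A mA _; exact: E.
(* A countable cover: index 0 is [C], and the other nonempty pieces are indexed by pairs of words
   along which x and h x merge, as [Corb] provides. *)
pose E n : set bc := if n is m.+1 then [set y | exists p : seq S0 * seq S0, [/\ unpickle m = Some p,
    winv e p.1 = winv e p.2 \o h & [/\ icyl p.1 (act (sinv h) y), icyl p.2 y & ~ C (act (sinv h) y)]]] else C.
have mpre (A : set bc) : measurable A -> measurable ((act (sinv h) : bc -> bc) @^-1` A).
  by move=> mA; rewrite -[X in measurable X]setTI; exact: (measurable_act ih').
have mE n : measurable (E n).
  case: n => [|n] /=; first exact: measurable_C.
  case: (unpickle n) => [p|]; last first.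
    by rewrite (_ : [set _ | _] = set0)//; apply/seteqP; split => // y [p []].
  have [eq|ne] := EM (winv e p.1 = winv e p.2 \o h); last first.
    by rewrite (_ : [set _ | _] = set0)//; apply/seteqP; split => // y [q [[<-] e1 _]]; apply: ne.
  rewrite (_ : [set _ | _] = ((act (sinv h) : bc -> bc) @^-1` (icyl p.1 `&` ~` C)) `&` icyl p.2).
    apply: measurableI; last exact: measurable_icyl.
    by apply: mpre; apply: measurableI; [exact: measurable_icyl|exact: (measurableC measurable_C)].
  apply/seteqP; split => y /=; first by move=> [q [[->] _ [c1 c2 c3]]].
  by move=> [[c1 c2] c3]; exists p.
apply: (cover_eq mE).
  apply/seteqP; split => // y _; have [Cy|nC] := EM (C (act (sinv h) y)).
    exists 0%N => //=; apply: contrapT => ny; exact: (Cinv (fuchs_sinv hF Gh) ny Cy).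
  have [w [w' [c1 c2 c3]]] := Corb Gh nC; exists (pickle (w, w')).+1 => //=.
  by exists (w, w'); rewrite pickleK; split => //; split => //; move: c2; rewrite actKV.
move=> [|n] A mA AE.
  transitivity (0%E : \bar R).
    apply/eqP; rewrite -measure_le0 -(fmeas_C (quotient_lcoset hF Gh qH)).
    by rewrite le_measure ?inE//; exact: measurable_C.
  apply/esym; rewrite /m2 /= /wpush; apply: null_set_integral.
  - by rewrite -[X in measurable X]setTI; exact: (mact measurableT _ mA).
  - by apply/measurable_EFinP; exact: (measurable_funTS mder).
  - apply/eqP; rewrite -measure_le0 -(fmeas_C qH) le_measure ?inE//; last first.
    + by move=> y /AE Cy; apply: contrapT => ny; exact: (Cinv Gh ny Cy).
    + exact: measurable_C.
    + by rewrite -[X in measurable X]setTI; exact: (mact measurableT _ mA).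
have [[y0 Ay0]|A0] := EM (exists y, A y); last first.
  have -> : A = set0 by apply/seteqP; split => // y Ay; apply: A0; exists y.
  by rewrite !measure0.
have [p [np pe _]] := AE _ Ay0.
have -> : fmeas (lcoset h H) A = (\int[fmeas (lcoset h H)]_y (\1_A y)%:E)%E.
  by rewrite integral_indicI// setIT.
rewrite m2E//; apply: (fmeas_local H Gh pe) => //.
  by apply/measurable_EFinP; exact: measurable_indic.
move=> x n1; rewrite indicE; have [|//] := boolP (act h x \in A).
rewrite inE => /AE[q []]; rewrite np => -[<-] _ []; rewrite actK// => c1 c2 c3.
by case: n1.
Qed.
End OfEigenmeasure.
End Families.

(** * Conformal measures and their extension to all cosets *)

Section ConformalMeasures.
Variables (R : realType) (G0 G : set (smap R)) (S0 : finType).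
Variables (I : S0 -> set (circle R)) (e : S0 -> smap R) (f : circle R -> circle R).
Hypothesis hF : fuchsian G0.
Hypothesis hN : normal_subgroup G G0.
Hypothesis hB : bowen_series G0 I e f.
Variables (g1 : smap R) (dl : R).
Hypotheses (Gg1 : G g1) (g1id : g1 <> id) (dl0 : 0 <= dl).

Implicit Types (a b c : S0) (w v : seq S0) (g h k : smap R) (H : set (smap R)).
Local Notation trb := (trb I e).
Local Notation icyl := (icyl I e).
Local Notation bc := (borel_circle R).

Lemma circle_imageE g (A : set (circle R)) : isu g ->
  circle_image g A = act (sinv g) @^-1` A.
Proof.
move=> ig; have [ig' _ _] := isu_sinv ig; apply/seteqP; split => y /=.
  by move=> [x Ax]; rewrite actE// => /on_sphere_inj <-; rewrite actK.
by move=> Ay; exists (act (sinv g) y) => //; rewrite actE// actKV.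
Qed.

Section Conformal.
Variable nu : {measure set bc -> \bar R}.
Hypothesis hnu : conformal G dl nu.

Lemma conformal_preimage g (A : set bc) : G g -> measurable A ->
  nu ((act (sinv g) : bc -> bc) @^-1` A) = (\int[nu]_(x in A) (der g x `^ dl)%:E)%E.
Proof.
move=> Gg mA; have := hnu.2 g Gg A mA; rewrite circle_imageE; last exact: (normal_isu hF hN Gg).
by move=> ->; apply: eq_integral => x _; rewrite der.unlock.
Qed.

Lemma conformal_integral g (F : bc -> \bar R) : G g -> measurable_fun setT F -> (forall x, 0 <= F x)%E ->
  (\int[nu]_x F x = \int[nu]_x ((der g x `^ dl)%:E * F (act g x)))%E.
Proof.
move=> Gg mF F0; have ig := normal_isu hF hN Gg.
have mder := measurable_der_pow dl ig; have mact := measurable_act ig.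
transitivity (\int[nu]_x ((cst 1%R x)%:E * F x))%E.
  by apply: eq_integral => x _; rewrite mul1e.
apply: (@transfer_integral _ _ _ _ R nu nu (fun x => der g x `^ dl) (cst 1%R) (act g)) => //.
- by move=> x; exact: powR_ge0.
- move=> B mB; have c1 : (\int[nu]_(x in B) (cst 1%R x)%:E = 1%:E * nu B)%E by exact: (integral_cst _ mB 1%:E).
  rewrite c1 mul1e -conformal_preimage//.
    by congr (nu _); apply/seteqP; split => x /=; rewrite actKV.
  by rewrite -[X in measurable X]setTI; exact: (mact measurableT _ mB).
Qed.

(** The inserted loop, inverted and conjugated by the prefix, is an element [g n] of [G] with
    derivative at least [k] at [xi]. Conformality then gives the point [g n] xi at least k^delta
    times the mass of an atom at [xi], while these points differ from [xi] and converge to it. *)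
Lemma conformal_point xi : nu [set xi] = 0%E.
Proof.
have [//|nz] := eqVneq (nu [set xi]) 0%E; exfalso.
have c0 : (0 < nu [set xi])%E by rewrite lt0e nz measure_ge0.
have finx : (nu [set xi] < +oo)%E.
  apply: le_lt_trans hnu.1; apply: le_measure; rewrite ?inE//; exact: measurable_pt.
have [k k0 Hk] := loop_displace hF hN hB Gg1 g1id.
have [s cs] := code_of hF hB xi.
have step n : exists g, [/\ G g, k <= der g xi, act g xi <> xi & closure (icyl (mkseq s n.+1)) (act g xi)].
  have sw : sorted trb (rcons (mkseq s n) (s n)).
    by rewrite -mkseqS; have [h1 _ _ <-] := code_path n cs.1; exact: h1.
  have [r [[_ _ Gr] _ ne dk cl]] := Hk xi _ _ sw (cs.2 n).
  set u := winv e (mkseq s n) in ne dk cl; set U := winv e (_ ++ _) in ne dk cl.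
  have Gu : G0 u by exact: (winv_G0 hF hB).
  have iu := fuchs_isu hF Gu; have [iu' _ _] := isu_sinv iu.
  have iU : isu U by exact: (winv_isu hF hB).
  have [iU' _ _] := isu_sinv iU; have ir := winv_isu hF hB (s n :: r).
  exists (sinv U \o u); split.
  - rewrite /U (winv_cat e) sinv_comp//; apply: (normal_conj hF hN Gu); exact: (normal_sinv hN Gr).
  - rewrite der_comp//; move: dk; rewrite der_sinv// -ler_pdivlMr ?invr_gt0 ?der_gt0// invrK; exact.
  - by rewrite act_comp.
  - by rewrite act_comp// mkseqS.
have [g Hg] := choice step.
have low n : ((k `^ dl * fine (nu [set xi]))%:E <= nu [set act (g n) xi])%E.
  have [Gg kd _ _] := Hg n; have ig := normal_isu hF hN Gg.
  have -> : [set act (g n) xi] = (act (sinv (g n)) : bc -> bc) @^-1` [set xi].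
    apply/seteqP; split => y /=; first by move=> ->; rewrite actK.
    by move=> <-; rewrite actKV.
  rewrite (conformal_preimage Gg (measurable_pt xi)).
  have -> : (\int[nu]_(x in [set xi]) (der (g n) x `^ dl)%:E =
      \int[nu]_(x in [set xi]) (cst (der (g n) xi `^ dl)%:E x))%E.
    by apply: eq_integral => x; rewrite inE => ->.
  rewrite integral_cst; last exact: measurable_pt.
  rewrite EFinM fineK ?ge0_fin_numE// lee_wpmul2r// lee_fin ge0_ler_powR ?nnegrE ?(ltW k0)//.
  exact/ltW/der_gt0.
have c1 : 0 < k `^ dl * fine (nu [set xi]) by rewrite mulr_gt0 ?powR_gt0// fine_gt0// c0.
have mY n : measurable ([set act (g n) xi] : set bc) /\ [set act (g n) xi] `<=` setT.
  by split => //; exact: measurable_pt.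
have [z Hz] := infinitely_often measurableT hnu.1 mY c1 low.
have [m0 _ zE] := Hz 0%N; have [_ _ zx _] := Hg m0; rewrite -zE in zx.
have d0 : 0 < csq z xi by apply: csq_gt0; apply/eqP.
have [n0 Hn] := small_cylinders hF hB d0.
have [m nm zm] := Hz n0; have [_ _ _ cl] := Hg m; rewrite -zm in cl.
have cx := coded_closure hF hB m cs.
have [pt _ _ E1] := code_path m cs.1; rewrite -E1 in cl cx.
by have := Hn _ _ pt; rewrite size_mkseq => /(_ nm _ _ cl cx); rewrite ltxx.
Qed.

Section CosetFamily.
Variable rp : set (smap R) -> smap R.
Hypothesis rpG : forall H, G0 (rp H).
Hypothesis rpH : forall H, quotient_group G0 G H -> H = lcoset (rp H) G.

(** A chosen representative [rp H] enters the definition; conformality under [G] removes the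
    dependence on the choice. *)
Definition cfam H : {measure set bc -> \bar R} :=
  wpush nu (measurable_der_pow dl (fuchs_isu hF (rpG H))) (fun x => powR_ge0 _ dl)
    (measurable_act (fuchs_isu hF (rpG H))).

Lemma cfam_integral H (F : bc -> \bar R) : measurable_fun setT F -> (forall x, 0 <= F x)%E ->
  (\int[cfam H]_x F x = \int[nu]_x ((der (rp H) x `^ dl)%:E * F (act (rp H) x)))%E.
Proof. by move=> mF F0; rewrite (wpush_integral nu _ _ _ mF F0). Qed.

Lemma subgroup_id : G id. Proof. by case: hN => -[]. Qed.

(** The representative of k H is k composed with [rp H] and with an element of [G] on the right,
    which [conformal_integral] absorbs. *)
Lemma cfam_family : conformal_family G0 G dl cfam.
Proof.
move=> k H F Gk qH mF F0; have ik := fuchs_isu hF Gk.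
have ir := fuchs_isu hF (rpG H); have ikr := isu_comp ik ir.
have mF1 := measurable_der_comp dl ik mF.
rewrite (cfam_integral _ mF F0) (cfam_integral _ mF1); last first.
  by move=> x; rewrite mule_ge0// lee_fin powR_ge0.
have [g Gg gE] : lcoset (k \o rp H) G (rp (lcoset k H)).
  rewrite lcoset_comp -(rpH qH) [X in X _](rpH (quotient_lcoset hF Gk qH)).
  by exists id => //; exact: subgroup_id.
have ig := normal_isu hF hN Gg.
have mF2 := measurable_der_comp dl ikr mF.
transitivity (\int[nu]_x ((der (k \o rp H) x `^ dl)%:E * F (act (k \o rp H) x)))%E; last first.
  apply: eq_integral => x _; rewrite der_comp// act_comp// powRM ?(ltW (der_gt0 _ _))// EFinM.
  by rewrite muleA; congr (_ * _)%E; exact: muleC.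
rewrite (conformal_integral Gg mF2); last by move=> x; rewrite mule_ge0// lee_fin powR_ge0.
apply: eq_integral => x _; rewrite -gE.
rewrite (der_comp _ ikr ig) (act_comp _ ikr ig) powRM ?(ltW (der_gt0 _ _))// EFinM.
by rewrite muleA; congr (_ * _)%E; exact: muleC.
Qed.

Lemma quotient_self : quotient_group G0 G G.
Proof. by exists id; [exact: (fuchs_id hF)|exact: lcoset_id]. Qed.

Lemma cfam_self (F : bc -> \bar R) : measurable_fun setT F -> (forall x, 0 <= F x)%E ->
  (\int[cfam G]_x F x = \int[nu]_x F x)%E.
Proof.
move=> mF F0; rewrite (cfam_integral _ mF F0); apply/esym/conformal_integral => //.
by rewrite [X in X _](rpH quotient_self); exists id => //; exact: subgroup_id.
Qed.

Lemma cfam_point H xi : cfam H [set xi] = 0%E.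
Proof.
have ir := fuchs_isu hF (rpG H).
rewrite /cfam /= /wpush (_ : _ @^-1` _ = [set act (sinv (rp H)) xi]); last first.
  by apply/seteqP; split => y /=; [move=> <-; rewrite actK|move=> ->; rewrite actKV].
apply: null_set_integral; [exact: measurable_pt| |exact: conformal_point].
by apply/measurable_EFinP; apply: measurable_funS (measurable_der_pow dl ir).
Qed.

Lemma cfam_finite H : (cfam H setT < +oo)%E.
Proof.
have ir := fuchs_isu hF (rpG H); rewrite /cfam /= /wpush preimage_setT.
apply: (@le_lt_trans _ _ (\int[nu]_x (cst ((4 * nrm (rp H)) `^ dl)%:E x))%E).
  apply: ge0_le_integral => //; first by move=> x _; rewrite lee_fin powR_ge0.
  - by apply/measurable_EFinP; exact: (measurable_der_pow dl ir).
  - move=> x _; rewrite lee_fin ge0_ler_powR ?nnegrE ?(ltW (der_gt0 _ _))//; last exact: der_le.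
    by rewrite mulr_ge0// ltW// nrm_gt0.
rewrite integral_cst// lte_mul_pinfty ?lee_fin ?powR_ge0//; exact: hnu.1.
Qed.
End CosetFamily.
End Conformal.
End ConformalMeasures.

(** * Sections of the coding map, uniqueness and lifting *)

Section Sections.
Variables (R : realType) (G0 G : set (smap R)) (S0 : finType).
Variables (I : S0 -> set (circle R)) (e : S0 -> smap R) (f : circle R -> circle R).
Hypothesis hF : fuchsian G0.
Hypothesis hN : normal_subgroup G G0.
Hypothesis hB : bowen_series G0 I e f.
Variable dl : R.

Variable C : set (circle R).
Hypotheses (Ccount : countable C) (Cinv : forall g x, G0 g -> ~ C x -> ~ C (act g x)).
Hypothesis Cint : forall a x, ~ C x -> I a x -> (I a)° x.
Hypothesis Corb : forall h x, G0 h -> ~ C x -> exists w w',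
  [/\ icyl I e w x, icyl I e w' (act h x) & winv e w = winv e w' \o h].
Implicit Types (a b c : S0) (w v : seq S0) (g h k : smap R) (H : set (smap R)).
Local Notation trb := (trb I e).
Local Notation icyl := (icyl I e).
Local Notation X := (Xspace G0 G I e f).
Local Notation bc := (borel_circle R).

Lemma lift_exists H xi : quotient_group G0 G H -> exists x : X, gp x = H /\ cd x = xi.
Proof.
move=> qH; have [s cs] := code_of hF hB xi.
pose t : seqs R S0 := fun i => (s i, lcoset (winv e (mkseq s i)) H).
have tX : Xset G0 G I e f t.
  split.
  - by move=> i; apply/(tr_sigma hF hB)/trbP; exact: cs.1.
  - by move=> i; apply: (quotient_lcoset hF) => //; exact: (winv_G0 hF hB).
  - by move=> i; rewrite /t /= mkseqS (winv_rcons e) lcoset_comp.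
pose x : X := SigSub (mem_set tX).
have E : set_val x = t by first [reflexivity|exact: SubK].
exists x; split; first by rewrite /gp E /t /= lcoset_id.
apply: (cd_uniq hF hB); have -> : lt_ x = s by apply/funext => i; rewrite /lt_ E.
exact: cs.
Qed.

Lemma lift_uniq (x y : X) : gp x = gp y -> cd x = cd y -> ~ C (cd x) -> x = y.
Proof.
move=> xy cxy nC; apply: X_ext => i; apply: (agree_words (n := i.+1)) => //.
have nC' : ~ C (cd y) by rewrite -cxy.
have cy := letters_icyl hF hB Cinv Cint (mkseq (lt_ y) i.+1) nC'.
have cx := letters_icyl hF hB Cinv Cint (mkseq (lt_ y) i.+1) nC.
rewrite size_mkseq in cx cy; apply: cx.2; rewrite cxy; exact: cy.1.
Qed.

Lemma Xspace_hausdorff : hausdorff_space X.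
Proof.
move=> x y xy; apply: X_ext => i.
by have [z [zx zy]] := xy _ _ (nbhs_coord x i) (nbhs_coord y i); rewrite -zx -zy.
Qed.

Variable x0 : X.

(** The lift of [xi] to the fibre over [H], unique off [C]. The constant value on [C] makes
    preimages of cylinders measurable. *)
Definition sec H xi : X :=
  if `[< C xi >] then x0 else xget x0 [set x : X | gp x = H /\ cd x = xi].

Lemma sec_in H xi : quotient_group G0 G H -> ~ C xi ->
  gp (sec H xi) = H /\ cd (sec H xi) = xi.
Proof.
by move=> qH nC; rewrite /sec asboolF//; have := xgetPex x0 (lift_exists xi qH).
Qed.

Lemma measurable_const_set (P : Prop) : measurable ([set _ | P] : set bc).
Proof.
have [p|np] := EM P.
  by rewrite (_ : [set _ | P] = setT)//; apply/seteqP; split.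
by rewrite (_ : [set _ | P] = set0)//; apply/seteqP; split.
Qed.

Lemma measurable_sec H : quotient_group G0 G H ->
  measurable_fun setT (sec H : bc -> borel_at x0).
Proof.
move=> qH; apply: (@measurability _ _ bc (borel_at x0) setT (sec H) (@cylinders _ _ _ _ _ _ _ x0) (cylinders_generate hF x0)) => _ [B cB <-]; rewrite setTI.
have mC := measurable_C Ccount.
case: cB => [->|[H' [w BE]]]; first by rewrite preimage_set0.
rewrite (_ : _ @^-1` _ = (C `&` [set _ | B x0]) `|` ((~` C `&` icyl w) `&` [set _ | H = H'])).
  apply: measurableU; first by apply: measurableI => //; exact: measurable_const_set.
  apply: measurableI; last exact: measurable_const_set.
  apply: measurableI; first exact: measurableC.
  exact: (measurable_icyl hF hB).
apply/seteqP; split => y /=; have [Cy|nC] := EM (C y).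
- by rewrite /sec asboolT//; left.
- have [sg sc] := sec_in qH nC; rewrite BE => -[gH mw]; right.
  rewrite -gH sg; split=> //; split=> //; rewrite -sc; apply: (letters_icyl hF hB Cinv Cint w _).1 => //.
  by rewrite sc.
- by rewrite /sec asboolT// => -[[]|[[]]].
- have [sg sc] := sec_in qH nC; case=> [[]//|[[_ cw] HH]]; rewrite BE; split; first by rewrite sg.
  by apply: (letters_icyl hF hB Cinv Cint w _).2; rewrite sc.
Qed.

Section Uniqueness.
Variable mu : {measure set (borel_at x0) -> \bar R}.
Hypothesis nmu : forall xi H, quotient_group G0 G H -> mu [set x : X | gp x = H /\ cd x = xi] = 0%E.

(** Off [C] the section inverts the coding map, and the part of the fibre over [C] is null. *)
Lemma fiber_measure H (A : set (borel_at x0)) : quotient_group G0 G H -> measurable A -> A `<=` fib H ->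
  mu A = fmeas hF hB mu H (~` C `&` (sec H : bc -> borel_at x0) @^-1` A).
Proof.
move=> qH mA AH; have mC := measurable_C Ccount.
have mcd := measurable_cd hF hB (x0:=x0).
have mN : measurable ((fun x : X => cd x) @^-1` C : set (borel_at x0)).
  by have := mcd measurableT _ mC; rewrite setTI.
have msA : measurable ((sec H : bc -> borel_at x0) @^-1` A).
  by rewrite -[X in measurable X]setTI; exact: (measurable_sec qH measurableT mA).
rewrite fmeasE; last by apply: measurableI => //; exact: measurableC.
rewrite (measureDI mu mA mN) [X in (_ + X)%E](_ : _ = 0%E) ?adde0.
  congr (mu _); apply/seteqP; split => x /=.
    move=> [Ax nC]; have gx := AH _ Ax; have [sg sc] := sec_in qH nC.
    have sx : sec H (cd x) = x by apply: lift_uniq; rewrite ?sg ?sc ?gx.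
    by split=> //; split=> //; rewrite sx.
  move=> [gx [nC sA]]; have [sg sc] := sec_in qH nC.
  have sx : sec H (cd x) = x by apply: lift_uniq; rewrite ?sg ?sc ?gx.
  by split=> //; rewrite -sx.
apply/eqP; rewrite -measure_le0 -(fmeas_C hF hB Ccount nmu qH) fmeasE//.
have mZ : measurable ([set x : X | gp x = H /\ C (cd x)] : set (borel_at x0)).
  by have := measurableI _ _ (@measurable_fib _ _ _ _ _ _ _ x0 H) mN.
rewrite le_measure ?inE//; first exact: measurableI.
by move=> x [/AH gx Cx].
Qed.
End Uniqueness.

Variable hn : nat -> smap R.
Hypotheses (hnG : forall n, G0 (hn n)) (hnE : forall x : X, exists n, gp x = lcoset (hn n) G).

Lemma quotient_hn n : quotient_group G0 G (lcoset (hn n) G).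
Proof. by exists (hn n). Qed.

Lemma fibers_cover : \bigcup_n fib (lcoset (hn n) G) = [set: borel_at x0].
Proof. by apply/seteqP; split => // x _; have [n gn] := hnE x; exists n. Qed.

Lemma eigen_unique (mu1 mu2 : {measure set (borel_at x0) -> \bar R}) :
  jac dl mu1 -> jac dl mu2 ->
  (forall xi H, quotient_group G0 G H -> mu1 [set x : X | gp x = H /\ cd x = xi] = 0%E) ->
  (forall xi H, quotient_group G0 G H -> mu2 [set x : X | gp x = H /\ cd x = xi] = 0%E) ->
  (forall E : set bc, measurable E -> mu1 [set x : X | gp x = G /\ E (cd x)] = mu2 [set x : X | gp x = G /\ E (cd x)]) ->
  forall A : set (borel_at x0), measurable A -> mu1 A = mu2 A.
Proof.
move=> j1 j2 n1 n2 E12; apply: (@cover_eq _ _ R mu1 mu2 (fun n => fib (lcoset (hn n) G))).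
- by move=> n; exact: measurable_fib.
- exact: fibers_cover.
move=> n A mA AH; have qH := quotient_hn n.
rewrite (fiber_measure n1 qH mA AH) (fiber_measure n2 qH mA AH).
set D := ~` C `&` _.
have mD : measurable (D : set bc).
  apply: measurableI; first exact: (measurableC (measurable_C Ccount)).
  by rewrite -[X in measurable X]setTI; exact: (measurable_sec qH measurableT mA).
have qG : quotient_group G0 G G by exists id; [exact: (fuchs_id hF)|exact: lcoset_id].
have m1 : measurable_fun setT ((fun y => (\1_D y)%:E) : bc -> \bar R).
  by apply/measurable_EFinP; exact: measurable_indic.
have p1 y : (0 <= (\1_D y)%:E :> \bar R)%E by rewrite lee_fin indic_nonneg.
have F1 := fmeas_family hF hB Ccount Cinv Cint Corb j1 n1 (hnG n) qG m1 p1.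
have F2 := fmeas_family hF hB Ccount Cinv Cint Corb j2 n2 (hnG n) qG m1 p1.
rewrite !integral_indicI// !setIT in F1 F2; rewrite F1 F2.
by apply: eq_measure_integral => E mE _; rewrite !fmeasE// E12.
Qed.

Section Lifting.
Variable M : set (smap R) -> {measure set bc -> \bar R}.
Hypothesis famM : conformal_family G0 G dl M.
Hypothesis MC : forall H, M H C = 0%E.
Hypothesis Mfin : forall H, (M H setT < +oo)%E.

(** The enumeration [hn] may meet a coset repeatedly; keeping only the first index makes [lifted]
    carry each fibre once. *)
Definition first_rep n : bool := `[< forall m, (m < n)%N -> lcoset (hn m) G <> lcoset (hn n) G >].

Lemma measurable_indicC : measurable_fun setT (\1_(~` C) : bc -> R).
Proof. by apply: measurable_indic; exact: (measurableC (measurable_C Ccount)). Qed.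

Definition part n : {measure set (borel_at x0) -> \bar R} :=
  if first_rep n then wpush (M (lcoset (hn n) G)) measurable_indicC (@indic_nonneg _ R (~` C))
    (measurable_sec (quotient_hn n)) : {measure set (borel_at x0) -> \bar R}
  else mzero.

Definition lifted : {measure set (borel_at x0) -> \bar R} := mseries part 0.

Lemma lifted_fib H (B : set (borel_at x0)) : quotient_group G0 G H -> measurable B ->
  lifted (fib H `&` B) = (\int[M H]_(x in (sec H : bc -> borel_at x0) @^-1` B) (\1_(~` C) x)%:E)%E.
Proof.
move=> qH mB; have mC := measurable_C Ccount; have mC' := measurableC mC.
have msec K : quotient_group G0 G K -> forall D, measurable D -> measurable ((sec K : bc -> borel_at x0) @^-1` D).
  by move=> qK D mD; rewrite -[X in measurable X]setTI; exact: (measurable_sec qK measurableT mD).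
have mfB : measurable ((fib H `&` B) : set (borel_at x0)).
  by apply: measurableI => //; exact: measurable_fib.
have partE n : first_rep n -> part n (fib H `&` B) = M (lcoset (hn n) G) (~` C `&` (sec (lcoset (hn n) G) : bc -> borel_at x0) @^-1` (fib H `&` B)).
  move=> fn; rewrite /part fn /= /wpush integral_indicI//; exact: (msec _ (quotient_hn n)).
have ex : exists n, `[< lcoset (hn n) G = H >].
  have [x [xH _]] := lift_exists point qH; have [n gn] := hnE x.
  by exists n; apply/asboolP; rewrite -gn.
case: (ex_minnP ex) => n /asboolP nH nmin.
have fn : first_rep n.
  by apply/asboolP => m mn; rewrite nH => mH; have := nmin m (asboolT mH); rewrite leqNgt mn.
rewrite /lifted /= /mseries (nneseriesD1 (n := n))// eseries0 ?adde0.
  rewrite partE// nH integral_indicI//; last exact: msec.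
  congr (M H _); apply/seteqP; split => y /=; first by case=> nC [].
  by case=> nC By; split=> //; split=> //; exact: (sec_in qH nC).1.
move=> k _ kn; have [fk|/negbTE fk] := boolP (first_rep k); last by rewrite /part fk.
rewrite partE// (_ : ~` C `&` _ = set0) ?measure0//.
apply/seteqP; split => // y [nC [yH _]].
have [sg _] := sec_in (quotient_hn k) nC; rewrite /fib /= sg in yH.
have nk := nmin k (asboolT yH); move/asboolP: fk => /(_ n).
rewrite nH yH ltn_neqAle nk andbT eq_sym; move: kn; by case: eqP => // _ _ /(_ isT).
Qed.

Lemma lifted_psi (E : set bc) : measurable E -> lifted [set x : X | gp x = G /\ E (cd x)] = M G E.
Proof.
move=> mE; have qG : quotient_group G0 G G by exists id; [exact: (fuchs_id hF)|exact: lcoset_id].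
have mC := measurable_C Ccount; have mC' := measurableC mC.
have mE' : measurable ((fun x : X => cd x) @^-1` E : set (borel_at x0)).
  by have := measurable_cd hF hB (x0:=x0) measurableT mE; rewrite setTI.
have := lifted_fib qG mE'; rewrite integral_indicI//; last first.
  by rewrite -[X in measurable X]setTI; exact: (measurable_sec qG measurableT mE').
have -> : ~` C `&` (sec G : bc -> borel_at x0) @^-1` ((fun x : X => cd x) @^-1` E) = E `\` C.
  apply/seteqP; split => y /= [h1 h2]; first by have [_ sc] := sec_in qG h1; rewrite sc in h2.
  by have [_ sc] := sec_in qG h2; rewrite sc.
move=> ->; rewrite (measureDI (M G) mE mC) [X in (_ + X)%E](_ : _ = 0%E) ?adde0//.
apply/eqP; rewrite -measure_le0 -(MC G) le_measure ?inE//; first [exact: measurableI|exact: subIsetr].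
Qed.

(** Fibres are open, so finitely many of them cover a compact set, and each has finite mass. *)
Lemma lifted_radon : radon lifted.
Proof.
move=> K cK; pose U n : set X := \big[setU/set0]_(i < n) fib (lcoset (hn i) G).
have mU n : measurable (U n : set (borel_at x0)).
  by apply: bigsetU_measurable => i _; exact: measurable_fib.
have finU n : (lifted (U n) < +oo)%E.
  elim: n => [|n IH]; first by rewrite /U big_ord0 measure0.
  rewrite /U big_ord_recr /=.
  have mf : measurable (fib (lcoset (hn n) G) : set (borel_at x0)) by exact: measurable_fib.
  have fH : (lifted (fib (lcoset (hn n) G)) < +oo)%E.
    have E1 := lifted_fib (quotient_hn n) measurableT; rewrite setIT in E1.
    rewrite E1 preimage_setT integral_indicI ?setIT//; last exact: (measurableC (measurable_C Ccount)).
    apply: le_lt_trans (Mfin (lcoset (hn n) G)); apply: le_measure; rewrite ?inE//.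
    exact: (measurableC (measurable_C Ccount)).
  apply: le_lt_trans (measureU2 _ (mU n) mf) _; exact: lte_add_pinfty.
have oU n : open (fib (lcoset (hn n) G) : set X).
  exact: (@open_finite _ _ _ _ _ _ _ 0%N (fun (H : set (smap R)) _ => H = lcoset (hn n) G)).
have mK : measurable (K : set (borel_at x0)).
  rewrite -[X in measurable X]setCK; apply: measurableC; apply: sub_sigma_algebra.
  by apply: closed_openC; exact: (compact_closed Xspace_hausdorff cK).
have cK' : @cover_compact (pointed_at x0) K by rewrite -compact_cover; exact: cK.
have [D _ KD] := cK' nat setT (fun n => fib (lcoset (hn n) G)) (fun n _ => oU n)
  (fun x _ => let: ex_intro n gn := hnE x in ex_intro2 _ _ n Logic.I gn).
have KU : K `<=` U (\big[maxn/0%N]_(i <- finmap.enum_fset D) i).+1.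
  move=> x /KD[n nD gx]; rewrite /U -(bigcup_mkord _ (fun n => fib (lcoset (hn n) G))).
  by exists n => //=; rewrite ltnS; exact: (@leq_bigmax_seq _ (finmap.enum_fset D) xpredT id n nD isT).
have leKU : (lifted K <= lifted (U (\big[maxn/0%N]_(i <- finmap.enum_fset D) i).+1))%E.
  by apply: le_measure; rewrite ?inE.
exact: (le_lt_trans leKU (finU _)).
Qed.

(** Checked on each fibre: the part of the fibre over [H] with first letter [a] comes by [ins a]
    from the fibre over [H'] = e_a^-1 H. Off [C], [sec H] at e_a(y) is [ins a] applied to [sec H']
    at y whenever the transition is allowed, so the family relation for e_a gives the Jacobian. *)
Lemma lifted_jac : jac dl lifted.
Proof.
move=> a B0 mB0.
have ma := measurable_indic (@measurable_La _ _ _ _ _ _ _ x0 a) : measurable_fun setT (\1_(La a) : borel_at x0 -> R).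
have mwa := measurable_wa hF hB dl (x0:=x0) a.
have mins := measurable_ins hF hB a (x0:=x0).
have wa0 (x : borel_at x0) : 0 <= wa dl a x by exact: wa_ge0.
apply: (@cover_eq _ _ R (wmeas lifted ma (@indic_nonneg _ R (La a))) (wpush lifted mwa wa0 mins)
  (fun n => fib (lcoset (hn n) G)) _ fibers_cover _ _ mB0); first by move=> n; exact: measurable_fib.
move=> n B mB BH; set H := lcoset (hn n) G in BH; have qH : quotient_group G0 G H := quotient_hn n.
have Ga : G0 (e a) := bs_in hB a; have ia := e_isu hF hB a; have ia' := sinv_isu hF hB a.
pose H' := lcoset (sinv (e a)) H.
have qH' : quotient_group G0 G H' by apply: (quotient_lcoset hF) => //; exact: (fuchs_sinv hF).
have HE : H = lcoset (e a) H' by rewrite /H' lcosetKV.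
change ((\int[lifted]_(x in B) (\1_(La a) x)%:E =
  \int[lifted]_(x in (ins a : borel_at x0 -> borel_at x0) @^-1` B) (wa dl a x)%:E)%E).
rewrite integral_indicI//; last exact: measurable_La.
have mLB : measurable ((La a `&` B) : set (borel_at x0)) by apply: measurableI => //; exact: measurable_La.
have msec K : quotient_group G0 G K -> forall D, measurable D -> measurable ((sec K : bc -> borel_at x0) @^-1` D).
  by move=> qK D mD; rewrite -[X in measurable X]setTI; exact: (measurable_sec qK measurableT mD).
have -> : La a `&` B = fib H `&` (La a `&` B).
  by apply/seteqP; split => x; [move=> [x1 x2]; split => //; exact: BH|case].
rewrite (lifted_fib qH mLB) (integral_weight_indic _ _ (msec _ qH _ mLB)).
pose F y := ((\1_(~` C) y)%:E * (\1_((sec H : bc -> borel_at x0) @^-1` (La a `&` B)) y)%:E : \bar R)%E.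
have mF : measurable_fun setT (F : bc -> \bar R).
  apply: emeasurable_funM; apply/measurable_EFinP; first exact: measurable_indicC.
  by apply: measurable_indic; exact: msec.
have F0 y : (0 <= F y)%E by rewrite mule_ge0// lee_fin indic_nonneg.
rewrite -/F [in LHS]HE (famM Ga qH' mF F0).
have mpre : measurable ((ins a : borel_at x0 -> borel_at x0) @^-1` B).
  by rewrite -[X in measurable X]setTI; exact: (mins measurableT _ mB).
rewrite (integral_weight_indic _ _ mpre).
pose K (x : X) := ((wa dl a x)%:E * (\1_((ins a : borel_at x0 -> borel_at x0) @^-1` B) x)%:E : \bar R)%E.
have mK : measurable_fun setT (K : borel_at x0 -> \bar R).
  by apply: emeasurable_funM; apply/measurable_EFinP => //; exact: measurable_indic.
have K0 (x : X) : (0 <= K x)%E by rewrite mule_ge0// lee_fin ?indic_nonneg ?wa_ge0.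
transitivity (\int[M H']_y ((\1_(~` C) y)%:E * K (sec H' y)))%E; last first.
  transitivity (\int[lifted]_x ((\1_(fib H') x)%:E * K x))%E.
    apply/esym; apply: (@transfer_integral _ _ _ _ R (M H') lifted (\1_(~` C)) (\1_(fib H')) (sec H')) => //.
    all: try exact: measurable_indicC.
    all: try by move=> x; exact: indic_nonneg.
    all: try exact: measurable_sec.
    all: try by apply: measurable_indic; exact: measurable_fib.
    move=> D mD; rewrite integral_indicI//; last exact: measurable_fib.
    exact: (lifted_fib qH' mD).
  apply: eq_integral => x _; rewrite indicE; have [|xH] := boolP (x \in fib H'); first by rewrite mul1e.
  rewrite mul0e -/(K x) /K; have [ta|ta] := boolP (trb a (lt_ x 0%N)); last by rewrite wa_out// mul0e.
  rewrite [\1_(_ @^-1` _) x]indicE; have [|_] := boolP (x \in _); last by rewrite mule0.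
  rewrite inE /= => /BH; rewrite /fib /= (ins_gp hF hB)// => gx; case/negP: xH; rewrite inE /fib /=.
  by rewrite /H' -gx lcosetK.
apply: eq_integral => y _; rewrite /F.
have [Cy|nC] := EM (C y).
  rewrite [\1_(~` C) y]indicE memNset ?mul0e; last by move/(_ Cy).
  rewrite indicE memNset ?mul0e ?mule0//; apply; apply: contrapT => n1.
  by have := Cinv (fuchs_sinv hF Ga) n1; rewrite actK// => /(_ Cy).
have nC' := Cinv Ga nC.
rewrite [\1_(~` C) (act (e a) y)]indicE [\1_(~` C) y]indicE !mem_set// !mul1e.
have [xg xc] := sec_in qH' nC; have [zg zc] := sec_in qH nC'.
set x := sec H' y in xg xc *; set z := sec H (act (e a) y) in zg zc *.
have -> : \1_((sec H : bc -> borel_at x0) @^-1` (La a `&` B)) (act (e a) y) = \1_(La a `&` B) z :> R by [].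
rewrite /K; have [ta|ta] := boolP (trb a (lt_ x 0%N)).
  have zx : z = ins a x.
    by apply: lift_uniq; rewrite ?zg ?zc ?(ins_gp hF hB)// ?(ins_cd hF hB)// ?xg ?xc -?HE.
  rewrite wa_in// xc; congr (_ * (_)%:E)%E; rewrite !indicE zx; congr ((_ : bool)%:R).
  apply/idP/idP; rewrite !inE /=; first by case.
  by split => //; rewrite /La /= (ins_lt0 hF hB).
(* A lift of e_a(y) beginning with [a] would put e_a(y) in the interior of [I a] and y in the
   interior of the arc of its first letter, and the Markov property would allow the transition. *)
rewrite wa_out// mul0e indicE memNset ?mule0// => -[za _].
have codex := (cd_coded hF hB x).2 0%N; have codez := (cd_coded hF hB z).2 0%N.
rewrite /= act_id xc in codex; rewrite /= act_id zc za in codez.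
case/negP: ta; apply/trbP; apply: (tr_meet hF hB (y := y)); exact: Cint.
Qed.

End Lifting.
End Sections.

(** Over a finite group the series converges for every exponent, so divergence below [d] makes [G]
    infinite. At exponent 0 every term is 1 and the series over an infinite group diverges, so [d]
    is not negative. *)
Lemma critical_facts (R : realType) (G : set (smap R)) (d : R) :
  is_subgroup G -> critical_exponent G d -> (exists2 g, G g & g <> id) /\ 0 <= d.
Proof.
move=> [Gid _ _] [conv div].
have ninf : infinite_set G.
  move=> fG; have := div (d - 1) ltac:(lra).
  rewrite /poincare_series esum_fset//.
  by rewrite fsumEFin.
split.
  apply: contrapT => n; apply: ninf; apply: (sub_finite_set _ (finite_set1 (id : smap R))) => g Gg /=.
  by apply: contrapT => gid; apply: n; exists g.
rewrite leNgt; apply/negP => d0; have := conv 0 d0; rewrite /poincare_series => fin.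
have E0 : (0 <= \esum_(g in G) (expR (- 0 * hdist 0 (finpart g 0)))%:E)%E.
  by apply: esum_ge0 => i _; rewrite lee_fin expR_ge0.
have fn : (\esum_(g in G) (expR (- 0 * hdist 0 (finpart g 0)))%:E)%E \is a fin_num.
  by rewrite ge0_fin_numE.
pose N := (Num.truncn (fine (\esum_(g in G) (expR (- 0 * hdist 0 (finpart g 0)))%:E)%E)).+1.
have [B BG cB] := infinite_set_fset N ninf.
have : (N%:R%:E <= \esum_(g in G) (expR (- 0 * hdist 0 (finpart g 0)))%:E)%E.
  apply: esum_ge.
  match type of BG with classical_sets.subset ?A _ => exists A end.
    by split => //; exact: finite_fset.
  rewrite fsumEFin; last exact: finite_fset.
  rewrite lee_fin (eq_fsbigr (fun _ => 1)); last by move=> i _; rewrite oppr0 mul0r expR0.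
  rewrite fsbig_finite/=; last exact: finite_fset.
  by rewrite set_fsetK big_const_seq count_predT iter_addr_0 ler_nat.
rewrite -(fineK fn) lee_fin leNgt => /negP; apply.
by rewrite -truncn_lt_nat// fine_ge0.
Qed.

(** * Assembling the correspondence *)

Section Conclusion.
Variables (R : realType) (G0 G : set (smap R)) (S0 : finType).
Variables (I : S0 -> set (circle R)) (e : S0 -> smap R) (f : circle R -> circle R).
Hypothesis hF : fuchsian G0.
Hypothesis hN : normal_subgroup G G0.
Hypothesis hB : bowen_series G0 I e f.
Variable dl : R.

Local Notation X := (Xspace G0 G I e f).
Local Notation bc := (borel_circle R).

Lemma family_conformal (M : set (smap R) -> {measure set bc -> \bar R}) :
  conformal_family G0 G dl M -> (M G setT < +oo)%E -> conformal G dl (M G).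
Proof.
move=> famM fin; split => // g Gg A mA.
have G0g := normal_sub hN Gg; have ig := fuchs_isu hF G0g; have [ig' _ _] := isu_sinv ig.
have qG : quotient_group G0 G G by exists id; [exact: (fuchs_id hF)|exact: lcoset_id].
rewrite circle_imageE//.
have mD : measurable ((act (sinv g) : bc -> bc) @^-1` A).
  by rewrite -[X in measurable X]setTI; exact: (measurable_act ig' measurableT mA).
set D := _ @^-1` A in mD *.
have m1 : measurable_fun setT ((fun y => (\1_D y)%:E) : bc -> \bar R).
  by apply/measurable_EFinP; exact: measurable_indic.
have p1 y : (0 <= (\1_D y)%:E :> \bar R)%E by rewrite lee_fin indic_nonneg.
have := famM _ _ _ G0g qG m1 p1; rewrite (normal_coset hF hN Gg qG) integral_indicI// setIT => ->.
transitivity (\int[M G]_(y in A) (der g y `^ dl)%:E)%E; last first.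
  by apply: eq_integral => x _; rewrite der.unlock.
rewrite (integral_weight_indic _ _ mA); apply: eq_integral => y _; congr (_ * (_)%:E)%E.
by rewrite !indicE; congr ((_ : bool)%:R); apply/idP/idP; rewrite !inE /D /= actK.
Qed.

Lemma jac_combination (x0 : X) (mu1 mu2 : {measure set (borel_at x0) -> \bar R}) (s t : {nonneg R}) :
  jac dl mu1 -> jac dl mu2 -> jac dl (measure_add (mscale s mu1) (mscale t mu2)).
Proof.
move=> j1 j2 a B mB.
have mB' : measurable ((ins a : borel_at x0 -> borel_at x0) @^-1` B).
  by rewrite -[X in measurable X]setTI; exact: (measurable_ins hF hB a measurableT mB).
have m1 : measurable_fun B ((fun x => (\1_(La a) x)%:E) : borel_at x0 -> \bar R).
  by apply: measurable_funTS; apply/measurable_EFinP; apply: measurable_indic; exact: measurable_La.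
have m2 : measurable_fun ((ins a : borel_at x0 -> borel_at x0) @^-1` B) ((fun x => (wa dl a x)%:E) : borel_at x0 -> \bar R).
  by apply: measurable_funTS; apply/measurable_EFinP; exact: (measurable_wa hF hB).
have p1 (x : borel_at x0) : (0 <= (\1_(La a) x : R)%:E)%E by rewrite lee_fin indic_nonneg.
have p2 (x : borel_at x0) : (0 <= (wa dl a x)%:E)%E by rewrite lee_fin wa_ge0.
rewrite !ge0_integral_measure_add//; try by move=> x _.
by rewrite !ge0_integral_mscale// (j1 a B mB) (j2 a B mB).
Qed.
End Conclusion.

Theorem theorem3p1 (R : realType) (Gamma0 Gamma : set (smap R))
    (hfuchs : fuchsian Gamma0) (hcoc : cocompact Gamma0)
    (hnormal : normal_subgroup Gamma Gamma0)
    (S0 : finType) (I : S0 -> set (circle R)) (e : S0 -> smap R)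
    (f : circle R -> circle R) (hBS : bowen_series Gamma0 I e f)
    (deltaGamma delta : R) (hcrit : critical_exponent Gamma deltaGamma)
    (hdelta : deltaGamma <= delta)
    (x0 : Xspace Gamma0 Gamma I e f) :
  [/\ (* psi maps eigenmeasures to conformal measures *)
      forall mu : {measure set (borel_at x0) -> \bar R},
        eigenmeasure delta mu ->
        exists2 nu : {measure set (borel_circle R) -> \bar R},
          conformal Gamma delta nu &
          forall E : set (borel_circle R), measurable E -> nu E = psi mu E,
      (* psi is injective *)
      forall mu1 mu2 : {measure set (borel_at x0) -> \bar R},
        eigenmeasure delta mu1 -> eigenmeasure delta mu2 ->
        (forall E : set (borel_circle R), measurable E ->
           psi mu1 E = psi mu2 E) ->
        forall A : set (borel_at x0), measurable A -> mu1 A = mu2 A,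
      (* psi is surjective *)
      forall nu : {measure set (borel_circle R) -> \bar R},
        conformal Gamma delta nu ->
        exists2 mu : {measure set (borel_at x0) -> \bar R},
          eigenmeasure delta mu &
          forall E : set (borel_circle R), measurable E -> nu E = psi mu E
    & (* psi is affine *)
      forall (s t : {nonneg R}) (mu1 mu2 : {measure set (borel_at x0) -> \bar R}),
        s%:num + t%:num = 1 ->
        eigenmeasure delta mu1 -> eigenmeasure delta mu2 ->
        eigenmeasure delta (measure_add (mscale s mu1) (mscale t mu2)) /\
        forall E : set (borel_circle R), measurable E ->
          (psi (measure_add (mscale s mu1) (mscale t mu2)) E =
           s%:num%:E * psi mu1 E + t%:num%:E * psi mu2 E)%E].
Proof.
have [sG _ _] := hnormal.
have [[g1 Gg1 g1id] dG0] := critical_facts sG hcrit.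
have dl0 : 0 <= delta by exact: le_trans hdelta.
have [C [cC Ci Co Cw]] := exists_exceptional hfuchs hBS.
have [hn [hnG hnE]] := coset_enum Gamma I e f hfuchs.
have qG : quotient_group Gamma0 Gamma Gamma.
  by exists id; [exact: (fuchs_id hfuchs)|exact: lcoset_id].
have psiE (mu : {measure set (borel_at x0) -> \bar R}) E :
    psi mu E = mu [set x : Xspace Gamma0 Gamma I e f | gp x = Gamma /\ E (cd x)].
  by congr (mu _); apply/seteqP; split => x [h1 h2]; split.
have null (mu : {measure set (borel_at x0) -> \bar R}) : eigenmeasure delta mu ->
    jac delta mu /\ forall xi H, quotient_group Gamma0 Gamma H ->
      mu [set x : Xspace Gamma0 Gamma I e f | gp x = H /\ cd x = xi] = 0%E.
  move=> emu; have jmu := eigen_jac hfuchs hBS emu; split => // xi H qH.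
  exact: (fiber_point_null hfuchs hnormal hBS Gg1 g1id dl0 emu.1 jmu xi qH).
split.
- move=> mu emu; have [jmu nmu] := null _ emu.
  exists (fmeas hfuchs hBS mu Gamma); last by move=> E mE; rewrite psiE fmeasE.
  apply: (family_conformal hfuchs hnormal (fmeas_family hfuchs hBS cC Ci Co Cw jmu nmu)).
  rewrite fmeasE//; apply: le_lt_trans (fiber_finite Gamma emu.1).
  have mfG := @measurable_fib _ _ _ _ _ _ _ x0 Gamma.
  rewrite (_ : [set x | _] = fib Gamma)//.
  by apply/seteqP; split => x //= [].
- move=> mu1 mu2 e1 e2 p12; have [j1 n1] := null _ e1; have [j2 n2] := null _ e2.
  apply: (eigen_unique hfuchs hBS cC Ci Co Cw hnG hnE j1 j2 n1 n2) => E mE.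
  by rewrite -!psiE; exact: p12.
- move=> nu hnu.
  (* A set that is not a coset receives the identity, which makes the choice of representatives
     total. *)
  have rep H : exists r, Gamma0 r /\ (quotient_group Gamma0 Gamma H -> H = lcoset r Gamma).
    have [[r Gr rH]|nq] := EM (quotient_group Gamma0 Gamma H); first by exists r; split => // _; rewrite rH.
    by exists id; split; [exact: (fuchs_id hfuchs)|].
  have [rp Hrp] := choice rep.
  have rpG H := (Hrp H).1; have rpH H := (Hrp H).2.
  pose M := cfam hfuchs delta nu rpG.
  have famM : conformal_family Gamma0 Gamma delta M := cfam_family hfuchs hnormal hnu rpG rpH.
  have MC H : M H C = 0%E.
    have [_ h] := countable_null (M H) (@measurable_point R) cC; apply: h => x.
    exact: (cfam_point hfuchs hnormal hBS Gg1 g1id dl0 hnu).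
  have Mfin H : (M H setT < +oo)%E by exact: (cfam_finite hfuchs dl0 hnu).
  exists (lifted hfuchs hBS cC Ci Co x0 hnG M).
    apply: (jac_eigen hfuchs hBS); first exact: lifted_radon.
    exact: lifted_jac.
  move=> E mE; rewrite psiE lifted_psi//.
  have m1 : measurable_fun setT ((fun y => (\1_E y)%:E) : borel_circle R -> \bar R).
    by apply/measurable_EFinP; exact: measurable_indic.
  have p1 y : (0 <= (\1_E y)%:E :> \bar R)%E by rewrite lee_fin indic_nonneg.
  have := cfam_self hfuchs hnormal hnu rpG rpH m1 p1.
  by rewrite !integral_indicI// !setIT => ->.
- move=> s t mu1 mu2 _ e1 e2; have [j1 _] := null _ e1; have [j2 _] := null _ e2.
  have addE A : (measure_add (mscale s mu1) (mscale t mu2) A = s%:num%:E * mu1 A + t%:num%:E * mu2 A)%E.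
    by rewrite measure_addE.
  split; last by move=> E mE; exact: addE.
  apply: (jac_eigen hfuchs hBS); last exact: (jac_combination hfuchs hBS).
  move=> K cK; suff fin : (s%:num%:E * mu1 K + t%:num%:E * mu2 K < +oo)%E.
    by rewrite -addE in fin; exact: fin.
  apply: lte_add_pinfty; apply: lte_mul_pinfty => //.
  + exact: e1.1.
  + exact: e2.1.
Qed.
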